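(* Let $J_0>0$ and let $\gamma,p\in\mathbb{R}$ satisfy $0\le \gamma+2p<1$. Then there exist $\delta>0$ and, with $I=(-\delta,\delta)$, a one-parameter family of kernels $K: I\to\mathcal{K}_{\gamma,p}$, $\delta_0\mapsto K_{\delta_0}$, which is continuous when $\mathcal{K}_{\gamma,p}$ is endowed with the topology generated by the metric $\mathrm{dist}$, such that the following holds. There is a number $Q>1$, independent of $\delta_0$, such that for each $\delta_0\in I\setminus\{0\}$ the equation $$J(x;f)=J_0\quad\text{for each }x>0,\qquad J(x;f)=\int_0^x dy\int_{x-y}^\infty dz\,K_{\delta_0}(y,z)\,y\,f(y)\,f(z),$$ has at least two different solutions. One of the solutions is the power law $$f(x)=\frac{C_0}{x^{\frac{3+\gamma}{2}}},\qquad C_0=b_{\Phi,\gamma}\sqrt{J_0},\qquad b_{\Phi,\gamma}=\left(\int_0^1dy\int_{1-y}^\infty dz\,\frac{(y+z)^\gamma}{y^{\frac{\gamma+1}{2}}z^{\frac{\gamma+3}{2}}}\,\Phi\!\left(\frac{y}{y+z}\right)\right)^{-1/2},$$ where $\Phi(s)=K_{\delta_0}(s,1-s)$. The second solution $f_{\delta_0}$ satisfies $f_{\delta_0}(Qx)=Q^{-\frac{\gamma+3}{2}}f_{\delta_0}(x)$ for all $x>0$, and $f_{\delta_0}$ is not a power law of the form $C x^{-\frac{3+\gamma}{2}}$, $C>0$, in the interval $(1,Q)$.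
   Context: For $\gamma,p\in\mathbb{R}$, $\mathcal{K}_{\gamma,p}$ denotes the class of continuous functions $K\in C((0,\infty)^2)$ of the form $$K(x,y)=(x+y)^\gamma\,\Phi\!\left(\frac{x}{x+y}\right),\qquad \Phi(s)=\Phi(1-s)=K(s,1-s)\ \text{ for }0<s<1,$$ where $\Phi\in C(0,1)$ satisfies $\Phi(s)>0$ for $s\in(0,1)$ and the limit $a:=\lim_{s\to0^+}s^p\Phi(s)$ exists and is strictly positive. The metric on $\mathcal{K}_{\gamma,p}$ is $$\mathrm{dist}(\Phi_1,\Phi_2)=\sup\{\,s^p|\Phi_1(s)-\Phi_2(s)|:\ s\in(0,1)\,\},$$ where a kernel is identified with its function $\Phi$ (the value $+\infty$ is allowed; the topology is generated by the balls of finite radius). A solution is a nonnegative measurable function $f$ on $(0,\infty)$ (a concentration of particles of volume $x$) satisfying $J(x;f)=J_0$ for every $x>0$. *)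

(* Defs.v *)
From HB Require Import structures.
From mathcomp Require Import all_boot all_order all_algebra.
From mathcomp Require Import all_classical all_reals all_analysis.
Import Order.TTheory GRing.Theory Num.Theory.
Import numFieldNormedType.Exports.

Set Implicit Arguments.
Unset Strict Implicit.
Unset Printing Implicit Defensive.

Local Open Scope classical_set_scope.
Local Open Scope ring_scope.

Section kernels.
Context {R : realType}.

(* The function Phi on ]0, 1[ attached to a kernel. *)
Definition profile (K : R -> R -> R) (s : R) : R := K s (1 - s).

Definition in_kernel_class (gamma p : R) (K : R -> R -> R) : Prop :=
  [/\ {within [set z : R * R | 0 < z.1 /\ 0 < z.2],
         continuous (fun z : R * R => K z.1 z.2)} /\
      {within `]0, 1[, continuous (profile K)},
      forall x y, 0 < x -> 0 < y ->
        K x y = (x + y) `^ gamma * profile K (x / (x + y)),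
      forall s, 0 < s < 1 -> profile K s = profile K (1 - s),
      forall s, 0 < s < 1 -> 0 < profile K s &
      exists2 a : R, 0 < a & s `^ p * profile K s @[s --> 0^'+] --> a].

(* Only the values of a kernel on the open quadrant are meaningful: two
   elements that agree there are at distance 0 from each other. *)
Record coag_kernel (gamma p : R) := CoagKernel {
  kernel_fun :> R -> R -> R;
  kernelP : in_kernel_class gamma p kernel_fun }.

Definition kernel_dist (gamma p : R) (K1 K2 : coag_kernel gamma p) : \bar R :=
  ereal_sup [set (s `^ p * `|profile K1 s - profile K2 s|)%:E | s in `]0, 1[].

Definition kernel_ball (gamma p : R) (K1 : coag_kernel gamma p) (e : R) :
    set (coag_kernel gamma p) :=
  [set K2 | (kernel_dist K1 K2 < e%:E)%E].

End kernels.

Section kernel_topology.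
Context {R : realType} (gamma p : R).

Let kernel_dist_le (K1 K2 : coag_kernel gamma p) (s : R) : s \in `]0, 1[ ->
  ((s `^ p * `|profile K1 s - profile K2 s|)%:E <= kernel_dist K1 K2)%E.
Proof. by move=> s01; apply: ereal_sup_ubound; exists s. Qed.

Let kernel_ball_center (K : coag_kernel gamma p) (e : R) :
  0 < e -> kernel_ball K e K.
Proof.
move=> e0; rewrite /kernel_ball /=; apply: (@le_lt_trans _ _ 0%E).
  by apply: ge_ereal_sup => _ [s _ <-]; rewrite subrr normr0 mulr0.
by rewrite lte_fin.
Qed.

Let kernel_ball_sym (K1 K2 : coag_kernel gamma p) (e : R) :
  kernel_ball K1 e K2 -> kernel_ball K2 e K1.
Proof.
rewrite /kernel_ball /=; suff -> : kernel_dist K1 K2 = kernel_dist K2 K1 by [].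
by congr ereal_sup; apply: eq_imagel => s _; rewrite distrC.
Qed.

Let kernel_ball_triangle (K1 K2 K3 : coag_kernel gamma p) (e1 e2 : R) :
  kernel_ball K1 e1 K2 -> kernel_ball K2 e2 K3 -> kernel_ball K1 (e1 + e2) K3.
Proof.
rewrite /kernel_ball /= => h1 h2; rewrite EFinD.
apply: le_lt_trans (lteD h1 h2).
apply: ge_ereal_sup => _ [s s01 <-].
apply: le_trans (leeD (kernel_dist_le K1 K2 s01) (kernel_dist_le K2 K3 s01)).
by rewrite -EFinD lee_fin -mulrDr ler_wpM2l ?powR_ge0// ler_distD.
Qed.

HB.instance Definition _ := gen_eqMixin (coag_kernel gamma p).
HB.instance Definition _ := gen_choiceMixin (coag_kernel gamma p).
HB.instance Definition _ := hasNbhs.Build (coag_kernel gamma p)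
  (nbhs_ (entourage_ (@kernel_ball R gamma p))).
HB.instance Definition _ := Nbhs_isPseudoMetric.Build R (coag_kernel gamma p)
  erefl kernel_ball_center kernel_ball_sym kernel_ball_triangle erefl.

End kernel_topology.

Section flux.
Context {R : realType}.
Local Notation mu := (@lebesgue_measure R).

Definition flux (K : R -> R -> R) (f : R -> R) (x : R) : \bar R :=
  \int[mu]_(y in `]0, x[)
    \int[mu]_(z in `](x - y)%R, +oo[) (K y z * y * f y * f z)%:E.

Definition solution (K : R -> R -> R) (J0 : R) (f : R -> R) : Prop :=
  [/\ measurable_fun (`]0, +oo[ : set R) f,
      forall x, 0 < x -> 0 <= f x &
      forall x, 0 < x -> flux K f x = J0%:E].

Definition b_integral (Phi : R -> R) (gamma : R) : \bar R :=
  \int[mu]_(y in `]0, 1[)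
    \int[mu]_(z in `](1 - y)%R, +oo[)
      ((y + z) `^ gamma / (y `^ ((gamma + 1) / 2) * z `^ ((gamma + 3) / 2))
        * Phi (y / (y + z)))%:E.

(* If the integral were infinite, [fine] would return 0 and so would [b_coef];
   the resulting zero power law has zero flux, hence is no solution for
   J0 > 0. *)
Definition b_coef (Phi : R -> R) (gamma : R) : R :=
  fine (b_integral Phi gamma) `^ (- 2^-1).

Definition power_law (C gamma : R) (x : R) : R := C / x `^ ((3 + gamma) / 2).

End flux.

(* Main.v *)
(**
Put [al = (3 + gamma) / 2], [beta = al + p] (so that [3/2 <= beta < 2]), [f x = G (ln x) / x^al] and
[Phi s = W s * (s (1 - s))^al].  In the variables [y = r (1 - s)], [z = r s] the flux becomes
   [J(x) = int_0^1 (1 - s) W s int_x^(x/(1-s)) G (ln r(1-s)) G (ln rs) dr/r ds],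
a quadratic form in [G] which acts diagonally on the modes [e^(i k om ln x)] around [G = 1], with
multiplier [F(k om) / (i k om)], [F] being an explicit oscillatory integral against [W].  For
[W ~ s^-beta] the real part of [F] grows like [t^(beta - 1)]; adding positive bumps to [W], for which
the values of [F] positively span the plane at [t = pi / ln 2], one can make [F] vanish there, and the
last multiple [om] of [pi / ln 2] at which [F] vanishes is a simple resonance: the multipliers
of the frequencies [k om], [k >= 2], stay bounded below by the size of the bilinear coefficients.
A quasi-Newton iteration started from [G = 1 + 2 eps cos (om ln x)] then produces a nonconstant
periodic [G] with constant flux; the residual at the resonant frequency [om] is absorbed by the
amplitudes [t1], [t2] of two further small bumps in [W].  The family of kernels can be taken constant:
the resulting kernel has both the power law and the log-periodic solution.
*)

Require Import Defs.
From HB Require Import structures.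
From mathcomp Require Import all_boot all_order all_algebra.
From mathcomp Require Import all_classical all_reals all_analysis.
From mathcomp Require Import measurable_realfun complex ring lra.
Import Order.TTheory GRing.Theory Num.Theory.
Import numFieldNormedType.Exports.
Local Open Scope classical_set_scope.
Local Open Scope ring_scope.

Set Implicit Arguments.
Unset Strict Implicit.
Unset Printing Implicit Defensive.
Import ComplexField.Normc.

(** This is a bifurcation from the power law with prescribed amplitude and with the kernel as the
    unknown parameter. The residual at the resonant frequency is complex, hence two real bump
    amplitudes. They act on it with strength 2 eps while it has size eps^2, so they stay of order
    eps and the weight stays positive. The number pi / ln 2 comes from s = 1 / 2, where all terms of
    the oscillating integrand add up to a positive real; the other directions come from s near 0.
    Growth of Re F leaves only finitely many zeros among the multiples of pi / ln 2. The multipliers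
    may decay like |k om|^(beta - 2), but the bilinear coefficients decay at the same rate in the
    output frequency, because the inner integral in r oscillates. Nothing is lost in the inversion:
    corrections live in plain l1, residuals in a weighted l1. The hypothesis on gamma + 2 p enters
    through beta only: beta < 2 makes the flux finite, beta > 1 gives the growth. The mean of the
    residual is never corrected: it only changes the value of the constant flux, and a final scaling
    repairs that. *)

Section ComplexFacts.
Context {R : realType}.
Implicit Types (z w : R[i]) (x y : R).
Local Notation Re := complex.Re.

Definition cis x : R[i] := Complex (cos x) (sin x).

Lemma cis0 : cis 0 = 1.
Proof. by rewrite /cis cos0 sin0. Qed.

Lemma cisD x y : cis (x + y) = cis x * cis y.
Proof. by rewrite /cis cosD sinD; congr Complex; ring. Qed.

Lemma conjc_cis x : conjc (cis x) = cis (- x).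
Proof. by rewrite /cis cosN sinN. Qed.

Lemma normc_cis x : normc (cis x) = 1.
Proof. by rewrite /= cos2Dsin2 sqrtr1. Qed.

Lemma normc_ge0 z : 0 <= normc z.
Proof. by case: z => a b; rewrite sqrtr_ge0. Qed.

Lemma normcD z w : normc (z + w) <= normc z + normc w.
Proof. exact: le_normcD. Qed.

Lemma normcN' z : normc (- z) = normc z.
Proof. exact: (@normcN R z). Qed.

Lemma normcJ' z : normc (conjc z) = normc z.
Proof. by case: z => a b /=; rewrite sqrrN. Qed.

Lemma normc_real x : normc (x%:C)%C = `|x|.
Proof. by rewrite /= expr0n addr0 sqrtr_sqr. Qed.

Lemma Re_le_normc z : `|Re z| <= normc z.
Proof.
case: z => a b /=; rewrite -sqrtr_sqr ler_wsqrtr// lerDl sqr_ge0//.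
Qed.

Lemma Im_le_normc z : `|complex.Im z| <= normc z.
Proof.
case: z => a b /=; rewrite -sqrtr_sqr ler_wsqrtr// lerDr sqr_ge0//.
Qed.

Lemma normc_le_ReIm z : normc z <= `|Re z| + `|complex.Im z|.
Proof.
rewrite {1}(complexE z); apply: le_trans (normcD _ _) _.
rewrite normcM normc_real lerD2l normc_real.
by rewrite /= expr0n/= add0r expr1n sqrtr1 mul1r.
Qed.

Lemma ReD z w : Re (z + w) = Re z + Re w.
Proof. by case: z w => [? ?] [? ?]. Qed.

Lemma ReN z : Re (- z) = - Re z.
Proof. by case: z. Qed.

Lemma ReJ z : Re (conjc z) = Re z.
Proof. by case: z. Qed.

Lemma ReZ x z : Re (x%:C%C * z) = x * Re z.
Proof. by case: z => a b /=; rewrite mul0r subr0. Qed.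

Lemma conjcM z w : conjc (z * w) = conjc z * conjc w.
Proof. exact: (rmorphM (@conjc R)). Qed.

Lemma conjc_half : conjc (2^-1 : R[i]) = 2^-1.
Proof. by rewrite (conjc_inv (2 : R[i])) conjc_nat. Qed.

Lemma mul_Re z w : Re z * Re w = Re (z * w / 2) + Re (z * conjc w / 2).
Proof.
rewrite -ReD -mulrDl -mulrDr addcJ.
rewrite (_ : z * _ / 2 = (Re w)%:C%C * z); first by rewrite ReZ mulrC.
by field.
Qed.

Lemma normc_half : normc (2^-1 : R[i]) = 2^-1 :> R.
Proof.
have -> : (2 : R[i]) = (2:R)%:C%C by rewrite rmorph_nat.
by rewrite normcV normc_real ger0_norm.
Qed.

End ComplexFacts.

(** * Finite trigonometric sums and bilinear forms on them *)

Section TrigSums.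
Context {R : realType}.
Local Notation Re := complex.Re.
Local Notation modes := (seq (int * R[i])).
Implicit Types (G H L : modes) (M : int -> int -> R[i]) (X : R) (w : int -> R).

(* A list of pairs (k, c), with possibly repeated frequencies k, stands for the trigonometric sum
   of the Re (c e^(ikX)); [prodm M] is the bilinear form with symbol [M], the two halves coming from
   Re a Re b = (Re (ab) + Re (a conj b)) / 2. *)
Definition ev X G : R := \sum_(e <- G) Re (e.2 * cis (e.1%:~R * X)).
(** With [w k] the modulus of the linear multiplier at [k], a residual is measured by the l1 size of
    the correction that it calls for; [w = 1] gives plain l1. *)
Definition nrm w G : R := \sum_(e <- G) normc e.2 / w e.1.
Definition prodm M G H : modes :=
  [seq (e.1 + h.1, e.2 * h.2 * M e.1 h.1 / 2) | e <- G, h <- H] ++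
  [seq (e.1 - h.1, e.2 * conjc h.2 * M e.1 (- h.1) / 2) | e <- G, h <- H].
Definition scalem (t : R) G : modes := [seq (e.1, t%:C%C * e.2) | e <- G].

Lemma ev_cat X G H : ev X (G ++ H) = ev X G + ev X H.
Proof. by rewrite /ev big_cat. Qed.

Lemma ev_scale X t G : ev X (scalem t G) = t * ev X G.
Proof.
by rewrite /ev big_map mulr_sumr; apply: eq_bigr => e _; rewrite /= -mulrA ReZ.
Qed.

Lemma ev_filterC X (p : pred (int * R[i])) G :
  ev X [seq e <- G | p e] + ev X [seq e <- G | ~~ p e] = ev X G.
Proof. by rewrite /ev !big_filter [RHS](bigID p). Qed.

Lemma nrm_cat w G H : nrm w (G ++ H) = nrm w G + nrm w H.
Proof. by rewrite /nrm big_cat. Qed.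

Lemma nrm_scale w t G : nrm w (scalem t G) = `|t| * nrm w G.
Proof.
rewrite /nrm big_map mulr_sumr; apply: eq_bigr => e _.
by rewrite /= normcM normc_real mulrA.
Qed.

Lemma nrm_ge0 w G : (forall k, 0 < w k) -> 0 <= nrm w G.
Proof.
by move=> w0; apply: sumr_ge0 => e _; rewrite divr_ge0 ?normc_ge0 ?ltW.
Qed.

Lemma nrm_filter w p G : (forall k, 0 < w k) ->
  nrm w [seq e <- G | p e] <= nrm w G.
Proof.
move=> w0; rewrite /nrm big_filter [leRHS](bigID p)/= lerDl.
by apply: sumr_ge0 => e _; rewrite divr_ge0 ?normc_ge0 ?ltW.
Qed.

Lemma norm_ev X G : `|ev X G| <= nrm (fun=> 1) G.
Proof.
rewrite (le_trans (ler_norm_sum _ _ _))//; apply: ler_sum => e _.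
by rewrite (le_trans (Re_le_normc _))// normcM normc_cis mulr1 divr1.
Qed.

Lemma ev_prodm X M G H : ev X (prodm M G H) = \sum_(e <- G) \sum_(h <- H)
  (Re (e.2 * h.2 * M e.1 h.1 / 2 * cis ((e.1 + h.1)%:~R * X)) +
   Re (e.2 * conjc h.2 * M e.1 (- h.1) / 2 * cis ((e.1 - h.1)%:~R * X))).
Proof.
rewrite ev_cat /ev !big_allpairs_dep/= -big_split/=.
by apply: eq_bigr => e _; rewrite -big_split.
Qed.

Lemma ev_prodm_catl X M G1 G2 H :
  ev X (prodm M (G1 ++ G2) H) = ev X (prodm M G1 H) + ev X (prodm M G2 H).
Proof. by rewrite !ev_prodm big_cat. Qed.

Lemma ev_prodm_catr X M G H1 H2 :
  ev X (prodm M G (H1 ++ H2)) = ev X (prodm M G H1) + ev X (prodm M G H2).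
Proof.
rewrite !ev_prodm -big_split/=; apply: eq_bigr => e _.
by rewrite big_cat.
Qed.

(** The bound on [M j l] sees the output frequency only, which is the one that [prodm] records in
    each half; the two halves carry 1/2 each and add up to [C]. *)
Lemma nrm_prodm w M C G H : (forall k, 0 < w k) ->
  (forall j l, normc (M j l) <= C * w (j + l)) ->
  nrm w (prodm M G H) <= C * nrm (fun=> 1) G * nrm (fun=> 1) H.
Proof.
move=> w0 MC; rewrite nrm_cat /nrm !big_allpairs_dep/= -big_split/=.
rewrite -mulrA mulr_suml mulr_sumr; apply: ler_sum => e _.
rewrite -big_split/= !mulr_sumr; apply: ler_sum => h _.
have key (c : R[i]) j l : normc (c * M j l / 2) / w (j + l) <=
    C * normc c / 2.
  rewrite !normcM normc_half ler_pdivrMr//.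
  have := ler_wpM2l (normc_ge0 c) (MC j l); lra.
apply: le_trans (lerD (key _ _ _) (key _ _ _)) _.
rewrite !normcM normcJ' !divr1; lra.
Qed.

End TrigSums.

(* The arithmetic behind the contraction of one iteration step: [n] bounds the residual and is halved,
   [x1], [x2] bound the bump amplitudes. *)
Lemma chord_step_ineq (R : realFieldType) (C e l q n x1 x2 : R) :
  1 <= C -> 0 < e -> 1000 * C ^+ 3 * e <= 1 ->
  0 <= l -> l <= 8 * C * e ^+ 2 -> 0 <= q -> q <= n -> n <= 4 * C * e ^+ 2 ->
  0 <= x1 -> x1 <= 4 * C ^+ 2 * e -> 0 <= x2 -> x2 <= 4 * C ^+ 2 * e ->
  C * (2 * (2 * e + l) * q + q * q)
    + (x1 + x2) * (C * (2 * (1 + 2 * e + l) * q + q * q))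
    + 2 * (C * n / (2 * e)) *
        (C * (2 * (l + q) + (2 * e + l + q) * (2 * e + l + q))) <= n / 2.
Proof.
move=> C1 e0 He l0 hl q0 hq hn x10 hx1 x20 hx2.
have C0 : 0 < C by lra.
have n0 : 0 <= n by lra.
have C2 : C <= C ^+ 2 by rewrite expr2 ler_peMr// ltW.
have C3 : C ^+ 2 <= C ^+ 3 by rewrite [C ^+ 3]exprS ler_peMl ?exprn_ge0 ?(ltW C0) ?(ltW e0).
have Ce : C * e <= 1.
  have : C * e <= C ^+ 3 * e by rewrite ler_pM2r//; lra.
  have : 0 <= C ^+ 3 * e by rewrite mulr_ge0// ?exprn_ge0// ltW.
  lra.
have e1 : e <= 1.
  have : e <= C * e by rewrite ler_peMl ?(ltW e0).
  lra.
have Cee : C * e ^+ 2 <= e by rewrite expr2 mulrA ler_piMl// ltW.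
have qe : q <= 4 * e by lra.
have le' : l <= 8 * e by lra.
have T1 : C * (2 * (2 * e + l) * q + q * q) <= 24 * C ^+ 3 * e * n.
  have : C * ((4 * e + 2 * l + q) * q) <= C * (24 * e * n).
    rewrite ler_pM2l// ler_pM//; lra.
  have : C * (e * n) <= C ^+ 3 * (e * n) by rewrite ler_wpM2r ?mulr_ge0 ?(ltW e0); lra.
  lra.
have T2 : (x1 + x2) * (C * (2 * (1 + 2 * e + l) * q + q * q)) <= 208 * C ^+ 3 * e * n.
  have : (x1 + x2) * (C * ((2 + 4 * e + 2 * l + q) * q)) <= (8 * C ^+ 2 * e) * (C * (26 * n)).
    apply: ler_pM; [lra| | lra |].
      by rewrite !mulr_ge0 ?(ltW C0)//; lra.
    rewrite ler_pM2l// ler_pM//; lra.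
  lra.
have T3 : 2 * (C * n / (2 * e)) *
        (C * (2 * (l + q) + (2 * e + l + q) * (2 * e + l + q))) <= 220 * C ^+ 3 * e * n.
  have h1 : (2 * e + l + q) * (2 * e + l + q) <= (14 * e) * (14 * e).
    by apply: ler_pM; lra.
  have h2 : C * (2 * (l + q) + (2 * e + l + q) * (2 * e + l + q)) <= 220 * C ^+ 2 * e ^+ 2.
    have : C * (2 * (l + q) + (2 * e + l + q) * (2 * e + l + q)) <= C * (220 * C * e ^+ 2).
      rewrite ler_pM2l//.
      have : e ^+ 2 <= C * e ^+ 2 by rewrite ler_peMl ?exprn_ge0 ?(ltW C0) ?(ltW e0).
      lra.
    lra.
  have -> : 2 * (C * n / (2 * e)) = C * n / e by field; rewrite gt_eqF.
  have -> : 220 * C ^+ 3 * e * n = C * n / e * (220 * C ^+ 2 * e ^+ 2).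
    by field; rewrite gt_eqF.
  by rewrite ler_wpM2l// divr_ge0 ?mulr_ge0 ?(ltW C0) ?(ltW e0).
(* 24 + 208 + 220 = 452 is less than 500, so the smallness of [e] leaves at most n / 2. *)
have : 1000 * C ^+ 3 * e * n <= 1 * n by rewrite ler_wpM2r.
lra.
Qed.

(** * Quasi-Newton iteration for a quadratic equation with one resonant frequency *)

Section Iteration.
Context {R : realType}.
Local Notation Re := complex.Re.
Local Notation modes := (seq (int * R[i])).
Implicit Types (G H L r : modes) (M : int -> int -> R[i]) (X : R).

Definition hermitian M := forall j l, M (- j) (- l) = conjc (M j l).
Definition symbol M (k : int) := M 0 k + M k 0.
Definition mode_one : modes := [:: (0, 1)].

Lemma ev_mode0 X G : all (fun e => e.1 == 0) G -> ev X G = ev 0 G.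
Proof.
move=> /allP G0; rewrite /ev !big_seq; apply: eq_bigr => e /G0/eqP ->.
by rewrite !mul0r.
Qed.

(** The product of 1 with a mode [k] has terms at [k] and [- k], the product in the other order two
    terms at [k], all with a factor 1/2. Hermitian symmetry conjugates the term at [- k] into one at
    [k], and the halves add up to the full symbol. *)
Lemma ev_linear_part X M G : hermitian M ->
  ev X (prodm M mode_one G) + ev X (prodm M G mode_one) =
  \sum_(e <- G) Re (e.2 * symbol M e.1 * cis (e.1%:~R * X)).
Proof.
move=> hM; rewrite !ev_prodm big_seq1 -big_split/=; apply: eq_bigr => -[k c] _.
rewrite big_seq1/= /symbol.
have -> : (1 -i* 0)%C = 1 :> R[i] by rewrite oppr0.
have k0 : k + 0 = k by rewrite addr0.
have k1 : 0 + k = k by rewrite add0r.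
have k1' : 0 - k = - k by rewrite sub0r.
rewrite {}k1 {}k1' {}k0.
change (M k (- 0)) with (M k 0).
rewrite !mul1r !mulr1 -[X in M X (- k)]oppr0 hM.
have -> : cis ((- k)%:~R * X) = conjc (cis (k%:~R * X)).
  by rewrite conjc_cis rmorphN mulNr.
have hc (a b d : R[i]) : Re (conjc a * conjc b / 2 * conjc d) = Re (a * b / 2 * d).
  by rewrite -[RHS]ReJ !conjcM conjc_half.
rewrite !hc -!ReD; congr complex.Re; by field.
Qed.

Variables (M0 M1 M2 : int -> int -> R[i]) (C : R).
Hypothesis hC : 1 <= C.
Hypothesis hM0 : hermitian M0.
Hypothesis hM1 : hermitian M1.
Hypothesis hM2 : hermitian M2.
(** At 1 and - 1 the symbol vanishes and the amplitudes [t1], [t2] absorb the residual; at 0 the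
    constant does. No division takes place there, hence the weight 1. *)
Let w (k : int) : R := if (`|k| <= 1)%N then 1 else normc (symbol M0 k).
Hypothesis w_gt0 : forall k, 0 < w k.
Hypothesis M0C : forall j l, normc (M0 j l) <= C * w (j + l).
Hypothesis M1C : forall j l, normc (M1 j l) <= C * w (j + l).
Hypothesis M2C : forall j l, normc (M2 j l) <= C * w (j + l).
Hypothesis M0_res : symbol M0 1 = 0.
(** The residual at the resonant frequency is a complex number: two real parameters reach it when
    their symbols there are independent over the reals. *)
Hypothesis transversal : forall z : R[i], exists t1 t2 : R,
  [/\ t1%:C%C * symbol M1 1 + t2%:C%C * symbol M2 1 = z,
      `|t1| <= C * normc z & `|t2| <= C * normc z].

Definition seed (eps : R) : modes := [:: (1, (2 * eps)%:C%C)].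
Definition total (eps : R) L : modes := mode_one ++ seed eps ++ L.
Definition quad t1 t2 X G : R :=
  ev X (prodm M0 G G) + t1 * ev X (prodm M1 G G) + t2 * ev X (prodm M2 G G).

(* The frequencies |k| >= 2 of the residual are removed through the linear part at [G = 1]; the
   frequencies +1 and -1, where the linear part vanishes, are removed by moving [t1] and [t2], whose
   effect at these frequencies has size [2 * eps]. *)
Definition correction r : modes :=
  [seq (e.1, - e.2 / symbol M0 e.1) | e <- r & (1 < `|e.1|)%N].

Lemma nrm_correction r : nrm (fun=> 1) (correction r) <= nrm w r.
Proof.
rewrite /correction.
set p := (fun e : int * R[i] => (1 < `|e.1|)%N).
apply: le_trans (nrm_filter p r w_gt0).
rewrite /nrm big_map !big_filter ler_sum// => e.
by rewrite /p /w ltnNge => /negbTE ->; rewrite divr1 normcM normcN' normcV.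
Qed.

Lemma correction_linear X r :
  ev X (prodm M0 mode_one (correction r)) + ev X (prodm M0 (correction r) mode_one)
  = - ev X [seq e <- r | (1 < `|e.1|)%N].
Proof.
rewrite ev_linear_part// /ev big_map !big_filter -sumrN; apply: eq_bigr => e he/=.
have w0 : symbol M0 e.1 != 0.
  have := w_gt0 e.1; rewrite /w leqNgt he/=; apply: contraTN => /eqP ->.
  by rewrite normc0 ltxx.
by rewrite -ReN; congr complex.Re; field.
Qed.

(** Only real parts are summed, so a term at - 1 is a term at 1 with conjugate coefficient, and one
    complex number collects both. *)
Lemma resonant_part r : all (fun e => e.1 != 0) r -> exists2 z : R[i],
  forall X, ev X [seq e <- r | ~~ (1 < `|e.1|)%N] = Re (z * cis X) &
  normc z <= nrm w r.
Proof.
elim: r => [_|[k c] r IH /= /andP[k0 /IH[z hz zr]]].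
  exists 0 => [X|]; first by rewrite /ev big_nil/= !mul0r subrr.
  by rewrite normc0 /nrm big_nil.
have ncons : nrm w ((k, c) :: r) = normc c / w k + nrm w r.
  by rewrite /nrm big_cons.
have c0 : 0 <= normc c / w k by rewrite divr_ge0 ?normc_ge0 ?ltW.
case: ltnP => /= hk; first by exists z => //; rewrite ncons; lra.
have evc X : ev X ((k, c) :: [seq e <- r | ~~ (1 < `|e.1|)%N]) =
   Re (c * cis (k%:~R * X)) + Re (z * cis X).
  by rewrite /ev big_cons -hz.
have wk : w k = 1 by rewrite /w hk.
have [k1|k1] : k = 1 \/ k = - 1.
- move: k0 hk {evc wk c0 ncons}; case: k => -[|[|n]]//= _ _; [by left|by right].
- exists (c + z) => [X|]; first by rewrite evc k1 mul1r -ReD mulrDl.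
  by rewrite ncons wk divr1 (le_trans (normcD _ _))// lerD2l.
- exists (conjc c + z) => [X|].
    rewrite evc k1 mulrN1z mulNr mul1r -conjc_cis.
    rewrite -[X in X + _ = _]ReJ conjcM conjcK.
    by rewrite -ReD mulrDl.
  by rewrite ncons wk divr1 (le_trans (normcD _ _))// normcJ' lerD2l.
Qed.

(** The derivative is frozen at [G = 1] and zero amplitudes. What it neglects is small relative to
    the residual, so the gain per step is a fixed factor and not a squaring. *)
Lemma quad_step (eps : R) L (t1 t2 c : R) r : 0 < eps -> eps <= 1 ->
  (forall X, quad t1 t2 X (total eps L) = c + ev X r) ->
  all (fun e => e.1 != 0) r ->
  exists L' t1' t2' c' r',
  [/\ forall X, quad t1' t2' X (total eps (L ++ L')) = c' + ev X r',
      all (fun e => e.1 != 0) r',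
      nrm (fun=> 1) L' <= nrm w r,
      `|t1' - t1| <= C * nrm w r / (2 * eps) /\
      `|t2' - t2| <= C * nrm w r / (2 * eps) &
      let l := nrm (fun=> 1) L in let q := nrm (fun=> 1) L' in
      nrm w r' <= C * (2 * (2 * eps + l) * q + q * q)
        + (`|t1| + `|t2|) * (C * (2 * (1 + 2 * eps + l) * q + q * q))
        + 2 * (C * nrm w r / (2 * eps)) *
            (C * (2 * (l + q) + (2 * eps + l + q) * (2 * eps + l + q)))].
Proof.
move=> e0 e1 hq hr.
have [z hz zr] := resonant_part hr.
have [d1 [d2 [hd hd1 hd2]]] := transversal (- z / (2 * eps)%:C%C).
have zd : normc (- z / (2 * eps)%:C%C) <= nrm w r / (2 * eps).
  rewrite normcM normcN' normcV normc_real ger0_norm; last by rewrite mulr_ge0// ltW.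
  by rewrite ler_pM2r ?invr_gt0 ?mulr_gt0.
have hdd (d : R) : `|d| <= C * normc (- z / (2 * eps)%:C%C) ->
    `|d| <= C * nrm w r / (2 * eps).
  by move=> /le_trans; apply; rewrite -mulrA ler_wpM2l// (le_trans ler01 hC).
set D := correction r.
set u := seed eps; set one := mode_one.
pose L' := L ++ D; pose Gp := u ++ L; pose G := one ++ Gp; pose Gp' := u ++ L'.
(* [lin] pairs the old amplitudes with the correction [D]. [new] pairs the increments [d1], [d2]
   with everything except [one] times [one], which is constant, and [one] times [u], which cancels
   the resonant part. [RR] collects all that is left. *)
pose lin (M : int -> int -> R[i]) t := scalem t
  (prodm M G D ++ prodm M D G ++ prodm M D D).
pose new (M : int -> int -> R[i]) d := scalem d
  (prodm M one L' ++ prodm M L' one ++ prodm M Gp' Gp').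
pose RR := (prodm M0 Gp D ++ prodm M0 D Gp ++ prodm M0 D D) ++
  lin M1 t1 ++ lin M2 t2 ++ new M1 d1 ++ new M2 d2.
(* Terms of frequency 0 are moved to the constant [cst], so that the new residual is free of
   them. *)
pose z0 := fun e : int * R[i] => e.1 == 0.
pose cst := d1 * ev 0 (prodm M1 one one) + d2 * ev 0 (prodm M2 one one)
  + ev 0 [seq e <- RR | z0 e].
exists D; exists (t1 + d1); exists (t2 + d2); exists (c + cst); exists [seq e <- RR | ~~ z0 e].
split.
- move=> X.
  have oneE (M : int -> int -> R[i]) : ev X (prodm M one one) = ev 0 (prodm M one one).
    by apply: ev_mode0.
  have RRE : ev X [seq e <- RR | ~~ z0 e] = ev X RR - ev 0 [seq e <- RR | z0 e].
    rewrite -(ev_filterC X z0 RR) (@ev_mode0 X [seq e <- RR | z0 e]); first by ring.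
    by rewrite filter_all.
  have lin0 := correction_linear X r.
  have lin1 : d1 * (ev X (prodm M1 one u) + ev X (prodm M1 u one)) +
      d2 * (ev X (prodm M2 one u) + ev X (prodm M2 u one)) =
      - ev X [seq e <- r | ~~ (1 < `|e.1|)%N].
    have evu (M : int -> int -> R[i]) : hermitian M ->
        ev X (prodm M one u) + ev X (prodm M u one) =
        2 * eps * Re (symbol M 1 * cis X).
      move=> hM; rewrite ev_linear_part// big_seq1 -ReZ mulrA.
      by congr (Re (_ * cis _)); rewrite mul1r.
    have e20 : 2 * eps != 0 by rewrite mulf_neq0// gt_eqF.
    rewrite hz (evu _ hM1) (evu _ hM2).
    have : 2 * eps * Re ((d1%:C%C * symbol M1 1 + d2%:C%C * symbol M2 1) * cis X)
        = 2 * eps * Re (- z / (2 * eps)%:C%C * cis X) by rewrite hd.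
    have -> : - z / (2 * eps)%:C%C * cis X = ((2 * eps)^-1)%:C%C * - (z * cis X).
      by rewrite fmorphV; ring.
    rewrite ReZ ReN mulrA divff// mul1r [(_ + _) * cis X]mulrDl ReD -![_ * symbol _ _ * cis X]mulrA !ReZ => <-; ring.
  have split_r := ev_filterC X (fun e : int * R[i] => (1 < `|e.1|)%N) r.
  have evr : ev X r = - (ev X (prodm M0 one D) + ev X (prodm M0 D one))
     - (d1 * (ev X (prodm M1 one u) + ev X (prodm M1 u one)) +
        d2 * (ev X (prodm M2 one u) + ev X (prodm M2 u one))).
    by rewrite lin0 lin1 !opprK split_r.
  have hJ := hq X; apply/eqP; rewrite -subr_eq0.
  rewrite -[X in _ == X](subrr (c + ev X r)) -{1}hJ evr RRE /cst -!oneE.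
  rewrite /quad /total -/u -/one /RR /lin /new /Gp' /Gp /G /L' /Gp.
  rewrite !(ev_cat, ev_scale, ev_prodm_catl, ev_prodm_catr).
  apply/eqP; ring.
- exact: filter_all.
- exact: nrm_correction.
- by rewrite ![_ + _ - _]addrAC !subrr !add0r; split; apply: hdd.
- move=> l q.
  apply: le_trans (nrm_filter _ _ w_gt0) _.
  have C0 : 0 <= C by rewrite (le_trans ler01 hC).
  have one1 : nrm (fun=> 1) one = 1 by rewrite /nrm big_seq1/= expr0n/= addr0 expr1n sqrtr1 divr1.
  have u2 : nrm (fun=> 1) u = 2 * eps.
    by rewrite /nrm big_seq1/= expr0n/= addr0 sqrtr_sqr divr1 ger0_norm// mulr_ge0// ltW.
  have l0 : 0 <= l by apply: nrm_ge0.
  have q0 : 0 <= q by apply: nrm_ge0.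
  have nGp : nrm (fun=> 1) Gp = 2 * eps + l by rewrite nrm_cat u2.
  have nG : nrm (fun=> 1) G = 1 + 2 * eps + l by rewrite nrm_cat nGp one1 addrA.
  have nL' : nrm (fun=> 1) L' = l + q by rewrite nrm_cat.
  have nGp' : nrm (fun=> 1) Gp' = 2 * eps + l + q by rewrite nrm_cat nL' u2 addrA.
  have nD : nrm (fun=> 1) D = q by [].
  have H0 G1 G2 := @nrm_prodm R w M0 C G1 G2 w_gt0 M0C.
  have H1 G1 G2 := @nrm_prodm R w M1 C G1 G2 w_gt0 M1C.
  have H2 G1 G2 := @nrm_prodm R w M2 C G1 G2 w_gt0 M2C.
  have n3 (A1 A2 A3 : modes) : nrm w (A1 ++ A2 ++ A3) =
      nrm w A1 + (nrm w A2 + nrm w A3) by rewrite !nrm_cat.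
  clearbody l q.
  have hlin (M : int -> int -> R[i]) t :
      (forall G1 G2, nrm w (prodm M G1 G2) <= C * nrm (fun=> 1) G1 * nrm (fun=> 1) G2) ->
      nrm w (lin M t) <= `|t| * (C * (2 * (1 + 2 * eps + l) * q + q * q)).
    move=> H; rewrite nrm_scale ler_wpM2l// n3.
    have := H G D; have := H D G; have := H D D; rewrite nG nD.
    set a1 := nrm w _; set a2 := nrm w _; set a3 := nrm w _; lra.
  have hnew (M : int -> int -> R[i]) d :
      (forall G1 G2, nrm w (prodm M G1 G2) <= C * nrm (fun=> 1) G1 * nrm (fun=> 1) G2) ->
      `|d| <= C * nrm w r / (2 * eps) ->
      nrm w (new M d) <= C * nrm w r / (2 * eps) *
         (C * (2 * (l + q) + (2 * eps + l + q) * (2 * eps + l + q))).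
    move=> H hd'; rewrite nrm_scale ler_pM// ?nrm_ge0// n3.
    have := H one L'; have := H L' one; have := H Gp' Gp'; rewrite one1 nL' nGp'.
    set a1 := nrm w _; set a2 := nrm w _; set a3 := nrm w _; lra.
  have := hlin M1 t1 H1; have := hlin M2 t2 H2.
  have := hnew M1 d1 H1 (hdd _ hd1); have := hnew M2 d2 H2 (hdd _ hd2).
  have -> : nrm w RR = nrm w (prodm M0 Gp D) + (nrm w (prodm M0 D Gp) +
      nrm w (prodm M0 D D)) + (nrm w (lin M1 t1) + (nrm w (lin M2 t2) +
      (nrm w (new M1 d1) + nrm w (new M2 d2)))).
    by rewrite /RR -n3 -nrm_cat -[in RHS]n3 -nrm_cat.
  have := H0 Gp D; have := H0 D Gp; have := H0 D D; rewrite nGp nD.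
  move: (nrm w (prodm M0 Gp D)) (nrm w (prodm M0 D Gp)) (nrm w (prodm M0 D D)).
  move: (nrm w (lin M1 t1)) (nrm w (lin M2 t2)) (nrm w (new M1 d1)) (nrm w (new M2 d2)).
  move: (C * nrm w r / (2 * eps)) (`|t1|) (`|t2|) => x1 x2 x3 a1 a2 a3 a4 b1 b2 b3.
  lra.
Qed.

Hypothesis M0B : forall j l, normc (M0 j l) <= C.

Let w_le k : w k <= 2 * C.
Proof.
have hC' := hC.
rewrite /w; case: ifP => _; first lra.
have := normcD (M0 0 k) (M0 k 0); have := M0B 0 k; have := M0B k 0.
rewrite -/(symbol M0 k); lra.
Qed.

Let nrm1_le_nrm r : nrm (fun=> 1) r <= 2 * C * nrm w r.
Proof.
rewrite /nrm mulr_sumr; apply: ler_sum => e _; rewrite divr1.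
rewrite mulrA ler_pdivlMr// mulrC ler_wpM2r ?normc_ge0//.
Qed.

Record state := State { st_L : modes; st_t1 : R; st_t2 : R; st_c : R; st_r : modes }.

(** The factors [1 - 2^-1 ^+ n] leave exactly the room for the increments of the next step, which
    are geometric of ratio 1/2. *)
Let good eps n s : Prop :=
  [/\ forall X, quad (st_t1 s) (st_t2 s) X (total eps (st_L s)) = st_c s + ev X (st_r s),
      all (fun e => e.1 != 0) (st_r s),
      nrm w (st_r s) <= 4 * C * eps ^+ 2 * 2^-1 ^+ n,
      nrm (fun=> 1) (st_L s) <= 8 * C * eps ^+ 2 * (1 - 2^-1 ^+ n) &
      `|st_t1 s| <= 4 * C ^+ 2 * eps * (1 - 2^-1 ^+ n) /\
      `|st_t2 s| <= 4 * C ^+ 2 * eps * (1 - 2^-1 ^+ n)].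

Let next eps n s s' : Prop :=
  [/\ exists2 D, st_L s' = st_L s ++ D & nrm (fun=> 1) D <= 4 * C * eps ^+ 2 * 2^-1 ^+ n,
      `|st_t1 s' - st_t1 s| <= 2 * C ^+ 2 * eps * 2^-1 ^+ n &
      `|st_t2 s' - st_t2 s| <= 2 * C ^+ 2 * eps * 2^-1 ^+ n].

Let good0 (eps : R) : 0 < eps -> exists s, good eps 0 s.
Proof.
move=> e0.
pose u := seed eps; pose one := mode_one; pose P := prodm M0 u u.
pose z0 := fun e : int * R[i] => e.1 == 0.
have hP : nrm w P <= 4 * C * eps ^+ 2.
  apply: le_trans (nrm_prodm _ _ w_gt0 M0C) _.
  rewrite /nrm !big_seq1/= expr0n/= addr0 sqrtr_sqr divr1.
  have -> : `|2 * eps| = 2 * eps by rewrite ger0_norm// mulr_ge0// ltW.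
  by rewrite le_eqVlt; apply/orP; left; apply/eqP; ring.
have hq X : quad 0 0 X (total eps [::]) = ev 0 (prodm M0 one one) + ev X P.
  rewrite /quad !mul0r !addr0 /total cats0 -/u -/one.
  rewrite !(ev_prodm_catl, ev_prodm_catr).
  have -> : ev X (prodm M0 one one) = ev 0 (prodm M0 one one) by apply: ev_mode0.
  (* The seed sits at frequency 1, where the symbol vanishes: the residual starts at order eps^2. *)
  have E : ev X (prodm M0 one u) + ev X (prodm M0 u one) = 0.
    by rewrite ev_linear_part// big_seq1 M0_res mulr0 mul0r.
  by rewrite !addrA -[_ + _ + ev X (prodm M0 u one)]addrA E addr0.
move: hP hq; set k0 := ev 0 _; clearbody P k0 => hP hq.
exists (State [::] 0 0 (k0 + ev 0 [seq e <- P | z0 e])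
  [seq e <- P | ~~ z0 e]); split => /=.
- move=> X; rewrite hq -(ev_filterC X z0 P) (@ev_mode0 X [seq e <- P | z0 e]) ?addrA//.
  by rewrite filter_all.
- exact: filter_all.
- by rewrite expr0 mulr1 (le_trans (nrm_filter _ _ w_gt0)).
- by rewrite expr0 subrr mulr0 /nrm big_nil.
- by rewrite expr0 subrr mulr0 normr0.
Qed.

Let goodS (eps : R) n s : 0 < eps -> 1000 * C ^+ 3 * eps <= 1 -> good eps n s ->
  exists s', good eps n.+1 s' /\ next eps n s s'.
Proof.
move=> e0 He [hq hr hn hl [ht1 ht2]].
have hC' := hC.
have C0 : 0 < C by lra.
have e1 : eps <= 1.
  have : eps <= C ^+ 3 * eps by rewrite ler_peMl ?(ltW e0)// exprn_ege1.
  lra.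
have [L' [t1' [t2' [c' [r' [hq' hr' hL' [ht1' ht2'] hn']]]]]] := quad_step e0 e1 hq hr.
exists (State (st_L s ++ L') t1' t2' c' r').
set th := 2^-1 ^+ n in hn hl ht1 ht2 *.
have th0 : 0 < th by rewrite exprn_gt0// invr_gt0.
have th1 : th <= 1 by rewrite exprn_ile1// ?invr_ge0// invf_le1// ler1n.
have thS : 2^-1 ^+ n.+1 = th / 2 by rewrite exprSr.
have Ce2 : 0 < C * eps ^+ 2 by rewrite mulr_gt0// exprn_gt0.
have C2e : 0 < C ^+ 2 * eps by rewrite mulr_gt0// exprn_gt0.
have Ce2t : C * eps ^+ 2 * th <= C * eps ^+ 2 by rewrite ler_piMr ?(ltW Ce2).
have C2et : C ^+ 2 * eps * th <= C ^+ 2 * eps by rewrite ler_piMr ?(ltW C2e).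
have Ce2t0 : 0 < C * eps ^+ 2 * th by rewrite mulr_gt0.
have C2et0 : 0 < C ^+ 2 * eps * th by rewrite mulr_gt0.
have dt : C * nrm w (st_r s) / (2 * eps) <= 2 * C ^+ 2 * eps * th.
  rewrite ler_pdivrMr ?mulr_gt0//.
  have -> : 2 * C ^+ 2 * eps * th * (2 * eps) = C * (4 * C * eps ^+ 2 * th) by ring.
  by rewrite ler_pM2l.
have l0 : 0 <= nrm (fun=> 1) (st_L s) by apply: nrm_ge0.
have q0 : 0 <= nrm (fun=> 1) L' by apply: nrm_ge0.
have key : nrm w r' <= nrm w (st_r s) / 2.
  apply: le_trans hn' _; apply: chord_step_ineq => //; lra.
split.
  rewrite /good /= thS; split => //.
  - lra.
  - rewrite nrm_cat; lra.
  - have h1 := ler_normD (st_t1 s) (t1' - st_t1 s).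
    have h2 := ler_normD (st_t2 s) (t2' - st_t2 s).
    rewrite ![st_t1 s + _]addrC subrK in h1; rewrite ![st_t2 s + _]addrC subrK in h2.
    split; lra.
rewrite /next/= -/th; split.
- by exists L' => //; lra.
- by lra.
- by lra.
Qed.

Lemma quad_iter (eps : R) : 0 < eps -> 1000 * C ^+ 3 * eps <= 1 ->
  exists (Ls : nat -> modes) (t1 t2 c : nat -> R),
  [/\ forall n, nrm (fun=> 1) (Ls n) <= 8 * C * eps ^+ 2,
      forall n, exists2 D, Ls n.+1 = Ls n ++ D &
        nrm (fun=> 1) D <= 4 * C * eps ^+ 2 * 2^-1 ^+ n,
      forall n, `|t1 n| <= 4 * C ^+ 2 * eps /\ `|t2 n| <= 4 * C ^+ 2 * eps,
      forall n, `|t1 n.+1 - t1 n| <= 2 * C ^+ 2 * eps * 2^-1 ^+ n /\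
        `|t2 n.+1 - t2 n| <= 2 * C ^+ 2 * eps * 2^-1 ^+ n &
      forall n X, `|quad (t1 n) (t2 n) X (total eps (Ls n)) - c n| <=
        8 * C ^+ 2 * eps ^+ 2 * 2^-1 ^+ n].
Proof.
move=> e0 He.
have hC' := hC.
have C0 : 0 < C by lra.
pose s0 : {s | good eps 0 s} := cid (good0 e0).
pose step n (s : {s | good eps n s}) := cid (goodS e0 He (svalP s)).
pose f := fix f n : {s | good eps n s} := match n with
  | 0%N => s0
  | n.+1 => exist _ (sval (step n (f n))) (proj1 (svalP (step n (f n)))) end.
have fS n : next eps n (sval (f n)) (sval (f n.+1)).
  exact: (proj2 (svalP (step n (f n)))).
pose S n := sval (f n).
have th0 n : 0 < 2^-1 ^+ n :> R by rewrite exprn_gt0// invr_gt0.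
have Ce2 : 0 < C * eps ^+ 2 by rewrite mulr_gt0// exprn_gt0.
have C2e : 0 < C ^+ 2 * eps by rewrite mulr_gt0// exprn_gt0.
exists (fun n => st_L (S n)), (fun n => st_t1 (S n)), (fun n => st_t2 (S n)),
  (fun n => st_c (S n)); split.
- move=> n; have [_ _ _ h _] := svalP (f n).
  have := mulr_gt0 Ce2 (th0 n); rewrite -/(S n) in h; lra.
- by move=> n; have [] := fS n.
- move=> n; have [_ _ _ _ [h1 h2]] := svalP (f n).
  have := mulr_gt0 C2e (th0 n); rewrite -/(S n) in h1 h2; lra.
- by move=> n; have [] := fS n.
- move=> n X; have [hq _ hn _ _] := svalP (f n); rewrite -/(S n) in hq hn.
  rewrite hq addrC addKr (le_trans (norm_ev _ _))//.
  apply: le_trans (nrm1_le_nrm _) _.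
  have -> : 8 * C ^+ 2 * eps ^+ 2 * 2^-1 ^+ n = 2 * C * (4 * C * eps ^+ 2 * 2^-1 ^+ n) by ring.
  by rewrite ler_pM2l// mulr_gt0.
Qed.
End Iteration.

(** * Changes of variables for nonnegative integrals *)

Section Affine.
Context {R : realType}.
Local Notation mu := (@lebesgue_measure R).
Local Open Scope ereal_scope.

Let affine (a b : R) (x : R) : R := (a * x + b)%R.

Let measurable_affine (a b : R) : measurable_fun [set: R] (affine a b).
Proof. by apply: measurable_funD => //; apply: measurable_funM. Qed.

(** By uniqueness of Lebesgue measure: [|a|] times its image under the affine map agrees with it on
    half-open intervals. For [a < 0] the preimage is closed at the other end, hence two cases. *)
Lemma ge0_integral_affine (a b : R) (f : R -> \bar R) : a != 0%R ->
  measurable_fun [set: R] f -> (forall x, 0 <= f x) ->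
  \int[mu]_x f x = `|a|%:E * \int[mu]_x f (a * x + b)%R.
Proof.
move=> a0 mf f0.
have an : (0 < `|a|)%R by rewrite normr_gt0.
pose m0 := mscale (NngNum (ltW an)) (pushforward mu (affine a b : _ -> measurableTypeR R)).
pose m := m0 (measurable_affine a b).
have mE A : measurable A -> mu A = m A.
  move=> mA; apply: lebesgue_measure_unique => // _ [[c d]] _ <-.
  change (mu `]c, d] = `|a|%:E * mu (affine a b @^-1` `]c, d])).
  have [a1|a1|a1] := ltgtP a 0%R; last by rewrite a1 eqxx in a0.
  - have E : affine a b @^-1` `]c, d]%classic = `[((d - b) / a)%R, ((c - b) / a)%R[%classic.
      apply/seteqP; split => x; rewrite /= !in_itv/= /affine.
        by rewrite ler_ndivrMr// ltr_ndivlMr// ltrBlDr lerBrDr mulrC andbC.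
      by rewrite ler_ndivrMr// ltr_ndivlMr// ltrBlDr lerBrDr mulrC andbC.
    rewrite [X in _ * mu X]E !lebesgue_measure_itv/= !lte_fin ltr_ndivrMr// divfK ?lt_eqF//.
    rewrite ltrD2r ltr0_norm//; case: ifPn => _; last by rewrite mule0.
    rewrite -!EFinB -EFinM; congr EFin; field; rewrite lt_eqF//.
  - have E : affine a b @^-1` `]c, d]%classic = `]((c - b) / a)%R, ((d - b) / a)%R]%classic.
      apply/seteqP; split => x; rewrite /= !in_itv/= /affine.
        by rewrite ler_pdivlMr// ltr_pdivrMr// ltrBlDr lerBrDr mulrC.
      by rewrite ler_pdivlMr// ltr_pdivrMr// ltrBlDr lerBrDr mulrC.
    rewrite [X in _ * mu X]E !lebesgue_measure_itv/= !lte_fin ltr_pdivrMr// divfK ?gt_eqF//.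
    rewrite ltrD2r gtr0_norm//; case: ifPn => _; last by rewrite mule0.
    rewrite -!EFinB -EFinM; congr EFin; field; rewrite gt_eqF//.
rewrite (@eq_measure_integral _ _ _ setT m mu); last by move=> A mA _; exact: mE.
rewrite /m /m0 ge0_integral_mscale//=; congr (_ * _).
by rewrite ge0_integral_pushforward//; exact: measurable_affine.
Qed.

(** The substitution y = r (1 - s), z = r s, of Jacobian |r|, is made one variable at a time between
    Tonelli exchanges: z = r - y for fixed y, then y = r - r s for fixed r. The second map
    degenerates at r = 0, a line on which [h] vanishes. *)
Lemma ge0_integral_split_sum (h : R * R -> \bar R) :
  measurable_fun [set: R * R] h -> (forall z, 0 <= h z) ->
  (forall y, h (y, - y)%R = 0) ->
  \int[mu]_y \int[mu]_z h (y, z) =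
  \int[mu]_s \int[mu]_r (`|r|%:E * h (r * (1 - s), r * s)%R).
Proof.
move=> mh h0 hN.
pose h1 (p : R * R) := h (p.1, p.2 - p.1)%R.
have mh1 : measurable_fun [set: R * R] h1.
  apply: measurableT_comp mh _; apply/measurable_fun_pairP; split => /=.
    exact: measurable_fst.
  by apply: measurable_funB; [exact: measurable_snd|exact: measurable_fst].
pose h2 (p : R * R) := `|p.2|%:E * h (p.2 * (1 - p.1), p.2 * p.1)%R.
have mh2 : measurable_fun [set: R * R] h2.
  apply: emeasurable_funM.
    apply/measurable_EFinP; apply: measurableT_comp => //; exact: measurable_snd.
  apply: measurableT_comp mh _; apply/measurable_fun_pairP; split => /=.
    apply: measurable_funM; first exact: measurable_snd.
    by apply: measurable_funB => //; exact: measurable_fst.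
  by apply: measurable_funM; [exact: measurable_snd|exact: measurable_fst].
have msec (g : R * R -> \bar R) y : measurable_fun [set: R * R] g ->
    measurable_fun [set: R] (fun z => g (y, z)).
  by move=> mg; apply: measurableT_comp mg _; exact: measurable_pair1.
have msec2 (g : R * R -> \bar R) y : measurable_fun [set: R * R] g ->
    measurable_fun [set: R] (fun z => g (z, y)).
  by move=> mg; apply: measurableT_comp mg _; exact: measurable_pair2.
have swap (g : R * R -> \bar R) : measurable_fun [set: R * R] g ->
    (forall p, 0 <= g p) ->
    \int[mu]_x \int[mu]_y g (x, y) = \int[mu]_y \int[mu]_x g (x, y).
  by move=> mg g0; exact: (@fubini_tonelli _ _ _ _ _ mu mu g mg g0).
transitivity (\int[mu]_y \int[mu]_r h1 (y, r)).
  apply: eq_integral => y _.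
  rewrite (@ge0_integral_affine 1 (- y) (fun z => h (y, z)))//; last exact: msec.
  rewrite normr1 mul1e; apply: eq_integral => r _.
  by rewrite /h1/= mul1r.
rewrite (swap h1)//; last by move=> p; exact: h0.
transitivity (\int[mu]_r \int[mu]_s h2 (s, r)).
  apply: eq_integral => r _.
  have [->|r0] := eqVneq r 0%R.
    rewrite (@integral0_eq _ _ _ mu setT (fun y => h1 (y, 0%R))); last first.
      by move=> s _; rewrite /h1/= sub0r hN.
    rewrite (@integral0_eq _ _ _ mu setT (fun y => h2 (y, 0%R)))// => s _.
    by rewrite /h2/= normr0 mul0e.
  rewrite (@ge0_integral_affine (- r) r (fun y => h1 (y, r))) ?oppr_eq0//; last 2 first.
  - exact: msec2.
  - by move=> y; exact: h0.
  rewrite -ge0_integralZl//; last 2 first.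
  - apply: (@measurableT_comp _ _ _ _ _ _ (fun y => h1 (y, r))); first exact: msec2.
    by apply: measurable_funD => //; apply: measurable_funM.
  - by move=> y _; exact: h0.
  apply: eq_integral => s _; rewrite /h2/= normrN /h1/=.
  by congr (_ * h (_, _)); ring.
by rewrite (swap h2)// => p; rewrite mule_ge0.
Qed.
End Affine.

(** Since [0^-1 = 0], the function equals its restriction off 0, where it is continuous on an open
    set. *)
Lemma measurable_inv (R : realType) : measurable_fun [set: R] (fun x : R => x^-1).
Proof.
rewrite (_ : (fun x : R => x^-1) = (fun x : R => x^-1) \_ [set~ (0 : R)]); last first.
  apply/funext => x; rewrite patchE; case: ifPn => // /negP hx.
  have [->|x0] := eqVneq x 0; first by rewrite invr0.
  by exfalso; apply: hx; rewrite mem_set//; apply/eqP.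
have m0 : measurable [set~ (0 : R)] by apply: measurableC; exact: measurable_set1.
apply/(measurable_restrictT _ m0).
apply: open_continuous_measurable_fun; first by apply: closed_openC; exact: closed_eq.
by move=> x /set_mem/eqP x0; exact: inv_continuous.
Qed.

(** * The flux of a modulated power law *)

Section FluxFormula.
Context {R : realType}.
Local Notation mu := (@lebesgue_measure R).

(* The profile is [W s * (s * (1 - s)) `^ ((3 + gamma) / 2)]: this power cancels those of the
   solutions in the flux. *)
Definition hom_kernel (gamma : R) (W : R -> R) (x y : R) : R :=
  (x + y) `^ gamma *
  (W (x / (x + y)) * (x / (x + y) * (1 - x / (x + y))) `^ ((3 + gamma) / 2)).

Definition modulated (gamma : R) (G : R -> R) (x : R) : R :=
  G (ln x) / x `^ ((3 + gamma) / 2).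

(** Put r = y + z and s = z / r: the conditions y < x and z > x - y become x < r < x / (1 - s). With
    al = (3 + gamma) / 2 the powers of s and 1 - s cancel up to the factor 1 - s coming from y, and
    with the Jacobian r^(gamma + 2 - 2 al) = 1 / r remains. *)
Lemma flux_modulated (gamma x : R) (W G : R -> R) :
  0 < x -> measurable_fun [set: R] W -> measurable_fun [set: R] G ->
  (forall s : R, 0 < s < 1 -> 0 <= W s) -> (forall s, W (1 - s) = W s) ->
  (forall t, 0 <= G t) ->
  flux (hom_kernel gamma W) (modulated gamma G) x =
  (\int[mu]_(s in `]0%R, 1%R[) \int[mu]_(r in `]x, (x / (1 - s))%R[)
     ((1 - s) * W s * (G (ln (r * (1 - s))) * G (ln (r * s)) / r))%:E)%E.
Proof.
move=> x0 mW mG W0 Wsym G0.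
pose al := (3 + gamma) / 2.
pose k (p : R * R) := hom_kernel gamma W p.1 p.2 * p.1 *
  modulated gamma G p.1 * modulated gamma G p.2.
pose A := [set p : R * R | (0 < p.1 < x) && (x - p.1 < p.2)].
(* Extended by 0 the integrand is nonnegative on the whole plane, and it vanishes where y + z = 0
   because x > 0. *)
pose h := (EFin \o k) \_ A.
have mf1 : measurable_fun [set: R * R] (@fst R R) by exact: measurable_fst.
have mf2 : measurable_fun [set: R * R] (@snd R R) by exact: measurable_snd.
have mS : measurable_fun [set: R * R] (fun p : R * R => p.1 + p.2).
  exact: measurable_funD.
have mV : measurable_fun [set: R] (fun t : R => t^-1) by exact: measurable_inv.
have mQ : measurable_fun [set: R * R] (fun p : R * R => p.1 / (p.1 + p.2)).
  by apply: measurable_funM => //; exact: (measurableT_comp mV mS).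
have mmod : measurable_fun [set: R] (modulated gamma G).
  apply: measurable_funM; first exact: (measurableT_comp mG (@measurable_ln R)).
  by apply: (measurableT_comp mV); exact: measurable_powR.
have mk : measurable_fun [set: R * R] k.
  apply: measurable_funM; last exact: (measurableT_comp mmod mf2).
  apply: measurable_funM; last exact: (measurableT_comp mmod mf1).
  apply: measurable_funM => //; apply: measurable_funM.
    exact: (measurableT_comp (measurable_powR _) mS).
  apply: measurable_funM; first exact: (measurableT_comp mW mQ).
  apply: (measurableT_comp (measurable_powR _)).
  by apply: measurable_funM => //; exact: measurable_funB.
have mA : measurable A.
  rewrite -[A]setTI; apply: (_ : measurable_fun [set: R * R]
    (fun p : R * R => (0 < p.1 < x) && (x - p.1 < p.2))) => //.
  by do 2?apply: measurable_and; apply: measurable_fun_ltr => //; exact: measurable_funB.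
have mh : measurable_fun [set: R * R] h.
  apply/(measurable_restrictT _ mA); apply: measurable_funTS.
  exact/measurable_EFinP.
have mod0 t : 0 <= modulated gamma G t by rewrite divr_ge0// powR_ge0.
have h0 z : (0 <= h z)%E.
  rewrite /h patchE; case: ifPn => // /set_mem; case: z => y z /= /andP[/andP[y0 yx] yz].
  have z0 : 0 < z by rewrite (le_lt_trans _ yz)// subr_ge0 ltW.
  rewrite /= in y0 yx yz; have yz0 : 0 < y + z by rewrite addr_gt0.
  rewrite lee_fin /k/= mulr_ge0// mulr_ge0// mulr_ge0 ?(ltW y0)//.
  rewrite mulr_ge0 ?powR_ge0// mulr_ge0 ?powR_ge0//.
  by apply: W0; rewrite divr_gt0//= ltr_pdivrMr// mul1r ltrDl.
have hN t : h (t, - t) = 0%E.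
  rewrite /h patchE; case: ifPn => // /set_mem /= /andP[_]; rewrite ltrBlDr.
  by rewrite addNr ltNge (ltW x0).
transitivity (\int[mu]_y \int[mu]_z h (y, z))%E.
  rewrite /flux integral_mkcond; apply: eq_integral => y _; rewrite patchE.
  case: ifPn => [/set_mem/= hy|hy].
    rewrite integral_mkcond; apply: eq_integral => z _.
    rewrite /h !patchE /=; congr (if _ then _ else _).
    apply/idP/idP => /set_mem/= H; apply/mem_set => /=.
      by move: hy H; rewrite /A !in_itv/= andbT => -> ->.
    by move: H; rewrite in_itv/= andbT => /andP[].
  rewrite integral0_eq// => z _; rewrite /h patchE; case: ifPn => // /set_mem/= /andP[H _].
  by move: hy; rewrite mem_set//= in_itv.
rewrite ge0_integral_split_sum// [RHS]integral_mkcond; apply: eq_integral => s _.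
rewrite patchE; case: ifPn => [/set_mem/=|hs].
  rewrite in_itv/= => /andP[s0 s1].
  rewrite [RHS]integral_mkcond; apply: eq_integral => r _.
  rewrite /h !patchE; case: ifPn => [/set_mem/= /andP[/andP[h1 h2] h3]|hr].
    rewrite /= in h1 h2 h3; have s10 : 0 < 1 - s by rewrite subr_gt0.
    have xr : x < r by lra.
    have r0 : 0 < r by lra.
    rewrite mem_set/=; last by rewrite in_itv/= xr/= ltr_pdivlMr.
    rewrite ger0_norm ?(ltW r0)// -EFinM; congr EFin.
    rewrite /k /hom_kernel /modulated/=.
    have -> : r * (1 - s) + r * s = r by ring.
    have -> : r * (1 - s) / r = 1 - s by field; rewrite gt_eqF.
    rewrite subKr Wsym -/al ![(r * _) `^ al]powRM ?(ltW r0) ?(ltW s0) ?(ltW s10)//.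
    rewrite powRM ?(ltW s0) ?(ltW s10)//.
    have p1 : 0 < r `^ al by rewrite powR_gt0.
    have p2 : 0 < s `^ al by rewrite powR_gt0.
    have p3 : 0 < (1 - s) `^ al by rewrite powR_gt0.
    have -> : r `^ gamma = r `^ al * r `^ al / (r * r * r).
      apply: (@mulIf _ (r * r * r)); first by rewrite !mulf_neq0// gt_eqF.
      rewrite divfK ?mulf_neq0 ?gt_eqF//.
      rewrite -{2 3 4}(powRr1 (ltW r0)) -!powRD ?(gt_eqF r0) ?implybT//.
      by congr powR; rewrite /al; field.
    by field; rewrite !gt_eqF.
  case: ifPn => [/set_mem/=|_]; last by rewrite mule0.
  rewrite in_itv/= => /andP[xr]; rewrite ltr_pdivlMr; last lra.
  move=> xr2; exfalso; move/negP: hr; apply; apply/mem_set; rewrite /A/=.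
  apply/andP; split; last lra.
  by rewrite xr2 andbT mulr_gt0; lra.
rewrite integral0_eq// => r _; rewrite /h patchE; case: ifPn => [/set_mem/=|]; last by rewrite mule0.
move=> /andP[/andP[/= h1 h2] h3]; rewrite /= in h1 h2 h3; exfalso; move/negP: hs; apply; apply/mem_set.
rewrite /= in_itv/=.
have xr : x < r by lra.
have r0 : 0 < r by lra.
have : 0 < 1 - s by rewrite -(pmulr_rgt0 _ r0).
have : 0 < r * s by lra.
by rewrite pmulr_rgt0// => -> ?; lra.
Qed.
End FluxFormula.

(** * Fundamental theorem of calculus and Lipschitz bounds *)

Section Calculus.
Context {R : realType}.
Local Notation mu := (@lebesgue_measure R).

Lemma integral_FTC (f F : R -> R) (a b : R) : a < b ->
  (forall x, a <= x <= b -> is_derive x 1 F (f x)) ->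
  (forall x, a <= x <= b -> {for x, continuous f}) ->
  (\int[mu]_(x in `[a, b]) (f x)%:E = (F b - F a)%:E)%E.
Proof.
move=> ab dF cf.
have dFx x : a <= x <= b -> derivable F x 1 by move=> /dF [].
have cF x : a <= x <= b -> {for x, continuous F}.
  by move=> /dFx dx; apply/differentiable_continuous/derivable1_diffP.
rewrite EFinB; apply: continuous_FTC2 => //.
- apply: continuous_in_subspaceT => x /set_mem/=; rewrite in_itv/=; exact: cf.
- split.
  + by move=> x; rewrite in_itv/= => /andP[? ?]; apply: dFx; rewrite !ltW.
  + by apply: cvg_at_right_filter; apply: cF; rewrite lexx ltW.
  + by apply: cvg_at_left_filter; apply: cF; rewrite lexx ltW.
- move=> x; rewrite in_itv/= => /andP[? ?]; rewrite derive1E.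
  have [_ ->] // : is_derive x 1 F (f x) by apply: dF; rewrite !ltW.
Qed.

Lemma sin_lipschitz (x y : R) : `|sin x - sin y| <= `|x - y|.
Proof.
wlog xy : x y / y <= x => [H|].
  case: (leP y x) => [|/ltW] /H //; by rewrite distrC (distrC x).
have [c _ ->] := @MVT_segment R sin cos y x xy (fun z _ => is_derive_sin z)
  (continuous_subspaceT (@continuous_sin R)).
by rewrite normrM ler_piMl// cos_max.
Qed.

Lemma cos_lipschitz (x y : R) : `|cos x - cos y| <= `|x - y|.
Proof.
rewrite -!sinDpihalf (le_trans (sin_lipschitz _ _))//.
by have -> : x + pi / 2 - (y + pi / 2) = x - y by ring.
Qed.

Lemma integral_FTC_oo (f F : R -> R) (a b : R) : a < b ->
  (forall x, a <= x <= b -> is_derive x 1 F (f x)) ->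
  (forall x, a <= x <= b -> {for x, continuous f}) ->
  (\int[mu]_(x in `]a, b[) (f x)%:E = (F b - F a)%:E)%E.
Proof.
move=> ab dF cf; rewrite -(integral_FTC ab dF cf); apply/esym/integral_itv_bndoo.
apply/measurable_EFinP; apply: open_continuous_measurable_fun.
  exact: interval_open.
move=> x /set_mem/=.
by rewrite in_itv/= => /andP[? ?]; apply: cf; rewrite !ltW.
Qed.

End Calculus.

(** * Flux of a pair of Fourier modes at fixed s *)

Section Modes.
Context {R : realType}.
Local Notation mu := (@lebesgue_measure R).
Local Notation Re := complex.Re.
Variable (om : R).
Hypothesis om0 : 0 < om.

(* The antiderivative of [cis (k * om * t)] in [t], taken from [0] to [lam]. *)
Definition arc (k : int) (lam : R) : R[i] :=
  if k == 0 then (lam%:C)%C else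
  Complex (sin (k%:~R * (om * lam)) / (k%:~R * om))
          ((1 - cos (k%:~R * (om * lam))) / (k%:~R * om)).

(** In u = ln r the measure dr / r is du on an interval of length ln q starting at ln x, so the
    phase at ln x factors out. *)
Lemma arc_integral (k : int) (c : R[i]) (x q : R) : 0 < x -> 1 < q ->
  (\int[mu]_(r in `]x, (x * q)%R[) (Re (c * cis (k%:~R * (om * ln r))) / r)%:E =
  (Re (c * arc k (ln q) * cis (k%:~R * (om * ln x))))%:E)%E.
Proof.
move=> x0 q1; have q0 : 0 < q by rewrite (lt_trans ltr01).
have xq : x < x * q by rewrite ltr_pMr.
have rpos r : x <= r <= x * q -> 0 < r by move=> /andP[/(lt_le_trans x0)].
have lnxq : ln (x * q) = ln x + ln q by rewrite lnM.
have dln r : x <= r <= x * q -> is_derive r 1 (@ln R) r^-1.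
  by move=> /rpos r0; exact: is_derive1_ln.
have cln r : x <= r <= x * q -> {for r, continuous (@ln R)}.
  by move=> /rpos; exact: continuous_ln.
case: c => a b.
pose th r : R := k%:~R * (om * ln r).
have Ef r : Re ((a +i* b)%C * cis (th r)) / r = (a * cos (th r) - b * sin (th r)) / r.
  by [].
under eq_integral do rewrite Ef.
have [k0|k0] := eqVneq k 0.
  have th0 r : th r = 0 by rewrite /th k0 mul0r.
  rewrite (_ : Re _ = a * ln (x * q) - a * ln x); last first.
    by rewrite /arc k0 eqxx mul0r cis0 /= lnxq; ring.
  apply: (@integral_FTC_oo _ _ (fun r => a * ln r)) => //.
  - move=> r hr; have := dln r hr => d; apply: is_derive_eq.
    by rewrite th0 cos0 sin0 /GRing.scale/=; ring.
  - move=> r hr; apply: cvgM; last by apply: inv_continuous; rewrite gt_eqF// rpos.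
    under eq_fun do rewrite th0.
    by rewrite th0; exact: cvg_cst.
have kom : k%:~R * om != 0 by rewrite mulf_neq0 ?intr_eq0// gt_eqF.
pose F r := (a * sin (th r) + b * cos (th r)) / (k%:~R * om).
rewrite (_ : Re _ = F (x * q) - F x); last first.
  rewrite /F /arc (negbTE k0).
  have -> : th (x * q) = th x + k%:~R * (om * ln q) by rewrite /th lnxq; ring.
  rewrite sinD cosD /th /= ; field.
  by rewrite intr_eq0 k0 gt_eqF.
pose f r := (a * cos (th r) - b * sin (th r)) / r.
apply: (@integral_FTC_oo _ f F x (x * q) xq).
- move=> r hr; have := dln r hr => d; apply: is_derive_eq.
  rewrite /f /GRing.scale/=; field.
  by rewrite intr_eq0 k0 !gt_eqF// rpos.
- move=> r hr; apply: cvgM; last by apply: inv_continuous; rewrite gt_eqF// rpos.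
  have cth : {for r, continuous th}.
    by apply: cvgM; [exact: cvg_cst|apply: cvgM; [exact: cvg_cst|exact: cln]].
  apply: cvgB; apply: cvgM; try exact: cvg_cst.
    by apply: (@continuous_comp _ _ _ th cos) => //; exact: continuous_cos.
  by apply: (@continuous_comp _ _ _ th sin) => //; exact: continuous_sin.
Qed.

Lemma arc_integrable (k : int) (c : R[i]) (x q : R) : 0 < x ->
  mu.-integrable `]x, x * q[ (EFin \o (fun r => Re (c * cis (k%:~R * (om * ln r))) / r)).
Proof.
move=> x0; case: c => a b.
have sub : `]x, x * q[ `<=` `[x, x * q] by apply: subset_itv; rewrite bnd_simp.
apply: (integrableS (mu := mu) (measurable_itv _) (measurable_itv _) sub).
apply: continuous_compact_integrable; first exact: segment_compact.
apply: continuous_in_subspaceT => r /set_mem/=; rewrite in_itv/= => /andP[xr _].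
have r0 : 0 < r by rewrite (lt_le_trans x0).
apply: cvgM; last by apply: inv_continuous; rewrite gt_eqF.
pose th r : R := k%:~R * (om * ln r).
have cth : {for r, continuous th}.
  by apply: cvgM; [exact: cvg_cst|apply: cvgM; [exact: cvg_cst|exact: continuous_ln]].
apply: cvgB; apply: cvgM; try exact: cvg_cst.
  by apply: (@continuous_comp _ _ _ th cos) => //; exact: continuous_cos.
by apply: (@continuous_comp _ _ _ th sin) => //; exact: continuous_sin.
Qed.

Lemma arc_integral_sum (P : seq (int * R[i])) (x q : R) : 0 < x -> 1 < q ->
  (\int[mu]_(r in `]x, (x * q)%R[) (ev (om * ln r) P / r)%:E =
  (\sum_(e <- P) Re (e.2 * arc e.1 (ln q) * cis (e.1%:~R * (om * ln x))))%:E)%E.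
Proof.
move=> x0 q1.
under eq_integral do rewrite /ev mulr_suml -sumEFin.
rewrite integral_sum//; last by move=> e; exact: (@arc_integrable e.1 e.2 x q x0).
by rewrite -sumEFin; apply: eq_bigr => e _; exact: arc_integral.
Qed.

Lemma arcN k lam : arc (- k) lam = conjc (arc k lam).
Proof.
rewrite /arc oppr_eq0; case: eqVneq => [_|k0]; first by rewrite conjc_real.
rewrite rmorphN/= !mulNr sinN cosN invrN mulrNN.
by rewrite mulrN.
Qed.

Lemma arc_le k lam : 0 <= lam -> normc (arc k lam) <= 2 * lam.
Proof.
move=> l0; rewrite /arc; case: eqVneq => [_|k0]; first by rewrite normc_real ger0_norm//; lra.
apply: le_trans (normc_le_ReIm _) _ => /=.
have kom : 0 < `|k%:~R * om| by rewrite normr_gt0 mulf_neq0 ?intr_eq0// gt_eqF.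
rewrite !normrM !normfV -mulrDl ler_pdivrMr//.
have h1 := sin_lipschitz (k%:~R * (om * lam)) 0.
have h2 := cos_lipschitz 0 (k%:~R * (om * lam)).
rewrite sin0 !subr0 in h1; rewrite cos0 sub0r normrN in h2.
apply: le_trans (lerD h1 h2) _.
by rewrite mulrA [`|_ * lam|]normrM (ger0_norm l0); lra.
Qed.

Lemma arc_le_inv k lam : k != 0 -> normc (arc k lam) <= 3 / `|k%:~R * om|.
Proof.
move=> k0; rewrite /arc (negbTE k0).
apply: le_trans (normc_le_ReIm _) _ => /=.
have kom : 0 < `|k%:~R * om| by rewrite normr_gt0 mulf_neq0 ?intr_eq0// gt_eqF.
rewrite [`|_ / _|]normrM [`|(_ - _) / _|]normrM normfV -mulrDl ler_pdivrMr//.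
rewrite divfK ?gt_eqF//.
have := sin_max (k%:~R * (om * lam)); have := cos_max (k%:~R * (om * lam)).
have := ler_normB 1 (cos (k%:~R * (om * lam))); rewrite normr1; lra.
Qed.

Definition phase (s : R) (j l : int) : R[i] :=
  cis (j%:~R * (om * ln (1 - s)) + l%:~R * (om * ln s)).

(** The contribution of mode [j] at y = r (1 - s) and mode [l] at z = r s once r is integrated: the
    product has frequency [j + l] in ln r, over a range of logarithmic length - ln (1 - s). *)
Definition pair_mode (s : R) (j l : int) : R[i] :=
  phase s j l * arc (j + l) (- ln (1 - s)).

Lemma ev_mul_phase (r s : R) (L : seq (int * R[i])) : 0 < r -> 0 < s < 1 ->
  ev (om * ln (r * (1 - s))) L * ev (om * ln (r * s)) L =
  ev (om * ln r) (prodm (phase s) L L).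
Proof.
move=> r0 /andP[s0 s1]; have s10 : 0 < 1 - s by rewrite subr_gt0.
rewrite ev_prodm /ev big_distrlr/=; apply: eq_bigr => e _; apply: eq_bigr => h _.
rewrite mul_Re conjcM conjc_cis lnM// lnM// /phase; congr (Re _ + Re _).
  have -> : e.1%:~R * (om * (ln r + ln (1 - s))) =
    e.1%:~R * (om * ln r) + e.1%:~R * (om * ln (1 - s)) by ring.
  have -> : h.1%:~R * (om * (ln r + ln s)) =
    h.1%:~R * (om * ln r) + h.1%:~R * (om * ln s) by ring.
  have -> : (e.1 + h.1)%:~R * (om * ln r) =
    e.1%:~R * (om * ln r) + h.1%:~R * (om * ln r) by rewrite intrD; ring.
  by rewrite !cisD; ring.
have -> : e.1%:~R * (om * (ln r + ln (1 - s))) =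
  e.1%:~R * (om * ln r) + e.1%:~R * (om * ln (1 - s)) by ring.
have -> : - (h.1%:~R * (om * (ln r + ln s))) =
  - (h.1%:~R * (om * ln r)) + (- h.1)%:~R * (om * ln s) by rewrite rmorphN/=; ring.
have -> : (e.1 - h.1)%:~R * (om * ln r) =
  e.1%:~R * (om * ln r) + - (h.1%:~R * (om * ln r)) by rewrite intrB; ring.
by rewrite !cisD; ring.
Qed.

Lemma inner_flux (x s : R) (L : seq (int * R[i])) : 0 < x -> 0 < s < 1 ->
  (\int[mu]_(r in `]x, (x / (1 - s))%R[)
    (ev (om * ln (r * (1 - s))) L * ev (om * ln (r * s)) L / r)%:E =
  (ev (om * ln x) (prodm (pair_mode s) L L))%:E)%E.
Proof.
move=> x0 s01; have /andP[s0 s1] := s01; have s10 : 0 < 1 - s by rewrite subr_gt0.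
transitivity (\int[mu]_(r in `]x, (x / (1 - s))%R[)
    (ev (om * ln r) (prodm (phase s) L L) / r)%:E)%E.
  apply: eq_integral => r /set_mem/=; rewrite in_itv/= => /andP[xr _].
  by rewrite ev_mul_phase// (lt_trans x0).
rewrite arc_integral_sum//; last by rewrite invf_gt1//; lra.
rewrite lnV ?posrE// ev_prodm /prodm big_cat/= !big_allpairs_dep/= -big_split/=.
congr EFin; apply: eq_bigr => e _; rewrite -big_split/=; apply: eq_bigr => h _.
by rewrite /pair_mode; congr (Re _ + Re _); ring.
Qed.
End Modes.

(** * Complex integrals against the weight (1 - s) W s *)

Section ComplexIntegral.
Context {R : realType}.
Local Notation mu := (@lebesgue_measure R).
Local Notation Re := complex.Re.
Local Notation Im := complex.Im.
Local Notation D := (`]0%R, 1%R[%classic : set R).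
Implicit Types (W : R -> R) (m : R -> R[i]).

Let mD : measurable (D : set (measurableTypeR R)).
Proof. exact: measurable_itv. Qed.

(* The length of the range ]x, x / (1 - s)[ in logarithmic scale. *)
Definition loglen (s : R) : R := - ln (1 - s).

Lemma loglen_ge0 s : 0 < s < 1 -> 0 <= loglen s.
Proof. by move=> /andP[s0 s1]; rewrite oppr_ge0 ln_le0//; lra. Qed.

Lemma measurable_loglen : measurable_fun [set: R] loglen.
Proof.
rewrite /loglen; apply: measurable_funN.
apply: (measurableT_comp (@measurable_ln R)); exact: measurable_funB.
Qed.

Definition weight_integrable W (q : R -> R) :=
  mu.-integrable D (EFin \o (fun s => (1 - s) * W s * q s)).

Definition cint W m : R[i] :=
  Complex (\int[mu]_(s in D) ((1 - s) * W s * Re (m s)))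
          (\int[mu]_(s in D) ((1 - s) * W s * Im (m s))).

Definition cintegrable W m :=
  weight_integrable W (fun s => Re (m s)) /\ weight_integrable W (fun s => Im (m s)).

Definition measurable_cfun m :=
  measurable_fun [set: R] (fun s => Re (m s)) /\ measurable_fun [set: R] (fun s => Im (m s)).

Definition admissible W :=
  [/\ measurable_fun [set: R] W, forall s, 0 < s < 1 -> 0 <= W s &
      weight_integrable W loglen].

Lemma Re_cint W m c : cintegrable W m ->
  \int[mu]_(s in D) ((1 - s) * W s * Re (c * m s)) = Re (c * cint W m).
Proof.
move=> [h1 h2]; case: c => a b.
transitivity (\int[mu]_(s in D) (a * ((1 - s) * W s * Re (m s))
   - b * ((1 - s) * W s * Im (m s)))).
  by apply: eq_Rintegral => s _; case: (m s) => c d /=; ring.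
rewrite RintegralB//; [|exact: (integrableZl mD a h1)|exact: (integrableZl mD b h2)].
by rewrite !RintegralZl.
Qed.

Lemma cintegrable_Re W m c : cintegrable W m ->
  mu.-integrable D (EFin \o (fun s => (1 - s) * W s * Re (c * m s))).
Proof.
move=> [h1 h2]; case: c => a b.
have := integrableB mD (integrableZl mD a h1)
  (integrableZl mD b h2).
apply: eq_integrable => // s _ /=.
by rewrite -!EFinM -EFinB; congr EFin; case: (m s) => c d /=; ring.
Qed.

Lemma weight_integrable_le W (q1 q2 : R -> R) (C : R) :
  measurable_fun [set: R] W -> (forall s, 0 < s < 1 -> 0 <= W s) ->
  measurable_fun [set: R] q1 ->
  (forall s, 0 < s < 1 -> `|q1 s| <= C * q2 s) ->
  weight_integrable W q2 -> weight_integrable W q1.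
Proof.
move=> mW W0 m1 q12 h2.
have hC := integrableZl mD C h2.
apply: le_integrable hC => //.
  apply: measurable_funTS; apply/measurable_EFinP; apply: measurable_funM => //.
  by apply: measurable_funM => //; exact: measurable_funB.
move=> s /=; rewrite in_itv/= => s01; have /andP[s0 s1] := s01.
have W1 : 0 <= (1 - s) * W s by rewrite mulr_ge0 ?W0//; lra.
rewrite lee_fin normrM (ger0_norm W1) [leRHS]ger0_norm.
  by rewrite mulrCA ler_wpM2l// q12.
by rewrite mulrCA mulr_ge0// (le_trans _ (q12 _ s01)).
Qed.

Lemma cintegrable_le W m (q : R -> R) (C : R) :
  measurable_fun [set: R] W -> (forall s, 0 < s < 1 -> 0 <= W s) ->
  measurable_cfun m ->
  (forall s, 0 < s < 1 -> normc (m s) <= C * q s) ->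
  weight_integrable W q -> cintegrable W m.
Proof.
move=> mW W0 [m1 m2] mq hq; split.
  apply: (weight_integrable_le mW W0 _ _ hq) => // s s01.
  exact: le_trans (Re_le_normc _) (mq s s01).
apply: (weight_integrable_le mW W0 _ _ hq) => // s s01.
exact: le_trans (Im_le_normc _) (mq s s01).
Qed.

Lemma normc_cint W m (q : R -> R) :
  (forall s, 0 < s < 1 -> 0 <= W s) -> cintegrable W m ->
  (forall s, 0 < s < 1 -> normc (m s) <= q s) -> weight_integrable W q ->
  normc (cint W m) <= 2 * \int[mu]_(s in D) ((1 - s) * W s * q s).
Proof.
move=> W0 [h1 h2] mq hq; apply: le_trans (normc_le_ReIm _) _.
have H (g : R -> R) : weight_integrable W g -> (forall s, 0 < s < 1 -> `|g s| <= q s) ->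
    `|\int[mu]_(s in D) ((1 - s) * W s * g s)| <= \int[mu]_(s in D) ((1 - s) * W s * q s).
  move=> hg gq; apply: le_trans (le_normr_Rintegral mD hg) _.
  apply: le_Rintegral => //; first exact: integrable_norm.
  move=> s /=; rewrite in_itv/= => s01; have /andP[s0 s1] := s01.
  have W1 : 0 <= (1 - s) * W s by rewrite mulr_ge0 ?W0//; lra.
  by rewrite normrM (ger0_norm W1) ler_wpM2l// gq.
rewrite mulr_natl mulr2n; apply: lerD.
  exact: (H _ h1 (fun s s01 => le_trans (Re_le_normc _) (mq s s01))).
exact: (H _ h2 (fun s s01 => le_trans (Im_le_normc _) (mq s s01))).
Qed.

Lemma cintD W1 W2 m (t : R) : cintegrable W1 m -> cintegrable W2 m ->
  cint (fun s => W1 s + t * W2 s) m = cint W1 m + (t%:C)%C * cint W2 m.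
Proof.
move=> [h1 h2] [k1 k2].
have H (g : R -> R) : weight_integrable W1 g -> weight_integrable W2 g ->
   \int[mu]_(s in D) ((1 - s) * (W1 s + t * W2 s) * g s) =
   \int[mu]_(s in D) ((1 - s) * W1 s * g s) + t * \int[mu]_(s in D) ((1 - s) * W2 s * g s).
  move=> hg kg; rewrite -RintegralZl// -RintegralD//; last exact: (integrableZl mD t kg).
  by apply: eq_Rintegral => s _; ring.
rewrite /cint (H _ h1 k1) (H _ h2 k2); apply/eqP; rewrite eq_complex/=.
by apply/andP; split; apply/eqP; ring.
Qed.

Lemma weight_integrableD W1 W2 (g : R -> R) (t : R) :
  weight_integrable W1 g -> weight_integrable W2 g ->
  weight_integrable (fun s => W1 s + t * W2 s) g.
Proof.
move=> h1 h2.
have := integrableD mD h1 (integrableZl mD t h2).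
apply: eq_integrable => // s _ /=.
by rewrite -!EFinM -EFinD; congr EFin; ring.
Qed.

Lemma cintZ W m c : cintegrable W m -> cint W (fun s => c * m s) = c * cint W m.
Proof.
move=> hm; apply/eqP; rewrite eq_complex; apply/andP; split; apply/eqP.
  exact: Re_cint.
have ImE (z : R[i]) : Im z = Re (- 'i%C * z) by case: z => a b /=; ring.
rewrite [RHS]ImE mulrA -Re_cint//=; apply: eq_Rintegral => s _.
by rewrite ImE mulrA.
Qed.

Lemma cintDm W m1 m2 : cintegrable W m1 -> cintegrable W m2 ->
  cint W (fun s => m1 s + m2 s) = cint W m1 + cint W m2.
Proof.
move=> [h1 h2] [k1 k2].
have H (g1 g2 : R -> R) : weight_integrable W g1 -> weight_integrable W g2 ->
   \int[mu]_(s in D) ((1 - s) * W s * (g1 s + g2 s)) =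
   \int[mu]_(s in D) ((1 - s) * W s * g1 s) + \int[mu]_(s in D) ((1 - s) * W s * g2 s).
  by move=> hg kg; rewrite -RintegralD//; apply: eq_Rintegral => s _; ring.
apply/eqP; rewrite eq_complex/= -(H _ _ h1 k1) -(H _ _ h2 k2).
by apply/andP; split; apply/eqP; apply: eq_Rintegral => s _;
  case: (m1 s) (m2 s) => [? ?] [? ?].
Qed.

Lemma cintJ W m : cintegrable W m ->
  cint W (fun s => conjc (m s)) = conjc (cint W m).
Proof.
move=> [h1 h2]; rewrite /cint /conjc; congr Complex.
  by apply: eq_Rintegral => s _; case: (m s).
rewrite -mulN1r -RintegralZl//; apply: eq_Rintegral => s _.
by case: (m s) => a b /=; ring.
Qed.

(** The value is an equation in the extended reals, where the flux lives, coupled with the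
    integrability that additivity requires. *)
Definition has_int (f : R -> R) (v : R) :=
  mu.-integrable D (EFin \o f) /\ (\int[mu]_(s in D) (f s)%:E = v%:E)%E.

Lemma has_intD f g a b : has_int f a -> has_int g b ->
  has_int (fun s => f s + g s) (a + b).
Proof.
move=> [h1 h2] [k1 k2]; split.
  exact: (integrableD mD h1 k1).
by rewrite EFinD -h2 -k2 -integralD.
Qed.

Lemma has_int_sum (I : Type) (r : seq I) (F : I -> R -> R) (v : I -> R) :
  (forall i, has_int (F i) (v i)) ->
  has_int (fun s => \sum_(i <- r) F i s) (\sum_(i <- r) v i).
Proof.
move=> h; elim: r => [|i r IH].
  rewrite big_nil; under eq_fun do rewrite big_nil; split.
    exact: integrable0.
  exact: integral0.
rewrite big_cons; under eq_fun do rewrite big_cons.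
exact: has_intD.
Qed.

Lemma has_int_Re W m c : cintegrable W m ->
  has_int (fun s => (1 - s) * W s * Re (c * m s)) (Re (c * cint W m)).
Proof.
move=> hm; split; first exact: cintegrable_Re.
rewrite -Re_cint// /Rintegral fineK//; apply: integrable_fin_num => //.
exact: cintegrable_Re.
Qed.

End ComplexIntegral.

(** * The flux of a trigonometric sum as a bilinear form *)

Section FluxTrig.
Context {R : realType}.
Local Notation mu := (@lebesgue_measure R).
Local Notation Re := complex.Re.
Local Notation D := (`]0%R, 1%R[%classic : set R).
Variable (om : R).
Hypothesis om0 : 0 < om.

Lemma measurable_cis (g : R -> R) : measurable_fun [set: R] g ->
  measurable_cfun (fun s => cis (g s)).
Proof.
move=> mg; split; apply: measurableT_comp mg; apply: continuous_measurable_fun.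
  exact: continuous_cos.
exact: continuous_sin.
Qed.

Lemma measurable_cfunM (m1 m2 : R -> R[i]) :
  measurable_cfun m1 -> measurable_cfun m2 -> measurable_cfun (fun s => m1 s * m2 s).
Proof.
move=> [a b] [c d]; split.
  have -> : (fun s => Re (m1 s * m2 s)) =
     (fun s => Re (m1 s) * Re (m2 s) - complex.Im (m1 s) * complex.Im (m2 s)).
    by apply/funext => s /=; case: (m1 s) (m2 s) => [? ?] [? ?].
  by apply: measurable_funB; apply: measurable_funM.
have -> : (fun s => complex.Im (m1 s * m2 s)) =
   (fun s => Re (m1 s) * complex.Im (m2 s) + complex.Im (m1 s) * Re (m2 s)).
  by apply/funext => s /=; case: (m1 s) (m2 s) => [? ?] [? ?].
by apply: measurable_funD; apply: measurable_funM.
Qed.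

Lemma measurable_ln1 : measurable_fun [set: R] (fun s : R => ln (1 - s)).
Proof. by apply: (measurableT_comp (@measurable_ln R)); exact: measurable_funB. Qed.

Lemma measurable_pair_mode j l :
  measurable_cfun (fun s => pair_mode om s j l).
Proof.
apply: measurable_cfunM.
  have mZ (a : R) (g : R -> R) : measurable_fun [set: R] g ->
      measurable_fun [set: R] (fun s => a * (om * g s)).
    by move=> mg; do 2!apply: measurable_funM => //.
  apply: measurable_cis; apply: measurable_funD; apply: mZ; first exact: measurable_ln1.
  exact: measurable_ln.
have ml := measurable_loglen; rewrite /loglen in ml.
rewrite /arc; case: eqP => _.
  split; first exact: ml.
  exact: measurable_cst.
have mk : measurable_fun [set: R] (fun s : R => (j + l)%:~R * (om * - ln (1 - s))).
  by do 2!apply: measurable_funM => //; exact: ml.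
have [mc ms] := measurable_cis mk.
split; first by apply: measurable_funM => //; exact: ms.
by apply: measurable_funM => //; apply: measurable_funB => //; exact: mc.
Qed.

Lemma normc_pair_mode s j l : 0 < s < 1 ->
  normc (pair_mode om s j l) <= 2 * loglen s.
Proof.
move=> s01; rewrite normcM normc_cis mul1r; apply: arc_le => //.
exact: loglen_ge0.
Qed.

Definition pair_coef (W : R -> R) (j l : int) : R[i] :=
  cint W (fun s => pair_mode om s j l).

Lemma cintegrable_pair_mode W j l : admissible W ->
  cintegrable W (fun s => pair_mode om s j l).
Proof.
move=> [mW W0 hW]; apply: (cintegrable_le mW W0 _ _ hW).
  exact: measurable_pair_mode.
by move=> s; exact: normc_pair_mode.
Qed.

Lemma pair_coef_hermitian W : admissible W -> hermitian (pair_coef W).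
Proof.
move=> aW j l; rewrite /pair_coef -cintJ; last exact: cintegrable_pair_mode.
congr cint; apply/funext => s.
rewrite /pair_mode conjcM conjc_cis -arcN (opprD j l); congr (_ * _); congr cis.
by rewrite !rmorphN/=; ring.
Qed.

Lemma measurable_ev (L : seq (int * R[i])) : measurable_fun [set: R] (fun t => ev t L).
Proof.
rewrite /ev; apply: measurable_sum => -[k [a b]] /=.
have mk : measurable_fun [set: R] (fun t : R => k%:~R * t) by exact: measurable_funM.
have [mc ms] := measurable_cis mk.
by apply: measurable_funB; apply: measurable_funM.
Qed.

(** [inner_flux] is integrated in s. The sums are finite, so linearity carries the integral onto the
    symbol and turns [pair_mode] into [pair_coef]. *)
Lemma flux_trig (gamma x : R) (W : R -> R) (L : seq (int * R[i])) : 0 < x ->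
  admissible W -> (forall s, W (1 - s) = W s) -> (forall t, 0 <= ev t L) ->
  flux (hom_kernel gamma W) (modulated gamma (fun t => ev (om * t) L)) x =
  (ev (om * ln x) (prodm (pair_coef W) L L))%:E.
Proof.
move=> x0 aW Wsym L0; have [mW W0 hW] := aW.
have mG : measurable_fun [set: R] (fun t => ev (om * t) L).
  by apply: (measurableT_comp (measurable_ev L)); exact: measurable_funM.
rewrite flux_modulated//.
transitivity (\int[mu]_(s in D) ((1 - s) * W s *
    ev (om * ln x) (prodm (pair_mode om s) L L))%:E)%E.
  apply: eq_integral => s /set_mem/=; rewrite in_itv/= => s01.
  have /andP[s0 s1] := s01.
  rewrite EFinM -inner_flux// -ge0_integralZl//.
  - apply: measurable_funTS; apply/measurable_EFinP; apply: measurable_funM.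
      by apply: measurable_funM; apply: (measurableT_comp mG);
        apply: (measurableT_comp (@measurable_ln R)); exact: measurable_funM.
    exact: measurable_inv.
  - move=> r /=; rewrite in_itv/= => /andP[xr _].
    by rewrite lee_fin divr_ge0 ?mulr_ge0// ltW// (lt_trans x0).
  - by rewrite lee_fin mulr_ge0 ?W0// subr_ge0 ltW.
set X := om * ln x.
have H e h : has_int (fun s => (1 - s) * W s *
   (Re (e.2 * h.2 * pair_mode om s e.1 h.1 / 2 * cis ((e.1 + h.1)%:~R * X)) +
   Re (e.2 * conjc h.2 * pair_mode om s e.1 (- h.1) / 2 * cis ((e.1 - h.1)%:~R * X))))
   (Re (e.2 * h.2 * pair_coef W e.1 h.1 / 2 * cis ((e.1 + h.1)%:~R * X)) +
   Re (e.2 * conjc h.2 * pair_coef W e.1 (- h.1) / 2 * cis ((e.1 - h.1)%:~R * X))).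
  have h1 := has_int_Re (e.2 * h.2 / 2 * cis ((e.1 + h.1)%:~R * X))
    (cintegrable_pair_mode e.1 h.1 aW).
  have h2 := has_int_Re (e.2 * conjc h.2 / 2 * cis ((e.1 - h.1)%:~R * X))
    (cintegrable_pair_mode e.1 (- h.1) aW).
  have := has_intD h1 h2.
  have sw (a b c d : R[i]) : a / b * c * d = a * d / b * c by ring.
  by rewrite !sw; under eq_fun do rewrite -mulrDr !sw.
have := has_int_sum L (fun e => has_int_sum L (H e)).
rewrite -ev_prodm => -[_ <-]; apply: eq_integral => s _; congr EFin.
rewrite ev_prodm mulr_sumr; apply: eq_bigr => e _.
by rewrite mulr_sumr.
Qed.
End FluxTrig.

(** * Improper integrals bounded through an antiderivative *)

Section OpenFTC.
Context {R : realType}.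
Local Notation mu := (@lebesgue_measure R).

(** The integrand may blow up at both ends: shrunken intervals exhaust the domain, the increments of
    [F] bound the integral on each, and monotone convergence concludes. *)
Lemma ge0_integral_le_FTC (f F : R -> R) (a b B : R) : a < b ->
  (forall x, a < x < b -> 0 <= f x) ->
  (forall x, a < x < b -> is_derive x 1 F (f x)) ->
  (forall x, a < x < b -> {for x, continuous f}) ->
  (forall x y, a < x -> x < y -> y < b -> F y - F x <= B) ->
  (\int[mu]_(x in `]a, b[) (f x)%:E <= B%:E)%E.
Proof.
move=> ab f0 dF cf FB.
(* The offset 3 keeps [2 * e n] below [b - a], so that no interval of the exhaustion is empty. *)
pose e n : R := (b - a) / n.+3%:R.
have e0 n : 0 < e n by rewrite divr_gt0 ?subr_gt0.
have e2 n : 2 * e n < b - a.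
  rewrite /e mulrCA gtr_pMr ?subr_gt0// ltr_pdivrMr// mul1r ltr_nat//.
pose I n : set R := `](a + e n), (b - e n)[%classic.
have eS m n : (m <= n)%N -> e n <= e m.
  by move=> mn; rewrite /e ler_pM2l ?subr_gt0// lef_pV2 ?posrE// ler_nat !ltnS.
have IE : \bigcup_n I n = `]a, b[%classic.
  apply/seteqP; split => x /=.
    move=> [n _]; rewrite /I/= !in_itv/= => /andP[h1 h2]; have := e0 n.
    by move=> h; apply/andP; split; lra.
  rewrite in_itv/= => /andP[ax xb].
  pose d := Num.min (x - a) (b - x).
  have d0 : 0 < d by rewrite lt_min !subr_gt0 ax xb.
  have [n hn] : exists n, e n < d.
    exists (Num.trunc ((b - a) / d)).
    rewrite /e ltr_pdivrMr// mulrC -ltr_pdivrMr//.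
    apply: lt_trans (truncnS_gt _) _.
    by rewrite ltr_nat ltnS leqW.
  exists n => //; rewrite /I/= in_itv/=.
  move: hn; rewrite lt_min => /andP[h1 h2]; apply/andP; split; lra.
have mf : measurable_fun `]a, b[ f.
  apply: open_continuous_measurable_fun; first exact: interval_open.
  by move=> x /set_mem/=; rewrite in_itv/=; exact: cf.
have sub n : I n `<=` `]a, b[ by rewrite -IE; exact: bigcup_sup.
have In x n : I n x -> a < x < b by move=> /sub; rewrite /= in_itv.
rewrite -IE.
have C : (\int[mu]_(x in I n) (f x)%:E)%E @[n --> \oo] -->
    (\int[mu]_(x in \bigcup_n I n) (f x)%:E)%E.
  apply: ge0_nondecreasing_set_cvg_integral.
  - move=> m n mn; apply/subsetPset => x; rewrite /I/= !in_itv/= => /andP[h1 h2].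
    by have := eS _ _ mn => h; apply/andP; split; lra.
  - by move=> n; exact: measurable_itv.
  - by move=> n; apply/measurable_EFinP; exact: measurable_funS mf.
  - by move=> n x /In xab; rewrite lee_fin f0.
rewrite -(cvg_lim _ C)//; apply: lime_le; first by apply/cvg_ex; eexists; exact: C.
near=> n.
have en := e0 n; have e2n := e2 n.
have lt_ab : a + e n < b - e n by lra.
have cI x : a + e n <= x <= b - e n -> a < x < b by move=> /andP[? ?]; apply/andP; split; lra.
have -> : (\int[mu]_(x in I n) (f x)%:E = (F (b - e n) - F (a + e n))%:E)%E.
  apply: integral_FTC_oo => //; first by move=> x /cI; exact: dF.
  by move=> x /cI; exact: cf.
by rewrite lee_fin FB//; lra.
Unshelve. all: by end_near. Qed.

Lemma continuous_powR (e x : R) : 0 < x -> {for x, continuous (fun y : R => y `^ e)}.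
Proof.
move=> x0; apply/differentiable_continuous/derivable1_diffP.
by apply: derivable_powR; rewrite in_itv/= x0.
Qed.

Lemma integral_powR_le (e q : R) : 0 < e -> 0 < q ->
  (\int[mu]_(x in `]0%R, q[) (x `^ (e - 1))%:E <= (q `^ e / e)%:E)%E.
Proof.
move=> e0 q0; apply: (@ge0_integral_le_FTC _ (fun x => e^-1 * x `^ e)); first exact: q0.
- by move=> x _; exact: powR_ge0.
- move=> x /andP[x0 _]; have := is_derive1_powR e x0 => d.
  by apply: is_derive_eq; rewrite /GRing.scale/=; field; rewrite gt_eqF.
- by move=> x /andP[x0 _]; exact: continuous_powR.
- move=> x y x0 xy yq; rewrite -mulrBr mulrC ler_pM2r ?invr_gt0//.
  have : y `^ e <= q `^ e.
    by rewrite ge0_ler_powR ?nnegrE ?(ltW e0) ?(ltW q0) ?(ltW yq)//; lra.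
  have := powR_ge0 x e; lra.
Qed.

Lemma integral_powRN_le (e q r : R) : 0 < e -> 0 < q -> q < r ->
  (\int[mu]_(x in `]q, r[) (x `^ (- e - 1))%:E <= (q `^ (- e) / e)%:E)%E.
Proof.
move=> e0 q0 qr; apply: (@ge0_integral_le_FTC _ (fun x => - e^-1 * x `^ (- e))); first exact: qr.
- by move=> x _; exact: powR_ge0.
- move=> x /andP[qx _]; have x0 := lt_trans q0 qx.
  have := is_derive1_powR (- e) x0 => d.
  by apply: is_derive_eq; rewrite /GRing.scale/=; field; rewrite gt_eqF.
- by move=> x /andP[qx _]; apply: continuous_powR; exact: lt_trans q0 qx.
- move=> x y qx xy yr; rewrite -mulrBr mulNr -mulrN mulrC ler_pM2r ?invr_gt0//.
  have : x `^ (- e) <= q `^ (- e).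
    rewrite !powRN lef_pV2 ?posrE ?powR_gt0//; last exact: lt_trans qx.
    by rewrite ge0_ler_powR ?nnegrE ?(ltW e0) ?(ltW q0) ?(ltW qx)//; lra.
  have := powR_ge0 y (- e); lra.
Qed.

Lemma integral_powR_onem_le (e : R) : 0 < e ->
  (\int[mu]_(x in `]0%R, 1%R[) ((1 - x) `^ (e - 1))%:E <= (e^-1)%:E)%E.
Proof.
move=> e0; apply: (@ge0_integral_le_FTC _ (fun x => - (e^-1 * (1 - x) `^ e))); first exact: ltr01.
- by move=> x _; exact: powR_ge0.
- move=> x /andP[_ x1]; have x10 : 0 < 1 - x by lra.
  have d1 : is_derive x 1 (fun y : R => 1 - y) (-1).
    by apply: is_derive_eq; ring.
  have d2 := is_derive1_powR e x10.
  have d3 : is_derive x 1 (fun y : R => (1 - y) `^ e) (e * (1 - x) `^ (e - 1) * - 1).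
    exact: (@is_derive1_comp _ (fun y : R => y `^ e) (fun y : R => 1 - y) x _ _ d2 d1).
  by apply: is_derive_eq; rewrite /GRing.scale/=; field; rewrite gt_eqF.
- move=> x /andP[_ x1]; have x10 : 0 < 1 - x by lra.
  apply: (@continuous_comp _ _ _ (fun y : R => 1 - y) (fun y : R => y `^ (e - 1))).
    by apply: cvgB; [exact: cvg_cst|exact: cvg_id].
  exact: continuous_powR.
- move=> x y x0 xy y1; rewrite opprK addrC -mulrBr -[leRHS]mulr1 ler_pM2l ?invr_gt0//.
  have : (1 - x) `^ e <= 1 `^ e.
    by rewrite ge0_ler_powR ?nnegrE ?(ltW e0)//; lra.
  have := powR_ge0 (1 - y) e; rewrite powR1; lra.
Qed.

End OpenFTC.

(** * The base weight s^(- beta) and its moments *)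

Section BaseWeight.
Context {R : realType}.
Local Notation mu := (@lebesgue_measure R).
Local Notation Re := complex.Re.
Local Notation D := (`]0%R, 1%R[%classic : set R).

Let mD : measurable (D : set (measurableTypeR R)).
Proof. exact: measurable_itv. Qed.

Lemma ge0_integral_bounded (f : R -> R) (B : R) : measurable_fun D f ->
  (forall s, 0 < s < 1 -> 0 <= f s) -> (\int[mu]_(s in D) (f s)%:E <= B%:E)%E ->
  mu.-integrable D (EFin \o f) /\ \int[mu]_(s in D) f s <= B.
Proof.
move=> mf f0 fB.
have i0 : (0 <= \int[mu]_(s in D) (f s)%:E)%E.
  by apply: integral_ge0 => s /=; rewrite in_itv/= => s01; rewrite lee_fin f0.
split.
  apply/integrableP; split; first exact/measurable_EFinP.
  apply: le_lt_trans (ltry B); apply: le_trans fB.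
  rewrite le_eqVlt; apply/orP; left; apply/eqP; apply: eq_integral => s /set_mem/=.
  by rewrite in_itv/= => s01; rewrite ger0_norm// f0.
rewrite /Rintegral -lee_fin fineK//.
by rewrite ge0_fin_numE// (le_lt_trans fB) ?ltry.
Qed.

Lemma integral_indic_le (g : R -> R) (A : set R) (B : R) :
  measurable (A : set (measurableTypeR R)) -> A `<=` D -> measurable_fun [set: R] g ->
  (forall s, A s -> 0 <= g s) -> (\int[mu]_(s in A) (g s)%:E <= B%:E)%E ->
  (\int[mu]_(s in D) (g s * \1_A s)%:E <= B%:E)%E.
Proof.
move=> mA AD mg g0; apply: le_trans.
rewrite (_ : A = D `&` A) ?integral_mkcondr; last first.
  by apply/seteqP; split => x; [move=> Ax; split => //; exact: AD|case].
rewrite le_eqVlt; apply/orP; left; apply/eqP; apply: eq_integral => s sD.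
rewrite patchE indicE in_setI sD/=; case: ifPn => _; first by rewrite mulr1.
by rewrite mulr0.
Qed.

Lemma integral_scale_le (g : R -> R) (c B : R) : 0 <= c ->
  measurable_fun [set: R] g -> (forall s, 0 < s < 1 -> 0 <= g s) ->
  (\int[mu]_(s in D) (g s)%:E <= B%:E)%E ->
  (\int[mu]_(s in D) (c * g s)%:E <= (c * B)%:E)%E.
Proof.
move=> c0 mg g0 gB; under eq_integral do rewrite EFinM.
rewrite ge0_integralZl//.
- by rewrite EFinM lee_wpmul2l// lee_fin.
- by apply/measurable_EFinP; exact: measurable_funTS.
Qed.

Lemma dominated3 (f g1 g2 g3 : R -> R) (B1 B2 B3 : R) :
  measurable_fun D f -> measurable_fun [set: R] g1 ->
  measurable_fun [set: R] g2 -> measurable_fun [set: R] g3 ->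
  (forall s, 0 < s < 1 -> 0 <= f s <= g1 s + g2 s + g3 s) ->
  (forall s, 0 < s < 1 -> [/\ 0 <= g1 s, 0 <= g2 s & 0 <= g3 s]) ->
  (\int[mu]_(s in D) (g1 s)%:E <= B1%:E)%E ->
  (\int[mu]_(s in D) (g2 s)%:E <= B2%:E)%E ->
  (\int[mu]_(s in D) (g3 s)%:E <= B3%:E)%E ->
  mu.-integrable D (EFin \o f) /\ \int[mu]_(s in D) f s <= B1 + B2 + B3.
Proof.
move=> mf m1 m2 m3 fg g0 I1 I2 I3.
have mE (g : R -> R) : measurable_fun [set: R] g -> measurable_fun D (EFin \o g).
  by move=> mg; apply/measurable_EFinP; exact: measurable_funTS.
apply: ge0_integral_bounded => //; first by move=> s /fg/andP[].
apply: (@le_trans _ _ (\int[mu]_(s in D) ((g1 s)%:E + (g2 s)%:E + (g3 s)%:E))%E).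
  apply: ge0_le_integral => //.
  - by move=> s /=; rewrite in_itv/= => /fg/andP[? _]; rewrite lee_fin.
  - exact/measurable_EFinP.
  - by apply: emeasurable_funD; [apply: emeasurable_funD|]; exact: mE.
  - by move=> s /=; rewrite in_itv/= => /fg/andP[_ ?]; rewrite -!EFinD lee_fin.
rewrite ge0_integralD//=; last 4 first.
- by move=> s; rewrite in_itv/= => /g0[? ? ?]; rewrite -EFinD lee_fin addr_ge0.
- by apply: emeasurable_funD; exact: mE.
- by move=> s; rewrite in_itv/= => /g0[? ? ?]; rewrite lee_fin.
- exact: mE.
rewrite ge0_integralD//=; last 4 first.
- by move=> s; rewrite in_itv/= => /g0[? ? ?]; rewrite lee_fin.
- exact: mE.
- by move=> s; rewrite in_itv/= => /g0[? ? ?]; rewrite lee_fin.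
- exact: mE.
by rewrite !EFinD; apply: leeD => //; exact: leeD.
Qed.

Variable (beta : R).
Hypothesis beta_lo : 3 / 2 <= beta.
Hypothesis beta_hi : beta < 2.

(* Normalised so that [(1 - s) * base_weight s = s `^ (- beta)] on the left half. *)
Definition base_weight (s : R) : R :=
  (Num.max s (1 - s))^-1 * (Num.min s (1 - s)) `^ (- beta).

Lemma base_weight_sym s : base_weight (1 - s) = base_weight s.
Proof. by rewrite /base_weight subKr maxC minC. Qed.

Lemma measurable_base_weight : measurable_fun [set: R] base_weight.
Proof.
have m1 : measurable_fun [set: R] (fun s : R => 1 - s) by exact: measurable_funB.
apply: measurable_funM.
  by apply: (measurableT_comp (@measurable_inv R)); exact: measurable_maxr.
by apply: (measurableT_comp (measurable_powR _)); exact: measurable_minr.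
Qed.

Lemma base_weight_ge1 (s : R) : 0 < s < 1 -> 1 <= base_weight s.
Proof.
have bl := beta_lo; move=> /andP[s0 s1].
rewrite /base_weight -[1 in leLHS]mulr1; apply: ler_pM => //.
  by rewrite invf_ge1 ?ge_max ?lt_max ?s0//; apply/andP; split; lra.
rewrite powRN invf_ge1; last by rewrite powR_gt0// lt_min s0/=; lra.
rewrite -[leRHS](_ : 1 `^ beta = 1); last by rewrite powR1.
rewrite ge0_ler_powR ?nnegrE//; first lra.
  by rewrite le_min (ltW s0)/=; lra.
by rewrite ge_min (ltW s1).
Qed.

Lemma base_weight_left (s : R) : 0 < s <= 1 / 2 -> (1 - s) * base_weight s = s `^ (- beta).
Proof.
move=> /andP[s0 s1]; rewrite /base_weight.
have h : s <= 1 - s by lra.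
by rewrite (max_idPr h) (min_idPl h) mulVKf//; lra.
Qed.

Lemma base_weight_right (s : R) : 1 / 2 <= s < 1 ->
  (1 - s) * base_weight s <= 2 * (1 - s) `^ (1 - beta).
Proof.
move=> /andP[s0 s1]; rewrite /base_weight.
have h : 1 - s <= s by lra.
have s10 : 0 < 1 - s by lra.
rewrite (max_idPl h) (min_idPr h) mulrCA powRD ?(gt_eqF s10) ?implybT//.
rewrite powRr1 ?(ltW s10)// ler_pM2r; last by rewrite mulr_gt0// powR_gt0.
by rewrite -[leRHS]invrK lef_pV2 ?posrE; lra.
Qed.

Lemma loglen_le (s : R) : 0 < s <= 1 / 2 -> loglen s <= 2 * s.
Proof.
move=> /andP[s0 s1]; rewrite /loglen -lnV ?posrE; last lra.
have -> : (1 - s)^-1 = 1 + s / (1 - s) by field; lra.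
apply: le_trans (le_ln1Dx _) _.
  by rewrite (lt_trans _ (divr_gt0 _ _))//; lra.
by rewrite ler_pdivrMr; [nra|lra].
Qed.

Lemma le_loglen (s : R) : 0 < s < 1 -> s <= loglen s.
Proof.
move=> /andP[s0 s1]; rewrite /loglen lerNr.
by apply: le_trans (le_ln1Dx _) _; lra.
Qed.

(** A logarithm is below any power: ln u < u at u = (1 - s)^(- k). *)
Lemma loglen_le_powR (k s : R) : 0 < k -> 0 < s < 1 -> loglen s <= (1 - s) `^ (- k) / k.
Proof.
move=> k0 /andP[s0 s1]; rewrite ler_pdivlMr//.
have s10 : 0 < 1 - s by lra.
rewrite /loglen mulNr mulrC -mulNr -ln_powR ltW// ln_sublinear// powR_gt0//.
Qed.

Let measurable_onem_powR (e : R) : measurable_fun [set: R] (fun s : R => (1 - s) `^ e).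
Proof. by apply: (measurableT_comp (measurable_powR _)); exact: measurable_funB. Qed.

Let measurable_V : measurable_fun [set: R] (fun s => (1 - s) * base_weight s).
Proof.
by apply: measurable_funM; [exact: measurable_funB|exact: measurable_base_weight].
Qed.

Let V_ge0 s : 0 < s < 1 -> 0 <= (1 - s) * base_weight s.
Proof.
move=> s01; rewrite mulr_ge0//; last by rewrite (le_trans ler01) ?base_weight_ge1.
by rewrite subr_ge0 ltW//; case/andP: s01.
Qed.

Let powR_shift (s : R) : 0 < s -> s `^ (- beta) * s = s `^ (2 - beta - 1).
Proof.
move=> s0; rewrite -{2}[s](powRr1 (ltW s0)) -powRD ?(gt_eqF s0) ?implybT//.
by congr powR; ring.
Qed.

(** On the left half the integrand is at most 2 s^(1 - beta); on the right half it is at most 2 (1 -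
    s)^(1 - beta) times a logarithm. Both are integrable as beta < 2. *)
Lemma base_weight_integrable : weight_integrable base_weight loglen.
Proof.
have bl := beta_lo; have bh := beta_hi.
(* Half of the room 2 - beta is spent on the logarithm; the remaining exponent 1 - beta - k is k - 1
   > - 1. *)
pose k := (2 - beta) / 2; have k0 : 0 < k by rewrite /k; lra.
have e0 : 0 < 2 - beta by lra.
apply: (proj1 (@dominated3 (fun s => (1 - s) * base_weight s * loglen s)
  (fun s => 2 * s `^ (2 - beta - 1)) (fun s => 2 / k * (1 - s) `^ (k - 1)) (fun=> 0)
  (2 * (1 `^ (2 - beta) / (2 - beta))) (2 / k * k^-1) 0 _ _ _ _ _ _ _ _ _)) => //.
- apply: measurable_funTS; apply: measurable_funM; first exact: measurable_V.
  exact: measurable_loglen.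
- by apply: measurable_funM => //; exact: measurable_powR.
- by apply: measurable_funM => //; exact: measurable_onem_powR.
- move=> s s01; have /andP[s0 s1] := s01.
  have s10 : 0 < 1 - s by lra.
  rewrite mulr_ge0 ?V_ge0 ?loglen_ge0//= addr0.
  have p1 : 0 <= 2 * s `^ (2 - beta - 1) by rewrite mulr_ge0// powR_ge0.
  have p2 : 0 <= 2 / k * (1 - s) `^ (k - 1).
    by rewrite mulr_ge0 ?powR_ge0// divr_ge0// ltW.
  have [sh|sh] := leP s (1 / 2).
    rewrite base_weight_left ?s0// -(powR_shift s0).
    apply: (@le_trans _ _ (s `^ (- beta) * (2 * s))).
      by rewrite ler_wpM2l ?powR_ge0// loglen_le// s0.
    lra.
  apply: (@le_trans _ _ (2 * (1 - s) `^ (1 - beta) * ((1 - s) `^ (- k) / k))).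
    rewrite ler_pM ?V_ge0 ?loglen_ge0 ?loglen_le_powR//.
    by rewrite base_weight_right// (ltW sh).
  have -> : k - 1 = 1 - beta - k by rewrite /k; field.
  rewrite [(1 - s) `^ (1 - beta - k)]powRD ?(gt_eqF s10) ?implybT//; lra.
- move=> s _; split => //; first by rewrite mulr_ge0// powR_ge0.
  by rewrite mulr_ge0 ?powR_ge0// divr_ge0// ltW.
- apply: integral_scale_le; [by []|exact: measurable_powR| |].
    by move=> s _; exact: powR_ge0.
  exact: integral_powR_le.
- apply: integral_scale_le; [by rewrite divr_ge0// ltW|exact: measurable_onem_powR| |].
    by move=> s _; exact: powR_ge0.
  exact: integral_powR_onem_le.
- by rewrite integral0.
Qed.

Lemma base_weight_admissible : admissible base_weight.
Proof.
split; [exact: measurable_base_weight| |exact: base_weight_integrable].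
by move=> s s01; rewrite (le_trans ler01) ?base_weight_ge1.
Qed.

Lemma base_weight_min_le : exists2 C : R, 0 < C & forall t, 1 <= t ->
  \int[mu]_(s in D) ((1 - s) * base_weight s * Num.min (loglen s) t^-1) <=
    C * t `^ (beta - 2).
Proof.
have bl := beta_lo; have bh := beta_hi.
have e0 : 0 < 2 - beta by lra.
have b0 : 0 < beta - 1 by lra.
exists (2 / (2 - beta) + 2 `^ (beta - 1) / (beta - 1) + 2 / (2 - beta)) => [|t t1].
  by rewrite !addr_gt0// ?divr_gt0// powR_gt0.
have t0 : 0 < t by lra.
have ti0 : 0 < t^-1 by rewrite invr_gt0.
have ti1 : t^-1 <= 1 by rewrite invf_le1.
(* The open interval [A2] starts at half of 1 / t so as to contain the point s = 1 / t. *)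
pose q := t^-1 / 2; have q0 : 0 < q by rewrite divr_gt0.
have q1 : q < 1 by rewrite /q; lra.
have tq : t^-1 `^ (2 - beta) = t `^ (beta - 2).
  by rewrite -powR_inv1 ?(ltW t0)// -powRrM; congr powR; ring.
pose A1 : set R := `]0, t^-1[%classic; pose A2 : set R := `]q, 1[%classic.
have mA1 : measurable (A1 : set (measurableTypeR R)) by exact: measurable_itv.
have mA2 : measurable (A2 : set (measurableTypeR R)) by exact: measurable_itv.
apply: le_trans (proj2 (@dominated3 (fun s => (1 - s) * base_weight s * Num.min (loglen s) t^-1)
  (fun s => 2 * (s `^ (2 - beta - 1) * \1_A1 s))
  (fun s => t^-1 * (s `^ (- (beta - 1) - 1) * \1_A2 s))
  (fun s => 2 * t^-1 * (1 - s) `^ (2 - beta - 1))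
  (2 * (t^-1 `^ (2 - beta) / (2 - beta))) (t^-1 * (q `^ (- (beta - 1)) / (beta - 1)))
  (2 * t^-1 * (2 - beta)^-1) _ _ _ _ _ _ _ _ _)) _ => //.
- apply: measurable_funTS; apply: measurable_funM; first exact: measurable_V.
  by apply: measurable_minr => //; exact: measurable_loglen.
- apply: measurable_funM => //; apply: measurable_funM; first exact: measurable_powR.
  exact: measurable_indic.
- apply: measurable_funM => //; apply: measurable_funM; first exact: measurable_powR.
  exact: measurable_indic.
- by apply: measurable_funM => //; exact: measurable_onem_powR.
- move=> s s01; have /andP[s0 s1] := s01.
  have s10 : 0 < 1 - s by lra.
  have l0 := loglen_ge0 s01.
  rewrite mulr_ge0 ?V_ge0 ?le_min ?l0 ?(ltW ti0)//=.
  have p1 : 0 <= s `^ (2 - beta - 1) by exact: powR_ge0.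
  have p2 : 0 <= s `^ (- (beta - 1) - 1) by exact: powR_ge0.
  have p3 : 0 <= (1 - s) `^ (2 - beta - 1) by exact: powR_ge0.
  have i1 : 0 <= \1_A1 s :> R by rewrite indicE.
  have i2 : 0 <= \1_A2 s :> R by rewrite indicE.
  have r1 : 0 <= 2 * (s `^ (2 - beta - 1) * \1_A1 s) by rewrite !mulr_ge0.
  have r2 : 0 <= t^-1 * (s `^ (- (beta - 1) - 1) * \1_A2 s).
    by rewrite !mulr_ge0// ltW.
  have r3 : 0 <= 2 * t^-1 * (1 - s) `^ (2 - beta - 1) by rewrite !mulr_ge0// ltW.
  have [sh|sh] := leP s (1 / 2).
    rewrite base_weight_left ?s0//.
    have [st|st] := ltP s t^-1.
      have : \1_A1 s = 1 :> R by rewrite indicE mem_set// /A1/= in_itv/= s0 st.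
      move=> i1E; rewrite i1E mulr1 in r1 *.
      apply: (@le_trans _ _ (s `^ (- beta) * (2 * s))).
        by rewrite ler_wpM2l ?powR_ge0// ge_min loglen_le ?s0.
      rewrite -(powR_shift s0); lra.
    have : \1_A2 s = 1 :> R.
      by rewrite indicE mem_set// /A2/= in_itv/= s1 andbT /q; lra.
    move=> i2E; rewrite i2E mulr1 in r2 *.
    have -> : - (beta - 1) - 1 = - beta by ring.
    apply: (@le_trans _ _ (s `^ (- beta) * t^-1)).
      by rewrite ler_wpM2l ?powR_ge0// ge_min lexx orbT.
    lra.
  apply: (@le_trans _ _ (2 * (1 - s) `^ (1 - beta) * t^-1)).
    rewrite ler_pM ?V_ge0 ?le_min ?l0 ?(ltW ti0)// ?ge_min ?lexx ?orbT//.
    by rewrite base_weight_right// (ltW sh).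
  have -> : 1 - beta = 2 - beta - 1 by ring.
  lra.
- move=> s s01; split; rewrite ?mulr_ge0 ?powR_ge0 ?(ltW ti0)// indicE//.
- apply: integral_scale_le; [by []| | |].
  + by apply: measurable_funM; [exact: measurable_powR|exact: measurable_indic].
  + by move=> s _; rewrite mulr_ge0 ?powR_ge0 ?indicE.
  apply: integral_indic_le; [exact: measurable_itv| | | |].
  + by apply: subset_itv; rewrite bnd_simp.
  + exact: measurable_powR.
  + by move=> s _; exact: powR_ge0.
  exact: integral_powR_le.
- apply: integral_scale_le; [exact: ltW| | |].
  + by apply: measurable_funM; [exact: measurable_powR|exact: measurable_indic].
  + by move=> s _; rewrite mulr_ge0 ?powR_ge0 ?indicE.
  apply: integral_indic_le; [exact: measurable_itv| | | |].
  + by apply: subset_itv; rewrite bnd_simp// ltW.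
  + exact: measurable_powR.
  + by move=> s _; exact: powR_ge0.
  exact: integral_powRN_le.
- apply: integral_scale_le; [by rewrite mulr_ge0// ltW|exact: measurable_onem_powR| |].
    by move=> s _; exact: powR_ge0.
  exact: integral_powR_onem_le.
rewrite tq.
have -> : t^-1 * (q `^ (- (beta - 1)) / (beta - 1)) =
    2 `^ (beta - 1) / (beta - 1) * t `^ (beta - 2).
  have -> : q `^ (- (beta - 1)) = 2 `^ (beta - 1) * t `^ (beta - 1).
    have -> : q = (2 * t) `^ (-1) by rewrite powR_inv1 ?mulr_ge0 ?(ltW t0)// invfM mulrC.
    by rewrite -powRrM mulrNN mul1r powRM// ltW.
  have -> : beta - 2 = beta - 1 - 1 by ring.
  rewrite [t `^ (beta - 1 - 1)]powRB ?(gt_eqF t0) ?implybT// powRr1 ?(ltW t0)//.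
  by field; lra.
have : t^-1 <= t `^ (beta - 2).
  rewrite -powR_inv1 ?(ltW t0)// ler_powR//; lra.
move: (t `^ (beta - 2)) (2 `^ (beta - 1) / (beta - 1)) => T Y hT.
have : 2 * t^-1 / (2 - beta) <= 2 * T / (2 - beta).
  by rewrite ler_pM2r ?invr_gt0// ler_pM2l.
lra.
Qed.

End BaseWeight.

(** * Growth of the multiplier of the base weight *)

Section Resonance.
Context {R : realType}.
Local Notation mu := (@lebesgue_measure R).
Local Notation Re := complex.Re.
Local Notation D := (`]0%R, 1%R[%classic : set R).

Let mD : measurable (D : set (measurableTypeR R)).
Proof. exact: measurable_itv. Qed.

(** The integrand of F. Divided by i t, at t = k om, it is the response at [G = 1] to a mode [k]
    placed in either factor. The product form [resonanceE] shows that it is O(t loglen s), hence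
    integrable against the weight. *)
Definition resonance (t s : R) : R[i] :=
  1 + cis (t * (ln s + loglen s)) - cis (- (t * loglen s)) - cis (t * ln s).

Definition freq (W : R -> R) (t : R) : R[i] := cint W (resonance t).

Lemma resonanceE t s : resonance t s =
  (1 - cis (- (t * loglen s))) * (1 + cis (t * (ln s + loglen s))).
Proof.
rewrite /resonance.
have -> : cis (t * ln s) = cis (- (t * loglen s)) * cis (t * (ln s + loglen s)).
  by rewrite -cisD; congr cis; ring.
by ring.
Qed.

Lemma normc_1Bcis (x : R) : normc (1 - cis x) <= 2 * `|x|.
Proof.
apply: le_trans (normc_le_ReIm _) _ => /=.
have := cos_lipschitz 0 x; have := sin_lipschitz 0 x.
rewrite cos0 sin0 !sub0r !normrN; lra.
Qed.

Lemma normc_resonance_le t s : normc (resonance t s) <= 4 * `|t| * `|loglen s|.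
Proof.
rewrite resonanceE normcM.
have h1 := normc_1Bcis (- (t * loglen s)); rewrite normrN normrM in h1.
have h2 := normcD 1 (cis (t * (ln s + loglen s))); rewrite normc1 normc_cis in h2.
apply: le_trans (ler_pM (normc_ge0 _) (normc_ge0 _) h1 h2) _; lra.
Qed.

Lemma normc_resonance_le4 t s : normc (resonance t s) <= 4.
Proof.
rewrite resonanceE normcM.
have h1 := normcD 1 (- cis (- (t * loglen s))); rewrite normcN' normc1 normc_cis in h1.
have h2 := normcD 1 (cis (t * (ln s + loglen s))); rewrite normc1 normc_cis in h2.
apply: le_trans (ler_pM (normc_ge0 _) (normc_ge0 _) h1 h2) _; lra.
Qed.

Lemma measurable_resonance t : measurable_cfun (resonance t).
Proof.
have ml := @measurable_loglen R; have ml2 := @measurable_ln R.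
have m1 : measurable_fun [set: R] (fun s => t * (ln s + loglen s)).
  by apply: measurable_funM => //; exact: measurable_funD.
have m2 : measurable_fun [set: R] (fun s => - (t * loglen s)).
  by apply: measurable_funN; exact: measurable_funM.
have m3 : measurable_fun [set: R] (fun s => t * ln s) by exact: measurable_funM.
have [a1 b1] := measurable_cis m1; have [a2 b2] := measurable_cis m2.
have [a3 b3] := measurable_cis m3.
split; apply: measurable_funB => //; apply: measurable_funB => //; exact: measurable_funD.
Qed.

Lemma cintegrable_resonance W t : admissible W -> cintegrable W (resonance t).
Proof.
move=> [mW W0 hW]; apply: (cintegrable_le mW W0 (measurable_resonance t) _ hW) => s s01.
by apply: le_trans (normc_resonance_le _ _) _; rewrite (ger0_norm (loglen_ge0 s01)).
Qed.

Lemma has_int_restrict (g : R -> R) (A : set R) (v : R) :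
  measurable (A : set (measurableTypeR R)) -> A `<=` D ->
  mu.-integrable A (EFin \o g) -> (\int[mu]_(s in A) (g s)%:E = v%:E)%E ->
  has_int (fun s => g s * \1_A s) v.
Proof.
move=> mA AD ig hv.
have AE : D `&` A = A.
  by apply/seteqP; split => x; [case|move=> Ax; split => //; exact: AD].
have E s : ((g s * \1_A s)%:E = ((EFin \o g) \_ A) s)%E.
  rewrite patchE indicE; case: ifPn => _; first by rewrite mulr1.
  by rewrite mulr0.
split.
  apply: (@eq_integrable _ _ _ mu D mD ((EFin \o g) \_ A)).
    by move=> s _ /=; rewrite -E.
  have := @integrable_restrict _ _ _ mu A mA D mD (EFin \o g).
  by move=> [+ _]; apply; rewrite AE.
under eq_integral do rewrite E.
by rewrite -integral_mkcondr AE -hv.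
Qed.

Lemma has_intZ (f : R -> R) (c a : R) : has_int f a -> has_int (fun s => c * f s) (c * a).
Proof.
move=> [h1 h2]; split; first exact: (integrableZl mD c h1).
by under eq_integral do rewrite EFinM; rewrite integralZl// h2.
Qed.

Lemma integrable_has_int (f : R -> R) : mu.-integrable D (EFin \o f) ->
  has_int f (\int[mu]_(s in D) f s).
Proof. by move=> h; split => //; rewrite /Rintegral fineK// integrable_fin_num. Qed.

Lemma le_has_int (f g : R -> R) (a b : R) : has_int f a -> has_int g b ->
  (forall s, 0 < s < 1 -> f s <= g s) -> a <= b.
Proof.
move=> [h1 h2] [k1 k2] fg; rewrite -lee_fin -h2 -k2; apply: le_integral => // s /set_mem/=.
by rewrite in_itv/= => /fg; rewrite lee_fin.
Qed.

Variable (beta : R).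
Hypothesis beta_lo : 3 / 2 <= beta.
Hypothesis beta_hi : beta < 2.

Lemma is_derive_loglen (s : R) : s < 1 -> is_derive s 1 loglen (1 - s)^-1.
Proof.
move=> s1; have s10 : 0 < 1 - s by rewrite subr_gt0.
have d1 : is_derive s 1 (fun y : R => 1 - y) (-1) by apply: is_derive_eq; ring.
have d2 := is_derive1_ln s10.
have d3 : is_derive s 1 (fun y : R => ln (1 - y)) ((1 - s)^-1 * - 1).
  exact: (@is_derive1_comp _ (@ln R) (fun y : R => 1 - y) s _ _ d2 d1).
by apply: is_derive_eq; ring.
Qed.

Lemma cos_half_lt1 : 0 < 1 - cos (1 / 2) :> R.
Proof.
have p2 := @pi_ge2 R.
have h0 : (0 : R) \in `[0, pi] by rewrite in_itv/= lexx (le_trans _ p2).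
have h1 : (1 / 2 : R) \in `[0, pi] by rewrite in_itv/=; apply/andP; split; lra.
by have := ltr_cos h0 h1; rewrite cos0 subr_gt0 => ->; lra.
Qed.

(** Used with q = 1 / (2 - beta): the ends of [psi] cost 2 each, the three error integrals 4 q, 4 q
    and 8 q. *)
Let remainder_bound (K x y I3 I4 I5 E u q : R) :
  - 2 <= x -> y <= 2 -> 0 <= u -> 0 <= q -> u * E <= 2 ->
  I3 <= 1 * q -> I4 <= E * q -> I5 <= q ->
  K - (4 + 16 * q) <= K + (x - y) + - 4 * I3 + - (2 * u) * I4 + - 8 * I5.
Proof.
move=> hx hy u0 q0 uE h3 h4 h5.
have := ler_wpM2l u0 h4; have := ler_wpM2r q0 uE; lra.
Qed.

Section FixedFrequency.
Variable (t : R).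
Hypothesis t2 : 2 <= t.

Let phs (s : R) := t * (ln s + loglen s).
(* [dpsi] agrees with the oscillating part of the integrand of [Re (freq _ t)] up to an integrable
   error of size s^(1 - beta) uniform in [t], so that part contributes only bounded boundary terms;
   the growth comes from [1 - cos (t * loglen s)] near [s = 1 / t]. *)
Let psi (s : R) : R := s `^ (1 - beta) / t * (sin (phs s) - sin (t * ln s)).
Let dpsi (s : R) : R := s `^ (- beta) * (cos (phs s) - cos (t * ln s))
  + s `^ (1 - beta) * cos (phs s) / (1 - s)
  + (1 - beta) * s `^ (- beta) / t * (sin (phs s) - sin (t * ln s)).

Let is_derive_psi (s : R) : 0 < s < 1 -> is_derive s 1 psi (dpsi s).
Proof.
move=> /andP[s0 s1].
have d1 := is_derive_loglen s1; have d2 := is_derive1_ln s0.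
have d3 := is_derive1_powR (1 - beta) s0.
have t0 : t != 0 by have h := t2; rewrite gt_eqF//; lra.
apply: is_derive_eq; rewrite /GRing.scale/=.
have -> : 1 - beta - 1 = - beta by ring.
have p : s `^ (1 - beta) = s `^ (- beta) * s.
  rewrite -{3}[s](powRr1 (ltW s0)) -powRD ?(gt_eqF s0) ?implybT//.
  by congr powR; ring.
rewrite /dpsi -/(phs s) p; field.
by rewrite t0 !gt_eqF//; lra.
Qed.

Let continuous_dpsi (s : R) : 0 < s < 1 -> {for s, continuous dpsi}.
Proof.
move=> /andP[s0 s1].
have d1 := is_derive_loglen s1; have d2 := is_derive1_ln s0.
have d3 := is_derive1_powR (1 - beta) s0.
have d4 := is_derive1_powR (- beta) s0.
apply/differentiable_continuous/derivable1_diffP.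
have d5 : derivable (fun y : R => (1 - y)^-1) s 1.
  apply: derivableV; first by rewrite gt_eqF// subr_gt0.
  by apply: derivableB.
have d6 : is_derive s 1 (fun y : R => (1 - y)^-1) ('D_1 (fun y : R => (1 - y)^-1) s).
  exact: derivableP.
by apply: ex_derive.
Qed.

Let kap : R := 1 - cos (1 / 2).
(** Chosen so that t eta^(2 - beta) = 1. Below [eta] the crude lower bound - 2 t s^(1 - beta) then
    costs O(1); above it, away from the singularity at 0, the derivative of [psi] integrates
    exactly. *)
Let eta : R := t `^ (- (2 - beta)^-1).

Let kap_gt0 : 0 < kap. Proof. exact: cos_half_lt1. Qed.

(** The range is that of t loglen s on [setA]. It lies where the cosine decreases, because 2 <=
    pi. *)
Let kap_le1Bcos (x : R) : 1 / 2 <= x <= 2 -> kap <= 1 - cos x.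
Proof.
move=> /andP[x1 x2]; have p2 := @pi_ge2 R.
rewrite lerD2l lerN2; move: x1; rewrite le_eqVlt => /orP[/eqP <-//|x1].
have h0 : x \in `[0, pi] by rewrite in_itv/=; apply/andP; split; lra.
have h1 : (1 / 2 : R) \in `[0, pi] by rewrite in_itv/=; apply/andP; split; lra.
by rewrite ltW// (ltr_cos h1 h0).
Qed.

Let t_gt0 : 0 < t. Proof. exact: lt_le_trans t2. Qed.

Let eta_gt0 : 0 < eta. Proof. exact: powR_gt0. Qed.

Let eta_le : eta <= (2 * t)^-1.
Proof.
have tt := t2; have bl := beta_lo; have bh := beta_hi; have t0 := t_gt0.
apply: (@le_trans _ _ (t `^ (- 2))).
  apply: ler_powR; first lra.
  by rewrite lerN2 -[leLHS]invrK lef_pV2 ?posrE ?invr_gt0//; lra.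
rewrite powRN lef_pV2 ?posrE ?powR_gt0 ?mulr_gt0// powR_mulrn ?(ltW t0)// expr2.
by rewrite ler_pM2r.
Qed.

Let eta_pow : t * eta `^ (2 - beta) = 1.
Proof.
have bh := beta_hi; have t0 := t_gt0.
rewrite /eta -powRrM mulNr mulVf ?gt_eqF//; last lra.
by rewrite powR_inv1 ?(ltW t0)// divff// gt_eqF.
Qed.

Let setA : set R := `](2 * t)^-1, t^-1[%classic.
Let setB : set R := `]eta, (1 / 2)[%classic.
Let setE : set R := `]0, (2 * eta)[%classic.

(** In order: the gain of 1 - cos at the scale s = 1 / t; the oscillating part as an exact
    derivative; the error of that replacement; the loss below [eta], on a set reaching 2 eta so as
    to contain [eta]; the loss on the right half. *)
Let minorant (s : R) : R :=
  kap * t `^ beta * \1_setA s + dpsi s * \1_setB s - 4 * s `^ (2 - beta - 1)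
  - 2 * t * (s `^ (2 - beta - 1) * \1_setE s) - 8 * (1 - s) `^ (2 - beta - 1).

Let t_inv_le : t^-1 <= 1 / 2.
Proof. by rewrite div1r lef_pV2 ?posrE// t_gt0. Qed.

Let powR_mulx (s : R) : 0 < s -> s `^ (- beta) * s = s `^ (2 - beta - 1).
Proof.
move=> s0; rewrite -{2}[s](powRr1 (ltW s0)) -powRD ?(gt_eqF s0) ?implybT//.
by congr powR; ring.
Qed.

Let minorantP s : 0 < s < 1 ->
  minorant s <= (1 - s) * base_weight beta s * Re (resonance t s).
Proof.
move=> s01; have /andP[s0 s1] := s01.
have tt := t2; have t0 := t_gt0; have tl := t_inv_le; have el := eta_le.
have e0 := eta_gt0; have bl := beta_lo; have bh := beta_hi.
have t2i : (2 * t)^-1 = t^-1 / 2 by rewrite invfM mulrC.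
have l0 := loglen_ge0 s01.
have p1 : 0 <= s `^ (2 - beta - 1) by exact: powR_ge0.
have p2 : 0 <= (1 - s) `^ (2 - beta - 1) by exact: powR_ge0.
have ReE : Re (resonance t s) = (1 - cos (t * loglen s)) + (cos (phs s) - cos (t * ln s)).
  by rewrite /resonance /= cosN /phs; ring.
have iE : 0 <= \1_setE s :> R by rewrite indicE.
have q1 : 0 <= t * (s `^ (2 - beta - 1) * \1_setE s) by rewrite !mulr_ge0// ltW.
have nA : (s <= (2 * t)^-1) || (t^-1 <= s) -> \1_setA s = 0 :> R.
  move=> h; rewrite indicE memNset// /setA/= in_itv/= => /andP[h1 h2].
  by move: h; rewrite leNgt h1/= leNgt h2.
have nB : (s <= eta) || (1 / 2 <= s) -> \1_setB s = 0 :> R.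
  move=> h; rewrite indicE memNset// /setB/= in_itv/= => /andP[h1 h2].
  by move: h; rewrite leNgt h1/= leNgt h2.
have cosl : `|cos (phs s) - cos (t * ln s)| <= t * loglen s.
  apply: le_trans (cos_lipschitz _ _) _; rewrite /phs.
  have -> : t * (ln s + loglen s) - t * ln s = t * loglen s by ring.
  by rewrite ger0_norm// mulr_ge0// ltW.
have sinl : `|sin (phs s) - sin (t * ln s)| <= t * loglen s.
  apply: le_trans (sin_lipschitz _ _) _; rewrite /phs.
  have -> : t * (ln s + loglen s) - t * ln s = t * loglen s by ring.
  by rewrite ger0_norm// mulr_ge0// ltW.
have c1 := cos_le1 (t * loglen s).
have pb : 0 < s `^ (- beta) by exact: powR_gt0.
rewrite /minorant.
(* Right half: the weight is at most 2 (1 - s)^(1 - beta) and [resonance] at most 4 in modulus,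
   hence the factor 8. *)
have [sh|sh] := ltP s (1 / 2); last first.
  rewrite nA ?(le_trans tl sh) ?orbT// nB ?sh ?orbT// !mulr0.
  have s10 : 0 < 1 - s by lra.
  have V1 : (1 - s) * base_weight beta s <= 2 * (1 - s) `^ (1 - beta).
    by apply: base_weight_right; rewrite ?sh.
  have V0 : 0 <= (1 - s) * base_weight beta s.
    rewrite mulr_ge0 ?(ltW s10)// (le_trans ler01)// base_weight_ge1//.
  have r4 := le_trans (Re_le_normc _) (normc_resonance_le4 t s).
  have h : (1 - s) * base_weight beta s * `|Re (resonance t s)| <=
      2 * (1 - s) `^ (1 - beta) * 4.
    by apply: ler_pM.
  have h' : - ((1 - s) * base_weight beta s * `|Re (resonance t s)|) <=
      (1 - s) * base_weight beta s * Re (resonance t s).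
    by rewrite -mulrN ler_wpM2l// lerNl ler_normr lexx orbT.
  have e1 : 2 - beta - 1 = 1 - beta by ring.
  rewrite e1 in p1 p2 q1 *; lra.
rewrite base_weight_left ?s0 ?(ltW sh)// ReE.
have ls : loglen s <= 2 * s by apply: loglen_le; rewrite s0 ltW.
have tls : t * loglen s <= t * (2 * s) by rewrite ler_pM2l.
have Pm := powR_mulx s0.
(* Below [eta], 1 - cos is nonnegative and the difference of cosines is at least - 2 t s by the
   Lipschitz bound. *)
have [se|se] := leP s eta.
  rewrite nA ?(le_trans se el)// nB ?se// !mulr0.
  have -> : \1_setE s = 1 :> R.
    by rewrite indicE mem_set// /setE/= in_itv/= s0/=; lra.
  have h : - (t * (2 * s)) <= 1 - cos (t * loglen s) + (cos (phs s) - cos (t * ln s)).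
    by move: cosl; rewrite ler_norml => /andP[cl _]; lra.
  have := ler_wpM2l (ltW pb) h.
  have -> : s `^ (- beta) * - (t * (2 * s)) = - (2 * t * s `^ (2 - beta - 1)).
    by rewrite -Pm; ring.
  lra.
have -> : \1_setB s = 1 :> R by rewrite indicE mem_set// /setB/= in_itv/= se.
have hA : kap * t `^ beta * \1_setA s <= s `^ (- beta) * (1 - cos (t * loglen s)).
  have pos : 0 <= s `^ (- beta) * (1 - cos (t * loglen s)).
    by rewrite mulr_ge0 ?(ltW pb)// subr_ge0.
  have [/andP[a1 a2]|a] := boolP (((2 * t)^-1 < s) && (s < t^-1)); last first.
    by rewrite nA ?mulr0// leNgt leNgt -negb_and.
  rewrite indicE mem_set; last by rewrite /setA/= in_itv/= a1.
  rewrite mulr1 mulrC; apply: ler_pM; rewrite ?powR_ge0 ?(ltW kap_gt0)//.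
    rewrite -[leLHS]invrK -powRN -powR_inv1 ?powR_ge0// -powRrM mulrN1 powRN.
    rewrite powRN lef_pV2 ?posrE ?powR_gt0//.
    have -> : t `^ (- beta) = t^-1 `^ beta.
      by rewrite -powR_inv1 ?(ltW t0)// -powRrM mulN1r.
    by rewrite ge0_ler_powR ?nnegrE ?invr_ge0 ?(ltW t0) ?(ltW s0) ?(ltW a2)//; lra.
  apply: kap_le1Bcos.
  have sl := le_loglen s01.
  have h1 : t * (2 * t)^-1 < t * s by rewrite ltr_pM2l.
  have h2 : t * s < t * t^-1 by rewrite ltr_pM2l.
  have h3 : t * s <= t * loglen s by rewrite ler_pM2l.
  rewrite divff ?gt_eqF// in h2.
  have h4 : t * (2 * t)^-1 = 1 / 2 by field; rewrite gt_eqF.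
  rewrite h4 in h1; apply/andP; split; lra.
(* The two extra terms of [dpsi] are at most 2 s^(1 - beta) each: the first since 1 - s >= 1 / 2,
   the second by the Lipschitz bound of the sine. *)
have hB : dpsi s <= s `^ (- beta) * (cos (phs s) - cos (t * ln s)) + 4 * s `^ (2 - beta - 1).
  rewrite /dpsi -addrA lerD2l.
  have e1 : 1 - beta = 2 - beta - 1 by ring.
  have g1 : s `^ (1 - beta) * cos (phs s) / (1 - s) <= 2 * s `^ (2 - beta - 1).
    rewrite ler_pdivrMr; last lra.
    rewrite e1; apply: (@le_trans _ _ (s `^ (2 - beta - 1) * 1)).
      by rewrite ler_wpM2l// cos_le1.
    have : s `^ (2 - beta - 1) * 1 <= s `^ (2 - beta - 1) * (2 * (1 - s)).
      by rewrite ler_wpM2l//; lra.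
    lra.
  have g2 : (1 - beta) * s `^ (- beta) / t * (sin (phs s) - sin (t * ln s)) <=
      2 * s `^ (2 - beta - 1).
    apply: le_trans (ler_norm _) _; rewrite normrM.
    have -> : `|(1 - beta) * s `^ (- beta) / t| = (beta - 1) * s `^ (- beta) / t.
      rewrite normrM (ger0_norm (ltW _) : `|t^-1| = t^-1) ?invr_gt0// normrM.
      by rewrite (ger0_norm (ltW pb)) distrC ger0_norm//; lra.
    apply: (@le_trans _ _ ((beta - 1) * s `^ (- beta) / t * (t * (2 * s)))).
      apply: ler_wpM2l; last exact: le_trans sinl tls.
      by rewrite divr_ge0 ?(ltW t0)// mulr_ge0 ?(ltW pb)//; lra.
    have -> : (beta - 1) * s `^ (- beta) / t * (t * (2 * s)) =
       (beta - 1) * (2 * s `^ (2 - beta - 1)).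
      by rewrite -Pm; field; rewrite gt_eqF.
    by rewrite ler_piMl ?mulr_ge0//; lra.
  lra.
rewrite mulr1 mulrDr; lra.
Qed.

Let has_int_A : has_int (fun s => kap * t `^ beta * \1_setA s) (kap / 2 * t `^ (beta - 1)).
Proof.
have t0 := t_gt0; have tl := t_inv_le.
have ti : (2 * t)^-1 = t^-1 / 2 by rewrite invfM mulrC.
have ti0 : 0 < t^-1 by rewrite invr_gt0.
have mA : measurable (setA : set (measurableTypeR R)) by exact: measurable_itv.
have muA : (mu setA = (t^-1 / 2)%:E)%E.
  rewrite /setA lebesgue_measure_itv/= lte_fin ifT; last by rewrite ti; lra.
  by rewrite -EFinB ti; congr EFin; lra.
have bE : t `^ (beta - 1) = t `^ beta / t.
  by rewrite powRB ?(gt_eqF t0) ?implybT// powRr1 ?(ltW t0).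
apply: (@has_int_restrict (fun=> kap * t `^ beta)) => //.
- by rewrite /setA; apply: subset_itv; rewrite bnd_simp; [rewrite ti|]; lra.
- have sA : setA `<=` `[(2 * t)^-1, t^-1] by apply: subset_itv; rewrite bnd_simp.
  apply: (integrableS (mu := mu) (measurable_itv _) mA sA).
  apply: continuous_compact_integrable; first exact: segment_compact.
  by apply: continuous_in_subspaceT => s _; exact: cvg_cst.
- rewrite integral_cst// [X in (_ * X)%E]muA -EFinM bE; congr EFin; field.
  by rewrite gt_eqF.
Qed.

Let psi_bound (s : R) : 0 < s <= 1 / 2 -> `|psi s| <= 2.
Proof.
move=> /andP[s0 sh]; have t0 := t_gt0; have bh := beta_hi; have bl := beta_lo.
have s01 : 0 < s < 1 by apply/andP; split; lra.
have l0 := loglen_ge0 s01.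
rewrite /psi normrM.
have sinl : `|sin (phs s) - sin (t * ln s)| <= t * (2 * s).
  apply: le_trans (sin_lipschitz _ _) _; rewrite /phs.
  have -> : t * (ln s + loglen s) - t * ln s = t * loglen s by ring.
  rewrite ger0_norm ?mulr_ge0 ?(ltW t0)// ler_pM2l//.
  by apply: loglen_le; rewrite s0.
apply: (@le_trans _ _ (s `^ (1 - beta) / t * (t * (2 * s)))).
  rewrite ger0_norm; last by rewrite divr_ge0 ?powR_ge0// ltW.
  by rewrite ler_wpM2l// divr_ge0 ?powR_ge0// ltW.
have -> : s `^ (1 - beta) / t * (t * (2 * s)) = 2 * (s `^ (1 - beta) * s).
  by field; rewrite gt_eqF.
have -> : s `^ (1 - beta) * s = s `^ (2 - beta).
  rewrite -{2}[s](powRr1 (ltW s0)) -powRD ?(gt_eqF s0) ?implybT//.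
  by congr powR; ring.
have : s `^ (2 - beta) <= 1 `^ (2 - beta).
  by rewrite ge0_ler_powR ?nnegrE ?(ltW s0)//; lra.
rewrite powR1; lra.
Qed.

Let has_int_B : has_int (fun s => dpsi s * \1_setB s) (psi (1 / 2) - psi eta).
Proof.
have e0 := eta_gt0; have tl := t_inv_le; have el := eta_le; have t0 := t_gt0.
have ti : (2 * t)^-1 = t^-1 / 2 by rewrite invfM mulrC.
have ti0 : 0 < t^-1 by rewrite invr_gt0.
have eh : eta < 1 / 2 by rewrite ti in el; lra.
have sub s : eta <= s <= 1 / 2 -> 0 < s < 1.
  by move=> /andP[? ?]; apply/andP; split; lra.
have mB : measurable (setB : set (measurableTypeR R)) by exact: measurable_itv.
apply: has_int_restrict => //.
- by rewrite /setB; apply: subset_itv; rewrite bnd_simp; lra.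
- have sb : setB `<=` `[eta, (1 / 2)] by apply: subset_itv; rewrite bnd_simp.
  apply: (integrableS (mu := mu) (measurable_itv _) mB sb).
  apply: continuous_compact_integrable; first exact: segment_compact.
  apply: continuous_in_subspaceT => s /set_mem/=; rewrite in_itv/= => /sub.
  exact: continuous_dpsi.
- apply: integral_FTC_oo => // s /sub; first exact: is_derive_psi.
  exact: continuous_dpsi.
Qed.

Let psi_ends : [/\ - 2 <= psi (1 / 2), psi eta <= 2 &
  t * (2 * eta) `^ (2 - beta) <= 2].
Proof.
have e0 := eta_gt0; have tl := t_inv_le; have el := eta_le; have t0 := t_gt0.
have bh := beta_hi; have bl := beta_lo.
have eh : eta <= 1 / 2.
  have ti : (2 * t)^-1 = t^-1 / 2 by rewrite invfM mulrC.
  have ti0 : 0 < t^-1 by rewrite invr_gt0.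
  rewrite ti in el; lra.
have h12 : 0 < (1 / 2 : R) <= 1 / 2 by rewrite lexx andbT; lra.
have := psi_bound h12; have := psi_bound (s := eta).
rewrite e0 eh !ler_norml => /(_ isT)/andP[_ p1] /andP[p2 _].
split => //; rewrite powRM ?(ltW e0)// mulrCA eta_pow mulr1.
rewrite -[leRHS](powRr1 (ler0n R 2)); apply: ler_powR; lra.
Qed.

Lemma freq_base_lower_aux :
  kap / 2 * t `^ (beta - 1) - (4 + 16 / (2 - beta)) <= Re (freq (base_weight beta) t).
Proof.
have e0 := eta_gt0; have tl := t_inv_le; have el := eta_le; have t0 := t_gt0.
have bh := beta_hi; have bl := beta_lo.
have ti : (2 * t)^-1 = t^-1 / 2 by rewrite invfM mulrC.
have ti0 : 0 < t^-1 by rewrite invr_gt0.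
have mp : measurable_fun [set: R] (fun s : R => s `^ (2 - beta - 1)) by exact: measurable_powR.
have mq : measurable_fun [set: R] (fun s : R => (1 - s) `^ (2 - beta - 1)).
  by apply: (measurableT_comp (measurable_powR _)); exact: measurable_funB.
have b0 : 0 < 2 - beta by lra.
have [i3 B3] := @ge0_integral_bounded R _ _ (measurable_funTS mp)
  (fun s _ => powR_ge0 s (2 - beta - 1)) (integral_powR_le b0 ltr01).
have [i5 B5] := @ge0_integral_bounded R _ _ (measurable_funTS mq)
  (fun s _ => powR_ge0 (1 - s) (2 - beta - 1)) (integral_powR_onem_le b0).
have mE : measurable (setE : set (measurableTypeR R)) by exact: measurable_itv.
have sE : setE `<=` D.
  by apply: subset_itv; rewrite bnd_simp//; rewrite ti in el; lra.
have m4 : measurable_fun [set: R] (fun s : R => s `^ (2 - beta - 1) * \1_setE s).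
  by apply: measurable_funM => //; exact: measurable_indic.
have e20 : 0 < 2 * eta by rewrite mulr_gt0.
have [|i4 B4] := @ge0_integral_bounded R _ _ (measurable_funTS m4) _
    (integral_indic_le mE sE mp (fun s _ => powR_ge0 s (2 - beta - 1))
      (integral_powR_le b0 e20)).
  by move=> s _; rewrite mulr_ge0 ?powR_ge0 ?indicE.
have h3 := has_intZ (- 4) (integrable_has_int i3).
have h4 := has_intZ (- (2 * t)) (integrable_has_int i4).
have h5 := has_intZ (- 8) (integrable_has_int i5).
have hf := integrable_has_int (cintegrable_resonance t (base_weight_admissible beta_lo beta_hi)).1.
have := le_has_int (has_intD (has_intD (has_intD (has_intD has_int_A has_int_B) h3) h4) h5) hf.
rewrite -/(Re (freq (base_weight beta) t)) => main.
apply: le_trans (main _); last first.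
  move=> s s01; apply: le_trans (minorantP s01); rewrite /minorant.
  by rewrite -!mulNr; exact: lexx.
have [p1 p2 ep] := psi_ends; rewrite powR1 in B3.
by apply: remainder_bound p1 p2 (ltW t0) _ ep B3 B4 B5; rewrite invr_ge0 ltW.
Qed.

End FixedFrequency.

Lemma freq_base_lower : exists c C : R, [/\ 0 < c, 0 < C &
  forall t, 2 <= t -> c * t `^ (beta - 1) - C <= Re (freq (base_weight beta) t)].
Proof.
have bh := beta_hi; exists ((1 - cos (1 / 2)) / 2), (4 + 16 / (2 - beta)).
split; first by have := cos_half_lt1; lra.
  by rewrite addr_gt0// divr_gt0//; lra.
by move=> t t2; exact: freq_base_lower_aux.
Qed.
End Resonance.

(** * The linear multipliers in terms of F *)

Section Symbol.
Context {R : realType}.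
Local Notation mu := (@lebesgue_measure R).
Local Notation Re := complex.Re.
Local Notation D := (`]0%R, 1%R[%classic : set R).
Variable (om : R).
Hypothesis om0 : 0 < om.

Lemma arc_cis (k : int) lam : k != 0 ->
  arc om k lam = Complex 0 (- (k%:~R * om)^-1) * (cis (k%:~R * om * lam) - 1).
Proof.
move=> k0; rewrite /arc (negbTE k0) /cis mulrA.
set t := k%:~R * om; rewrite -[in LHS]/t.
apply/eqP; rewrite eq_complex/=; apply/andP; split; apply/eqP; ring.
Qed.

Lemma symbol_pair_coef W (k : int) : admissible W -> k != 0 ->
  symbol (pair_coef om W) k =
  Complex 0 (- (k%:~R * om)^-1) * freq W (k%:~R * om).
Proof.
move=> aW k0; rewrite /symbol /pair_coef /freq.
rewrite -cintDm; try exact: cintegrable_pair_mode.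
rewrite -cintZ; last exact: cintegrable_resonance.
congr cint; apply/funext => s.
rewrite /pair_mode /phase add0r addr0 -[- ln (1 - s)]/(loglen s) arc_cis// resonanceE.
rewrite !mul0r add0r addr0.
have -> : k%:~R * (om * ln (1 - s)) = - (k%:~R * om * loglen s) by rewrite /loglen; ring.
rewrite [k%:~R * om * (ln s + _)]mulrDr [cis (_ * ln s + _)]cisD.
have -> : k%:~R * (om * ln s) = k%:~R * om * ln s by rewrite mulrA.
set a := cis (k%:~R * om * ln s).
have h : cis (k%:~R * om * loglen s) * cis (- (k%:~R * om * loglen s)) = 1.
  by rewrite -cisD subrr cis0.
move: h; set u := cis _; set v := cis (- _) => h.
(* As u v = 1, the product (a + v) (u - 1) expands into the four terms of [resonance]. *)
transitivity (Complex 0 (- (k%:~R * om)^-1) * (a * (u - 1) + (u * v - v))); first by ring.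
rewrite h.
transitivity (Complex 0 (- (k%:~R * om)^-1) * (1 + a * u - v - a * (u * v))); last by ring.
by rewrite h; ring.
Qed.

Lemma normc_symbol W (k : int) : admissible W -> k != 0 ->
  normc (symbol (pair_coef om W) k) = normc (freq W (k%:~R * om)) / `|k%:~R * om|.
Proof.
move=> aW k0; rewrite symbol_pair_coef// normcM mulrC; congr (_ * _).
by rewrite /normc expr0n/= add0r sqrtr_sqr normrN normfV.
Qed.

Lemma normc_pair_mode_min s (j l : int) : 0 < s < 1 -> j + l != 0 ->
  normc (pair_mode om s j l) <= 3 * Num.min (loglen s) (`|(j + l)%:~R * om|)^-1.
Proof.
move=> s01 jl; have l0 := loglen_ge0 s01.
rewrite normcM normc_cis mul1r.
have h1 := arc_le om0 (j + l) l0; have h2 := arc_le_inv om0 (- ln (1 - s)) jl.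
rewrite -[- ln (1 - s)]/(loglen s) in h2 *.
by rewrite /Num.min; case: ifP => _ //; lra.
Qed.

End Symbol.

(** * Bilinear coefficients of weights dominated by the base weight *)

Section Dominated.
Context {R : realType}.
Local Notation mu := (@lebesgue_measure R).
Local Notation D := (`]0%R, 1%R[%classic : set R).
Variable (beta : R).
Hypothesis beta_lo : 3 / 2 <= beta.
Hypothesis beta_hi : beta < 2.
Local Notation W0 := (base_weight beta).

Let mD : measurable (D : set (measurableTypeR R)).
Proof. exact: measurable_itv. Qed.

Definition dominated (K : R) (W : R -> R) :=
  measurable_fun [set: R] W /\ forall s, 0 < s < 1 -> 0 <= W s <= K * W0 s.

Lemma dominated_le_weight (K : R) W (q : R -> R) : dominated K W ->
  measurable_fun [set: R] q ->
  (forall s, 0 < s < 1 -> 0 <= q s <= loglen s) ->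
  weight_integrable W q /\
  \int[mu]_(s in D) ((1 - s) * W s * q s) <= K * \int[mu]_(s in D) ((1 - s) * W0 s * q s).
Proof.
move=> [mW WK] mq q0.
have [mB B0 hB] := base_weight_admissible beta_lo beta_hi.
have iB : weight_integrable W0 q.
  apply: (weight_integrable_le (C := 1) mB B0 mq _ hB) => s s01.
  by have /andP[a b] := q0 s s01; rewrite ger0_norm// mul1r.
have iKB := integrableZl mD K iB.
have V (s : R) : 0 < s < 1 -> 0 <= (1 - s) * W s * q s <= K * ((1 - s) * W0 s * q s).
  move=> s01; have /andP[s0 s1] := s01; have /andP[a b] := q0 s s01.
  have /andP[w0 w1] := WK s s01; have s10 : 0 <= 1 - s by rewrite subr_ge0 ltW.
  apply/andP; split; first by rewrite !mulr_ge0.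
  have -> : K * ((1 - s) * W0 s * q s) = (1 - s) * (K * W0 s) * q s by ring.
  by rewrite ler_wpM2r// ler_wpM2l.
have iW : weight_integrable W q.
  apply: (le_integrable mD _ _ iKB).
    apply: measurable_funTS; apply/measurable_EFinP; apply: measurable_funM => //.
    by apply: measurable_funM => //; exact: measurable_funB.
  move=> s /=; rewrite in_itv/= => /V/andP[v0 v1].
  by rewrite lee_fin !ger0_norm// (le_trans v0).
split => //; rewrite -RintegralZl//; apply: le_Rintegral => //.
by move=> s /=; rewrite in_itv/= => /V/andP[].
Qed.

Lemma dominated_admissible (K : R) W : dominated K W -> admissible W.
Proof.
move=> dW; have [mW WK] := dW; split => //; first by move=> s /WK/andP[].
apply: (proj1 (dominated_le_weight dW _ _)); first exact: measurable_loglen.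
by move=> s /loglen_ge0 ->/=.
Qed.

(** The decay is in the output frequency [j + l], with the exponent beta - 2 of the lower bound
    t^(beta - 1) / t on the multipliers, so that dividing by a multiplier loses only a constant. It
    comes from bounding [arc] by its length and by the inverse frequency at once. *)
Lemma dominated_pair_coef : exists2 C : R, 0 < C & forall (om K : R) W j l,
  0 < om -> 0 <= K -> dominated K W ->
  normc (pair_coef om W j l) <= K * C /\
  (j + l != 0 -> 1 <= `|(j + l)%:~R * om| ->
   normc (pair_coef om W j l) <= K * C * `|(j + l)%:~R * om| `^ (beta - 2)).
Proof.
have [C C0 hC] := base_weight_min_le beta_lo beta_hi.
pose I0 := \int[mu]_(s in D) ((1 - s) * W0 s * loglen s).
have [mB B0 hB] := base_weight_admissible beta_lo beta_hi.
have I00 : 0 <= I0.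
  apply: Rintegral_ge0 => s /=; rewrite in_itv/= => s01.
  have /andP[s0 s1] := s01.
  have s10 : (0 : R) <= 1 - s by rewrite subr_ge0 ltW.
  by apply: mulr_ge0; [apply: mulr_ge0 => //; exact: B0|exact: loglen_ge0].
(* [normc_cint] costs a factor 2, on top of 3 for the bound by a minimum and 2 for the bound by
   length. *)
exists (6 * C + 4 * I0); first by lra.
move=> om K W j l om0 K0 dW; have aW := dominated_admissible dW; have [mW W0' hW] := aW.
have hm := cintegrable_pair_mode om0 j l aW.
split.
  have i2 : weight_integrable W (fun s => 2 * loglen s).
    have := integrableZl mD 2 hW; apply: eq_integrable => // s _ /=.
    by rewrite -EFinM; congr EFin; ring.
  apply: le_trans (normc_cint W0' hm _ i2) _; first by move=> s; exact: normc_pair_mode.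
  have -> : \int[mu]_(s in D) ((1 - s) * W s * (2 * loglen s)) =
      2 * \int[mu]_(s in D) ((1 - s) * W s * loglen s).
    by rewrite -RintegralZl//; apply: eq_Rintegral => s _; ring.
  have [_] := dominated_le_weight dW (@measurable_loglen R)
    (fun s s01 => ltac:(by rewrite loglen_ge0//=)).
  rewrite -/I0 => h; rewrite mulrDr.
  have : 0 <= K * (6 * C) by rewrite !mulr_ge0// ltW.
  lra.
move=> jl kom; set T := `|_| in kom *.
pose q s : R := Num.min (loglen s) T^-1.
have T0 : 0 < T by lra.
have mq : measurable_fun [set: R] q.
  by apply: measurable_minr; [exact: measurable_loglen|exact: measurable_cst].
have qb (s : R) : 0 < s < 1 -> 0 <= q s <= loglen s.
  move=> s01; rewrite le_min loglen_ge0// invr_ge0 (ltW T0)/=.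
  by rewrite ge_min lexx.
have [iq hq] := dominated_le_weight dW mq qb.
have i3 : weight_integrable W (fun s => 3 * q s).
  have := integrableZl mD 3 iq; apply: eq_integrable => // s _ /=.
  by rewrite -EFinM; congr EFin; ring.
apply: le_trans (normc_cint W0' hm _ i3) _.
  by move=> s s01; exact: normc_pair_mode_min.
have -> : \int[mu]_(s in D) ((1 - s) * W s * (3 * q s)) =
    3 * \int[mu]_(s in D) ((1 - s) * W s * q s).
  by rewrite -RintegralZl//; apply: eq_Rintegral => s _; ring.
have h2 := ler_wpM2l K0 (hC T kom).
have : 0 <= K * (4 * I0) * T `^ (beta - 2).
  by rewrite !mulr_ge0 ?powR_ge0.
rewrite -/q in h2; rewrite (mulrDr K) (mulrDl (K * _)); lra.
Qed.

End Dominated.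

(** * Bumps as approximate point masses *)

Section Bump.
Context {R : realType}.
Local Notation mu := (@lebesgue_measure R).
Local Notation Re := complex.Re.
Local Notation Im := complex.Im.
Local Notation D := (`]0%R, 1%R[%classic : set R).

Let mD : measurable (D : set (measurableTypeR R)).
Proof. exact: measurable_itv. Qed.

Definition bump (s0 h s : R) : R := Num.max 0 (h ^+ 2 - (s - s0) ^+ 2).

Lemma bump_ge0 s0 h s : 0 <= bump s0 h s.
Proof. by rewrite /bump le_max lexx. Qed.

Lemma bump_le s0 h s : bump s0 h s <= h ^+ 2.
Proof. by rewrite /bump ge_max sqr_ge0 lerBlDr lerDl sqr_ge0. Qed.

Lemma bump_out s0 h s : 0 <= h -> h <= `|s - s0| -> bump s0 h s = 0.
Proof.
move=> h0 hs; rewrite /bump max_l// subr_le0 -[leRHS]real_normK ?num_real//.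
by rewrite lerXn2r ?nnegrE.
Qed.

Lemma bump_in s0 h s : `|s - s0| < h -> bump s0 h s = h ^+ 2 - (s - s0) ^+ 2.
Proof.
move=> hs; have h0 : 0 <= h by rewrite (le_trans _ (ltW hs)).
rewrite /bump max_r// subr_ge0 -[leLHS]real_normK ?num_real//.
by rewrite lerXn2r ?nnegrE// ltW.
Qed.

Lemma bump_onem s0 h s : bump s0 h (1 - s) = bump (1 - s0) h s.
Proof. by congr (Num.max _ (_ - _)); ring. Qed.

Lemma continuous_bump s0 h : continuous (bump s0 h).
Proof.
move=> s; apply: (@continuous_max R R (fun=> 0) (fun s => h ^+ 2 - (s - s0) ^+ 2)).
  exact: cvg_cst.
apply/differentiable_continuous/derivable1_diffP.
exact: ex_derive.
Qed.

Lemma measurable_bump s0 h : measurable_fun [set: R] (bump s0 h).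
Proof. by apply: continuous_measurable_fun; exact: continuous_bump. Qed.

Lemma bump_mass s0 h : 0 < h -> 0 < s0 - h -> s0 + h < 1 ->
  has_int (bump s0 h) (4 / 3 * h ^+ 3).
Proof.
move=> h0 a0 b1.
have ab : s0 - h < s0 + h by lra.
pose A := `](s0 - h), (s0 + h)[%classic : set R.
pose P s : R := h ^+ 2 - (s - s0) ^+ 2.
have -> : bump s0 h = (fun s => P s * \1_A s).
  apply/funext => s; rewrite indicE; case: (boolP (s \in A)) => [/set_mem|/negP sA].
    rewrite /A/= in_itv/= => /andP[s1 s2]; rewrite mulr1 bump_in// ltr_norml.
    by apply/andP; split; lra.
  rewrite mulr0 bump_out ?(ltW h0)// leNgt; apply/negP; rewrite ltr_norml => /andP[s1 s2].
  by apply: sA; apply/mem_set; rewrite /A/= in_itv/=; apply/andP; split; lra.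
have cP s : {for s, continuous P}.
  apply/differentiable_continuous/derivable1_diffP; exact: ex_derive.
have mA : measurable (A : set (measurableTypeR R)) by exact: measurable_itv.
apply: has_int_restrict => //.
- by apply: subset_itv; rewrite bnd_simp; lra.
- have sb : A `<=` `[(s0 - h), (s0 + h)] by apply: subset_itv; rewrite bnd_simp.
  apply: (integrableS (mu := mu) (measurable_itv _) mA sb).
  apply: continuous_compact_integrable; first exact: segment_compact.
  by apply: continuous_in_subspaceT => s _; exact: cP.
- have -> : 4 / 3 * h ^+ 3 = (h ^+ 2 * (s0 + h) - ((s0 + h) - s0) ^+ 3 / 3) -
     (h ^+ 2 * (s0 - h) - ((s0 - h) - s0) ^+ 3 / 3) by field.
  apply: (@integral_FTC_oo R P (fun s => h ^+ 2 * s - (s - s0) ^+ 3 / 3)) => //.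
  by move=> s _; apply: is_derive_eq; rewrite /P /GRing.scale/=; field.
Qed.

Lemma bump_average (g : R -> R) (s0 h v G0 e : R) :
  0 < h -> 0 < s0 - h -> s0 + h < 1 ->
  has_int (fun s => (1 - s) * bump s0 h s * g s) v ->
  (forall s, `|s - s0| < h -> `|(1 - s) * g s - G0| <= e) ->
  `|v - 4 / 3 * h ^+ 3 * G0| <= 4 / 3 * h ^+ 3 * e.
Proof.
move=> h0 a0 b1 hv hg; have hm := bump_mass h0 a0 b1.
have key s : (G0 - e) * bump s0 h s <= (1 - s) * bump s0 h s * g s <= (G0 + e) * bump s0 h s.
  have -> : (1 - s) * bump s0 h s * g s = ((1 - s) * g s) * bump s0 h s by ring.
  have [hs|hs] := ltP `|s - s0| h; last by rewrite (bump_out (ltW h0) hs) !mulr0 lexx.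
  have := hg s hs; rewrite ler_norml => /andP[k1 k2].
  by rewrite !ler_wpM2r ?bump_ge0//; lra.
have u := le_has_int (has_intZ (G0 - e) hm) hv (fun s _ => proj1 (andP (key s))).
have w := le_has_int hv (has_intZ (G0 + e) hm) (fun s _ => proj2 (andP (key s))).
rewrite ler_norml; apply/andP; split; lra.
Qed.

Lemma continuous_resonance (t s0 : R) : 0 < s0 < 1 ->
  {for s0, continuous (fun s : R => (1 - s) * Re (resonance t s))} /\
  {for s0, continuous (fun s : R => (1 - s) * Im (resonance t s))}.
Proof.
move=> /andP[s00 s01].
have d1 := is_derive_loglen s01; have d2 := is_derive1_ln s00.
have -> : (fun s : R => (1 - s) * Re (resonance t s)) = fun s : R => (1 - s) * (1 + cos (t * (ln s + loglen s))
   - cos (- (t * loglen s)) - cos (t * ln s)) by apply/funext.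
have -> : (fun s : R => (1 - s) * Im (resonance t s)) = fun s : R => (1 - s) * (0 + sin (t * (ln s + loglen s))
   - sin (- (t * loglen s)) - sin (t * ln s)) by apply/funext.
by split; apply/differentiable_continuous/derivable1_diffP; apply: ex_derive.
Qed.

Let near_le (g : R -> R) (s0 e : R) : 0 < e -> {for s0, continuous g} ->
  exists2 h : R, 0 < h & forall s, `|s - s0| < h -> `|g s - g s0| <= e.
Proof.
move=> e0 /cvgrPdist_le/(_ e e0)/nbhs_ballP[h /= h0 H]; exists h => // s hs.
by rewrite distrC; apply: H; rewrite /ball/= distrC.
Qed.

Variable (beta : R).
Hypothesis beta_lo : 3 / 2 <= beta.
Hypothesis beta_hi : beta < 2.

Lemma dominated_bounded (K : R) (W : R -> R) : measurable_fun [set: R] W -> 0 <= K ->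
  (forall s, 0 < s < 1 -> 0 <= W s <= K) -> dominated beta K W.
Proof.
move=> mW K0 WK; split => // s s01; have /andP[-> w1] := WK s s01 => /=.
apply: le_trans w1 _; rewrite -[leLHS]mulr1 ler_wpM2l//.
exact: base_weight_ge1.
Qed.

Let bump_dominated s0 h : dominated beta (h ^+ 2) (bump s0 h).
Proof.
apply: dominated_bounded; [exact: measurable_bump|exact: sqr_ge0|].
by move=> s _; rewrite bump_ge0 bump_le.
Qed.

(** A narrow bump acts as a point mass 4/3 h^3 at [s0], by continuity of the integrand there; half
    of the tolerance goes to the real part and half to the imaginary part. *)
Lemma freq_bump t s0 e : 0 < s0 < 1 -> 0 < e ->
  exists2 h0 : R, 0 < h0 & forall h, 0 < h < h0 ->
    normc (freq (bump s0 h) t - (4 / 3 * h ^+ 3)%:C%C * ((1 - s0)%:C%C * resonance t s0))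
      <= 4 / 3 * h ^+ 3 * e.
Proof.
move=> s01 e0; have /andP[s00 s1] := s01.
have [c1 c2] := continuous_resonance t s01.
have e2 : 0 < e / 2 by lra.
have [h1 h10 H1] := near_le e2 c1; have [h2 h20 H2] := near_le e2 c2.
exists (Num.min (Num.min h1 h2) (Num.min s0 (1 - s0))) => [|h].
  by rewrite !lt_min h10 h20 s00 subr_gt0.
rewrite !lt_min => /andP[h0 /andP[/andP[hh1 hh2] /andP[hs0 hs1]]].
have [i1 i2] := cintegrable_resonance t (dominated_admissible beta_lo beta_hi (bump_dominated s0 h)).
have a0 : 0 < s0 - h by rewrite subr_gt0.
have a1 : s0 + h < 1 by lra.
have b1 := bump_average h0 a0 a1 (integrable_has_int i1)
  (fun s hs => H1 s (lt_trans hs hh1)).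
have b2 := bump_average h0 a0 a1 (integrable_has_int i2)
  (fun s hs => H2 s (lt_trans hs hh2)).
apply: le_trans (normc_le_ReIm _) _.
move: b1 b2; rewrite /freq /cint.
move: (\int[mu]_(s in D) _) (\int[mu]_(s in D) _) => v2 v1.
case: (resonance t s0) => x y /= b1 b2.
have -> : v1 - (4 / 3 * h ^+ 3 * ((1 - s0) * x - 0 * y) - 0 * ((1 - s0) * y + 0 * x)) =
   v1 - 4 / 3 * h ^+ 3 * ((1 - s0) * x) by ring.
have -> : v2 - (4 / 3 * h ^+ 3 * ((1 - s0) * y + 0 * x) + 0 * ((1 - s0) * x - 0 * y)) =
   v2 - 4 / 3 * h ^+ 3 * ((1 - s0) * y) by ring.
lra.
Qed.

(** Perturbations allowed on the base weight: vanishing near 0, and by symmetry near 1, they leave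
    the exponent and the limit of the kernel at 0 unchanged. *)
Definition tame (W : R -> R) :=
  [/\ continuous W, forall s, W (1 - s) = W s,
      exists K : R, forall s, 0 <= W s <= K &
      exists2 a : R, 0 < a & forall s, s < a -> W s = 0].

Lemma tame_dominated W : tame W -> exists2 K, 0 <= K & dominated beta K W.
Proof.
move=> [cW _ [K WK] _]; have K0 : 0 <= K by have /andP[/le_trans h /h] := WK 0.
exists K => //; apply: dominated_bounded => //.
exact: continuous_measurable_fun.
Qed.

Lemma tame_admissible W : tame W -> admissible W.
Proof. by move=> /tame_dominated[K _ /(dominated_admissible beta_lo beta_hi)]. Qed.

Lemma tame0 : tame (fun=> 0).
Proof.
split => //; first by move=> x; exact: cvg_cst.
  by exists 0 => s; rewrite lexx.
by exists 1.
Qed.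

Lemma tameD W1 W2 (c : R) : 0 <= c -> tame W1 -> tame W2 ->
  tame (fun s => W1 s + c * W2 s).
Proof.
move=> c0 [u1 u2 [K1 u3] [a1 a10 u4]] [v1 v2 [K2 v3] [a2 a20 v4]]; split.
- by move=> x; apply: cvgD; [exact: u1|apply: cvgM; [exact: cvg_cst|exact: v1]].
- by move=> s; rewrite u2 v2.
- exists (K1 + c * K2) => s; have /andP[k1 k2] := u3 s; have /andP[l1 l2] := v3 s.
  by rewrite addr_ge0 ?mulr_ge0//= lerD// ler_wpM2l.
- exists (Num.min a1 a2); first by rewrite lt_min a10.
  by move=> s; rewrite lt_min => /andP[sa1 sa2]; rewrite u4// v4// mulr0 addr0.
Qed.

Lemma freqD W1 W2 (c t : R) : admissible W1 -> admissible W2 ->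
  freq (fun s => W1 s + c * W2 s) t = freq W1 t + c%:C%C * freq W2 t.
Proof. by move=> a1 a2; apply: cintD; exact: cintegrable_resonance. Qed.

Lemma freq0 t : freq (fun=> 0) t = 0 :> R[i].
Proof.
have z (g : R -> R) : \int[mu]_(s in D) ((1 - s) * 0 * g s) = 0.
  rewrite /Rintegral; under eq_integral do rewrite mulr0 mul0r.
  by rewrite integral0.
by rewrite /freq /cint !z.
Qed.

(* The joint contribution of [s] and [1 - s], since weights are symmetric. *)
Definition folded t s : R[i] :=
  (1 - s)%:C%C * resonance t s + s%:C%C * resonance t (1 - s).

(** Symmetry of the weight forces bumps at both [s0] and [1 - s0]; dividing by their common mass [m]
    makes them unit point masses in the limit. *)
Lemma pulse t s0 e : 0 < s0 < 1 -> 0 < e ->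
  exists2 B, tame B & normc (freq B t - folded t s0) <= e.
Proof.
move=> s01 e0; have /andP[s00 s1] := s01.
have s01' : 0 < 1 - s0 < 1 by apply/andP; split; lra.
have e2 : 0 < e / 2 by lra.
have [h1 h10 H1] := freq_bump t s01 e2; have [h2 h20 H2] := freq_bump t s01' e2.
pose h := Num.min (Num.min h1 h2) (Num.min s0 (1 - s0)) / 2.
have hpos : 0 < Num.min (Num.min h1 h2) (Num.min s0 (1 - s0)).
  by rewrite !lt_min h10 h20 s00 subr_gt0.
have h0 : 0 < h by rewrite divr_gt0.
have : h < Num.min (Num.min h1 h2) (Num.min s0 (1 - s0)).
  by rewrite /h ltr_pdivrMr// ltr_pMr//; lra.
rewrite !lt_min => /andP[/andP[hh1 hh2] /andP[hs0 hs1]].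
clearbody h; have {}H1 := H1 h _; have {}H2 := H2 h _; rewrite h0 hh1 in H1; rewrite h0 hh2 in H2.
have {}H1 := H1 isT; have {}H2 := H2 isT; rewrite subKr in H2.
pose m := 4 / 3 * h ^+ 3; have m0 : 0 < m by rewrite mulr_gt0 ?divr_gt0 ?exprn_gt0.
rewrite -/m in H1 H2.
have mi : 0 <= m^-1 by rewrite invr_ge0 ltW.
clearbody m.
have b1 := dominated_admissible beta_lo beta_hi (bump_dominated s0 h).
have b2 := dominated_admissible beta_lo beta_hi (bump_dominated (1 - s0) h).
have bB : dominated beta (m^-1 * h ^+ 2) (fun s => 0 + m^-1 * bump s0 h s).
  apply: dominated_bounded; [|exact: mulr_ge0 mi (sqr_ge0 h)|].
    apply: measurable_funD => //; apply: measurable_funM => //; exact: measurable_bump.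
  by move=> s _; rewrite add0r mulr_ge0 ?bump_ge0//= ler_wpM2l// bump_le.
(* The leading [0 +] lets [freqD] treat the first bump like the second, starting from [tame0]. *)
exists (fun s => (0 + m^-1 * bump s0 h s) + m^-1 * bump (1 - s0) h s).
  split.
  - move=> s; have c1 := @continuous_bump s0 h s; have c2 := @continuous_bump (1 - s0) h s.
    apply: cvgD; [apply: cvgD; first exact: cvg_cst|]; apply: cvgM => //; exact: cvg_cst.
  - by move=> s; rewrite !bump_onem subKr !add0r addrC.
  - exists (m^-1 * h ^+ 2 + m^-1 * h ^+ 2) => s; rewrite add0r.
    by rewrite addr_ge0 ?mulr_ge0 ?bump_ge0//= lerD// ler_wpM2l// bump_le.
  - exists (Num.min (s0 - h) (1 - s0 - h)).
      by rewrite lt_min; apply/andP; split; lra.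
    move=> s; rewrite lt_min => /andP[l1 l2].
    rewrite !bump_out ?(ltW h0)// ?mulr0 ?addr0//.
      by rewrite ler_normr; apply/orP; right; lra.
    by rewrite ler_normr; apply/orP; right; lra.
rewrite freqD//; last exact: (dominated_admissible beta_lo beta_hi bB).
rewrite freqD//; last exact: (tame_admissible tame0).
rewrite freq0.
have mC : (m^-1)%:C%C * m%:C%C = 1 :> R[i] by rewrite -rmorphM/= mulVf ?gt_eqF.
have -> : 0 + (m^-1)%:C%C * freq (bump s0 h) t + (m^-1)%:C%C * freq (bump (1 - s0) h) t -
    folded t s0 = (m^-1)%:C%C * (freq (bump s0 h) t - m%:C%C * ((1 - s0)%:C%C * resonance t s0))
    + (m^-1)%:C%C * (freq (bump (1 - s0) h) t - m%:C%C * (s0%:C%C * resonance t (1 - s0))).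
  move: mC; rewrite /folded; move: (m^-1)%:C%C m%:C%C (freq _ _) (freq _ _) => u v x y uv.
  move: (_ * resonance _ _) (_ * resonance _ _) => p q.
  transitivity (u * x + u * y - (u * v) * (p + q)); last by ring.
  by rewrite uv; ring.
have nm : normc ((m^-1)%:C%C : R[i]) = m^-1 by rewrite normc_real ger0_norm.
apply: le_trans (normcD _ _) _; rewrite !normcM nm.
have g1 := ler_wpM2l mi H1; have g2 := ler_wpM2l mi H2.
have E : m^-1 * (m * (e / 2)) = e / 2 by rewrite mulKf ?gt_eqF.
rewrite E in g1 g2; lra.
Qed.

End Bump.

(** * Directions reached by point masses, and positive spanning of the plane *)

Section Directions.
Context {R : realType}.
Local Notation Re := complex.Re.
Local Notation Im := complex.Im.

Lemma foldedE (t s : R) : folded t s =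
  Complex (1 + cos (t * ln s + t * loglen s) - cos (t * loglen s) - cos (t * ln s))
   (sin (t * loglen s) - sin (t * ln s)
     + (1 - 2 * s) * sin (t * ln s + t * loglen s)).
Proof.
have l1 : loglen (1 - s) = - ln s by rewrite /loglen subKr.
have l2 : ln (1 - s) = - loglen s by rewrite /loglen opprK.
rewrite /folded /resonance l1 l2.
have -> : t * (- loglen s + - ln s) = - (t * ln s + t * loglen s) by ring.
have -> : t * (ln s + loglen s) = t * ln s + t * loglen s by ring.
have -> : t * - loglen s = - (t * loglen s) by ring.
have -> : - (t * - ln s) = t * ln s by ring.
apply/eqP; rewrite eq_complex/= !sinN !cosN; apply/andP; split; apply/eqP; ring.
Qed.

(** The origin of pi / ln 2: at s = 1 / 2 the phase t (ln s + loglen s) is 0 while the two others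
    are pi and - pi, so each of the four terms contributes 1. *)
Lemma folded_half : folded (pi / ln 2) (1 / 2) = Complex 4 0 :> R[i].
Proof.
have l2 : 0 < ln 2 :> R by rewrite ln_gt0//; lra.
rewrite foldedE /loglen.
have -> : 1 - 1 / 2 = 1 / 2 :> R by lra.
have -> : ln (1 / 2) = - ln 2 :> R by rewrite div1r lnV// posrE.
have -> : pi / ln 2 * - ln 2 = - pi :> R by field; rewrite gt_eqF.
have -> : pi / ln 2 * - - ln 2 = pi :> R by field; rewrite gt_eqF.
rewrite addNr cos0 sin0 cosN sinN cospi sinpi; congr Complex; ring.
Qed.

(* The limit of [folded t s / s] as [s] tends to 0 with the phase [t * ln s] fixed to [th]. *)
Definition direction (t th : R) : R[i] :=
  Complex (- t * sin th) (t + t * cos th - 2 * sin th).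

Lemma is_derive_little_o (f : R -> R) (a e : R) : is_derive (0 : R) 1 f a -> f 0 = 0 ->
  0 < e -> exists2 h, 0 < h & forall s, 0 < s < h -> `|f s - s * a| <= s * e.
Proof.
move=> [df da] f0 e0.
have : (fun h : R => h^-1 *: ((f \o shift (0 : R)) (h *: (1 : R)) - f 0)) @ (0 : R)^' --> a.
  by rewrite -da; exact: df.
move=> /cvgrPdist_le/(_ e e0); rewrite near_withinE => /nbhs_ballP[h /= h0 H].
exists h => // s /andP[s0 sh].
have := H s; rewrite /ball/= sub0r normrN gtr0_norm// => /(_ sh).
rewrite gt_eqF// => /(_ isT).
rewrite f0 subr0 /shift/= addr0 /GRing.scale/= mulr1 => k.
have -> : f s - s * a = - (s * (a - s^-1 * f s)) by field; rewrite gt_eqF.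
by rewrite normrN normrM (gtr0_norm s0) ler_pM2l.
Qed.

(** Multiplying s by e^(- 2 pi / t) keeps the phase t ln s modulo 2 pi, so every phase occurs
    arbitrarily close to 0. *)
Lemma small_phase (t th h : R) : 0 < t -> 0 < h ->
  exists2 s, 0 < s < h & cos (t * ln s) = cos th /\ sin (t * ln s) = sin th.
Proof.
move=> t0 h0; have p0 := @pi_gt0 R.
pose n := Num.bound `|(th - t * ln h) / (2 * pi)|.
have hn : (th - t * ln h) / (2 * pi) < n%:R.
  apply: le_lt_trans (ler_norm _) _; exact/archi_boundP/normr_ge0.
rewrite ltr_pdivrMr in hn; last by rewrite mulr_gt0.
have thE : th = t * ((th - n%:R * (2 * pi)) / t) + pi *+ 2 *+ n.
  by rewrite -(mulr_natl pi) -[_ *+ n]mulr_natl; field; rewrite gt_eqF.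
exists (expR ((th - n%:R * (2 * pi)) / t)).
  rewrite expR_gt0/= -[ltRHS](lnK h0) ltr_expR ltr_pdivrMr//; lra.
rewrite expRK; split.
  by rewrite [in RHS]thE periodicn//; exact: cosD2pi.
by rewrite [in RHS]thE periodicn//; exact: sinD2pi.
Qed.

Lemma folded_direction (t th e : R) : 0 < t -> 0 < e -> exists2 s, 0 < s < 1 &
  normc (folded t s - s%:C%C * direction t th) <= s * e.
Proof.
move=> t0 e0.
have d1 := @is_derive_loglen R 0 ltr01.
have l0 : loglen (0 : R) = 0 by rewrite /loglen subr0 ln1 oppr0.
(* [folded t s] oscillates as s tends to 0. With t ln s frozen at [th], its real and imaginary parts
   become [FR] and [FI], which are differentiable at 0; at the s given by [small_phase] nothing is
   changed by the freezing. *)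
pose FR s : R := 1 + (cos th * cos (t * loglen s) - sin th * sin (t * loglen s))
  - cos (t * loglen s) - cos th.
pose FI s : R := sin (t * loglen s) - sin th
  + (1 - 2 * s) * (sin th * cos (t * loglen s) + cos th * sin (t * loglen s)).
have d2 : is_derive (0 : R) 1 FR (- t * sin th).
  by apply: is_derive_eq; rewrite /GRing.scale/= l0 mulr0 sin0 cos0 !subr0 divr1; ring.
have d3 : is_derive (0 : R) 1 FI (t + t * cos th - 2 * sin th).
  by apply: is_derive_eq; rewrite /GRing.scale/= l0 mulr0 sin0 cos0 !(subr0, mulr0) divr1; ring.
have e2 : 0 < e / 2 by lra.
have [|h1 h10 H1] := is_derive_little_o d2 _ e2.
  by rewrite /FR l0 mulr0 sin0 cos0; ring.
have [|h2 h20 H2] := is_derive_little_o d3 _ e2.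
  by rewrite /FI l0 mulr0 sin0 cos0; ring.
have [|s /andP[s0]] := @small_phase t th (Num.min 1 (Num.min h1 h2)) t0.
  by rewrite !lt_min ltr01 h10.
rewrite !lt_min => /andP[s1 /andP[sh1 sh2]] [cE sE].
exists s; first by rewrite s0.
have := H1 s; have := H2 s; rewrite s0 sh1 sh2 => /(_ isT) b2 /(_ isT) b1.
apply: le_trans (normc_le_ReIm _) _.
rewrite foldedE cosD sinD cE sE /direction.
have -> : Re (Complex (1 + (cos th * cos (t * loglen s) - sin th * sin (t * loglen s)) -
     cos (t * loglen s) - cos th)
    (sin (t * loglen s) - sin th +
      (1 - 2 * s) * (sin th * cos (t * loglen s) + cos th * sin (t * loglen s))) -
   s%:C%C * Complex (- t * sin th) (t + t * cos th - 2 * sin th)) = FR s - s * (- t * sin th).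
  by rewrite /FR /=; ring.
have -> : Im (Complex (1 + (cos th * cos (t * loglen s) - sin th * sin (t * loglen s)) -
     cos (t * loglen s) - cos th)
    (sin (t * loglen s) - sin th +
      (1 - 2 * s) * (sin th * cos (t * loglen s) + cos th * sin (t * loglen s))) -
   s%:C%C * Complex (- t * sin th) (t + t * cos th - 2 * sin th)) =
   FI s - s * (t + t * cos th - 2 * sin th).
  by rewrite /FI /=; ring.
lra.
Qed.

(** The determinant of two vectors of the real plane. *)
Definition cross (u v : R[i]) : R := Re u * Im v - Im u * Re v.

(** Pulses reach their directions only approximately; this margin preserves the orientations. *)
Lemma cross_open (u v : R[i]) : 0 < cross u v -> exists2 e, 0 < e &
  forall u' v', normc (u' - u) <= e -> normc (v' - v) <= e -> 0 < cross u' v'.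
Proof.
move=> uv; pose K := 2 * (normc u + normc v + 1).
have K0 : 0 < K by have := normc_ge0 u; have := normc_ge0 v; rewrite /K; lra.
exists (Num.min 1 (cross u v / (2 * K))).
  by rewrite lt_min ltr01 divr_gt0// mulr_gt0.
move=> u' v'; rewrite !le_min => /andP[a1 a2] /andP[b1 b2].
have hK : cross u v / (2 * K) * K = cross u v / 2 by field; rewrite gt_eqF.
have M (x y : R) (z w : R[i]) : `|x| <= normc z -> `|y| <= normc w -> `|x * y| <= normc z * normc w.
  by move=> h1 h2; rewrite normrM; apply: ler_pM.
pose du := u' - u; pose dv := v' - v.
have ru := Re_le_normc du; have iu := Im_le_normc du.
have rv := Re_le_normc dv; have iv := Im_le_normc dv.
have r0 := Re_le_normc u; have i0 := Im_le_normc u.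
have r1 := Re_le_normc v; have i1 := Im_le_normc v.
have E : cross u' v' = cross u v + (Re u * Im dv - Im u * Re dv) + (Re du * Im v - Im du * Re v)
   + (Re du * Im dv - Im du * Re dv).
  rewrite /cross /du /dv; case: (u) (u') (v) (v') => [? ?] [? ?] [? ?] [? ?] /=; ring.
have m1 := M _ _ _ _ r0 iv; have m2 := M _ _ _ _ i0 rv.
have m3 := M _ _ _ _ ru i1; have m4 := M _ _ _ _ iu r1.
have m5 := M _ _ _ _ ru iv; have m6 := M _ _ _ _ iu rv.
rewrite -/du in a1 a2; rewrite -/dv in b1 b2.
have n0 := normc_ge0 du; have n1 := normc_ge0 dv; have n2 := normc_ge0 u; have n3 := normc_ge0 v.
move: m1 m2 m3 m4 m5 m6; rewrite !ler_norml => /andP[p1 _] /andP[_ p2] /andP[p3 _] /andP[_ p4]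
  /andP[p5 _] /andP[_ p6].
set q := cross u v / (2 * K) in a2 b2 hK.
have g1 : normc u * normc dv <= normc u * q by rewrite ler_wpM2l.
have g2 : normc du * normc v <= q * normc v by rewrite ler_wpM2r.
have g3 : normc du * normc dv <= q * 1 by apply: ler_pM.
have hK' : q * K = 2 * (q * normc u) + 2 * (q * normc v) + 2 * q by rewrite /K; ring.
rewrite E; rewrite hK' in hK; rewrite (mulrC _ q) in g1; rewrite mulr1 in g3; lra.
Qed.

(* The three vectors positively span the plane. *)
Lemma cone_full (u0 u1 u2 : R[i]) :
  0 < cross u0 u1 -> 0 < cross u1 u2 -> 0 < cross u2 u0 ->
  forall z, exists c0 c1 c2 : R, [/\ 0 <= c0, 0 <= c1, 0 <= c2 &
    z = c0%:C%C * u0 + c1%:C%C * u1 + c2%:C%C * u2].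
Proof.
move=> h01 h12 h20 z.
pose a := cross z u1 / cross u0 u1; pose b := cross u0 z / cross u0 u1.
(* Cramer's rule gives [z] from [u0] and [u1] with real coefficients [a], [b]. The relation (cross
   u1 u2) u0 + (cross u2 u0) u1 + (cross u0 u1) u2 = 0, added [la] times, makes all coefficients
   nonnegative. *)
pose la := `|a| / cross u1 u2 + `|b| / cross u2 u0.
have A0 : 0 <= `|a| / cross u1 u2 by rewrite divr_ge0// ltW.
have B0 : 0 <= `|b| / cross u2 u0 by rewrite divr_ge0// ltW.
exists (a + la * cross u1 u2), (b + la * cross u2 u0), (la * cross u0 u1).
have aE : la * cross u1 u2 = `|a| + `|b| / cross u2 u0 * cross u1 u2.
  by rewrite /la mulrDl divfK// gt_eqF.
have bE : la * cross u2 u0 = `|a| / cross u1 u2 * cross u2 u0 + `|b|.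
  by rewrite /la mulrDl divfK// gt_eqF.
have P1 : 0 <= `|b| / cross u2 u0 * cross u1 u2 by rewrite mulr_ge0// ltW.
have P2 : 0 <= `|a| / cross u1 u2 * cross u2 u0 by rewrite mulr_ge0// ltW.
have na : - a <= `|a| by rewrite -normrN ler_norm.
have nb : - b <= `|b| by rewrite -normrN ler_norm.
split; [rewrite aE; lra|rewrite bE; lra|by rewrite mulr_ge0 ?(ltW h01)// addr_ge0|].
rewrite /a /b; clearbody la; move: h01 {aE bE A0 B0 P1 P2 na nb a b h12 h20}.
rewrite /cross; case: u0 u1 u2 z => [x0 y0] [x1 y1] [x2 y2] [x y] /= h.
apply/eqP; rewrite eq_complex/=; apply/andP; split; apply/eqP; field; rewrite gt_eqF//.
Qed.

Lemma cross_solve (u0 u1 : R[i]) : 0 < cross u0 u1 -> exists2 C : R, 0 < C & forall z,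
  exists a b : R, [/\ a%:C%C * u0 + b%:C%C * u1 = z, `|a| <= C * normc z & `|b| <= C * normc z].
Proof.
move=> h; have n0 := normc_ge0 u0; have n1 := normc_ge0 u1.
exists (2 * (normc u0 + normc u1 + 1) / cross u0 u1).
  by rewrite divr_gt0//; lra.
have bnd (z w : R[i]) : `|cross z w| <= 2 * (normc z * normc w).
  rewrite /cross; apply: le_trans (ler_normB _ _) _; rewrite !normrM.
  have a1 := ler_pM (normr_ge0 _) (normr_ge0 _) (Re_le_normc z) (Im_le_normc w).
  have a2 := ler_pM (normr_ge0 _) (normr_ge0 _) (Im_le_normc z) (Re_le_normc w).
  lra.
move=> z; exists (cross z u1 / cross u0 u1), (cross u0 z / cross u0 u1).
have nz := normc_ge0 z.
have q0 : 0 <= normc u0 * normc z by rewrite mulr_ge0.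
have q1 : 0 <= normc u1 * normc z by rewrite mulr_ge0.
split.
- move: h {bnd n0 n1 nz q0 q1}; rewrite /cross; case: u0 u1 z => [x0 y0] [x1 y1] [x y] /= h.
  by apply/eqP; rewrite eq_complex/=; apply/andP; split; apply/eqP; field; rewrite gt_eqF.
- rewrite normrM normfV (gtr0_norm h) mulrAC ler_pM2r ?invr_gt0//.
  by apply: le_trans (bnd _ _) _; lra.
- rewrite normrM normfV (gtr0_norm h) mulrAC ler_pM2r ?invr_gt0//.
  by apply: le_trans (bnd _ _) _; lra.
Qed.

End Directions.

(** * A weight with a simple resonance *)

Section ResonantWeight.
Context {R : realType}.
Local Notation mu := (@lebesgue_measure R).
Local Notation Re := complex.Re.
Local Notation Im := complex.Im.
Local Notation D := (`]0%R, 1%R[%classic : set R).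
Variable (beta : R).
Hypothesis beta_lo : 3 / 2 <= beta.
Hypothesis beta_hi : beta < 2.
Local Notation tame_admissible := (tame_admissible beta_lo beta_hi).

Lemma pulse_direction t th e : 0 < t -> 0 < e ->
  exists2 B : R -> R, tame B & normc (freq B t - direction t th) <= e.
Proof.
move=> t0 e0; have e2 : 0 < e / 2 by lra.
have [s s01 hs] := folded_direction th t0 e2; have /andP[s0 s1] := s01.
have se : 0 < s * (e / 2) by rewrite mulr_gt0.
have [B tB hB] := pulse beta_lo beta_hi t s01 se.
have si : 0 <= s^-1 by rewrite invr_ge0 ltW.
exists (fun s' => 0 + s^-1 * B s'); first exact: tameD si tame0 tB.
rewrite freqD; [|exact: tame_admissible tame0|exact: tame_admissible].
rewrite freq0 add0r.
have sC : (s^-1)%:C%C * s%:C%C = 1 :> R[i] by rewrite -rmorphM/= mulVf ?gt_eqF.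
have -> : (s^-1)%:C%C * freq B t - direction t th =
   (s^-1)%:C%C * ((freq B t - folded t s) + (folded t s - s%:C%C * direction t th)).
  move: sC; move: (s^-1)%:C%C s%:C%C => u v uv.
  transitivity (u * freq B t - (u * v) * direction t th); last by ring.
  by rewrite uv mul1r.
rewrite normcM normc_real ger0_norm//.
apply: (@le_trans _ _ (s^-1 * (s * e))); last by rewrite mulKf// gt_eqF.
rewrite ler_wpM2l//; apply: le_trans (normcD _ _) _; lra.
Qed.

Let pi_div_ln2_gt2 : 2 < pi / ln 2 :> R.
Proof.
have l2 : 0 < ln 2 :> R by rewrite ln_gt0//; lra.
rewrite ltr_pdivlMr//; apply: lt_le_trans (@pi_ge2 R).
rewrite gtr_pMr// -[ltRHS](@expRK R 1) ltr_ln ?posrE ?expR_gt0//.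
by apply: le_lt_trans (@expR_gt1Dx R 1 _).
Qed.

Let tame_freq (om1 : R) (z : R[i]) : om1 = pi / ln 2 ->
  exists2 B : R -> R, tame B & freq B om1 = z.
Proof.
move=> om1E; have t2 := pi_div_ln2_gt2; rewrite -om1E in t2; have t0 : 0 < om1 by lra.
(* The angle with tan (th / 2) = om1. It makes [v2] a positive multiple of (- om1, - 1), while [v0]
   is real positive and [v1] = (- om1, om1 - 2) lies above the real axis because om1 > 2: the three
   surround the origin. *)
pose th := acos ((1 - om1 ^+ 2) / (1 + om1 ^+ 2)).
pose q := 1 + om1 ^+ 2; have q0 : 0 < q by rewrite /q ltr_pwDl// sqr_ge0.
have s0 : 0 < om1 ^+ 2 by rewrite exprn_gt0.
have rng : -1 <= (1 - om1 ^+ 2) / q <= 1.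
  by rewrite ler_pdivlMr// ler_pdivrMr// /q; apply/andP; split; lra.
have cth : cos th = (1 - om1 ^+ 2) / q by rewrite /th acosK// in_itv.
have sth : sin th = 2 * om1 / q.
  rewrite /th sin_acos//.
  have -> : 1 - ((1 - om1 ^+ 2) / (1 + om1 ^+ 2)) ^+ 2 = (2 * om1 / q) ^+ 2.
    by rewrite /q; field; rewrite gt_eqF.
  by rewrite sqrtr_sqr ger0_norm// divr_ge0 ?(ltW q0)// mulr_ge0// ltW.
pose v0 : R[i] := Complex 4 0; pose v1 := direction om1 (pi / 2); pose v2 := direction om1 th.
have v2E : v2 = Complex (- (2 * om1 ^+ 2) / q) (- (2 * om1) / q).
  rewrite /v2 /direction cth sth; congr Complex; first by rewrite expr2; ring.
  by rewrite /q; field; rewrite gt_eqF.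
have c01 : 0 < cross v0 v1.
  rewrite /cross /v1 /direction/= cos_pihalf sin_pihalf.
  have -> : 4 * (om1 + om1 * 0 - 2 * 1) - 0 * (- om1 * 1) = 4 * (om1 - 2) by ring.
  by rewrite mulr_gt0// subr_gt0.
have c12 : 0 < cross v1 v2.
  rewrite v2E /cross /v1 /direction/= cos_pihalf sin_pihalf.
  have -> : - om1 * 1 * (- (2 * om1) / q) - (om1 + om1 * 0 - 2 * 1) * (- (2 * om1 ^+ 2) / q) =
     2 * om1 ^+ 2 * (om1 - 1) / q by rewrite expr2; ring.
  by rewrite divr_gt0// !mulr_gt0// subr_gt0; lra.
have c20 : 0 < cross v2 v0.
  rewrite v2E /cross/=.
  have -> : - (2 * om1 ^+ 2) / q * 0 - - (2 * om1) / q * 4 = 8 * om1 / q by ring.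
  by rewrite divr_gt0// mulr_gt0.
have [e1 e10 H1] := cross_open c01; have [e2 e20 H2] := cross_open c12.
have [e3 e30 H3] := cross_open c20.
pose e := Num.min e1 (Num.min e2 e3).
have e0 : 0 < e by rewrite !lt_min e10 e20.
have /andP[ee1 /andP[ee2 ee3]] : [&& e <= e1, e <= e2 & e <= e3].
  by rewrite /e !ge_min !lexx !orbT.
have h01 : 0 < (1 / 2 : R) < 1 by lra.
have [B0 tB0 hB0] := pulse beta_lo beta_hi om1 h01 e0.
rewrite om1E folded_half -om1E -/v0 in hB0.
have [B1 tB1 hB1] := pulse_direction (pi / 2) t0 e0.
have [B2 tB2 hB2] := pulse_direction th t0 e0.
have d01 := H1 _ _ (le_trans hB0 ee1) (le_trans hB1 ee1).
have d12 := H2 _ _ (le_trans hB1 ee2) (le_trans hB2 ee2).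
have d20 := H3 _ _ (le_trans hB2 ee3) (le_trans hB0 ee3).
have [a0 [a1 [a2 [p0 p1 p2 ->]]]] := cone_full d01 d12 d20 z.
have u0 := tameD p0 tame0 tB0; have u1 := tameD p1 u0 tB1; have u2 := tameD p2 u1 tB2.
exists (fun s => ((0 + a0 * B0 s) + a1 * B1 s) + a2 * B2 s) => //.
rewrite freqD; [|exact: tame_admissible|exact: tame_admissible].
rewrite freqD; [|exact: tame_admissible|exact: tame_admissible].
rewrite freqD; [|exact: tame_admissible tame0|exact: tame_admissible].
by rewrite freq0 add0r.
Qed.

(** The bound is uniform in t, so a tame perturbation cannot undo the growth of the base multiplier
    at high frequency. *)
Lemma freq_tame_le (B : R -> R) : tame B -> exists2 C, 0 < C & forall t, normc (freq B t) <= C.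
Proof.
move=> tB; have [cB _ [K BK] _] := tB.
have aB := tame_admissible tB; have [_ B0 _] := aB.
have i4 : weight_integrable B (fun=> 4).
  have sb : D `<=` `[0, 1] by apply: subset_itv; rewrite bnd_simp.
  apply: (integrableS (mu := mu) (measurable_itv _) (measurable_itv _) sb).
  apply: continuous_compact_integrable; first exact: segment_compact.
  apply: continuous_in_subspaceT => s _.
  apply: cvgM; last exact: cvg_cst.
  apply: cvgM; last exact: cB.
  by apply: cvgB; [exact: cvg_cst|exact: cvg_id].
exists (`|2 * \int[mu]_(s in D) ((1 - s) * B s * 4)| + 1).
  by rewrite ltr_wpDl.
move=> t; apply: le_trans (normc_cint B0 (cintegrable_resonance t aB) _ i4) _.
  by move=> s _; exact: normc_resonance_le4.
by apply: le_trans (ler_norm _) _; rewrite lerDl.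
Qed.

Let finite_min (a b : nat -> R) (N : nat) :
  (forall j, (2 <= j < N)%N -> 0 < a j /\ 0 < b j) ->
  exists2 c : R, 0 < c & forall j, (2 <= j < N)%N -> c * b j <= a j.
Proof.
elim: N => [_|N IH h]; first by exists 1 => // j; rewrite ltn0 andbF.
have [j /andP[j2 jN]|c c0 hc] := IH; first by apply: h; rewrite j2 ltnS ltnW.
have [N2|N2] := leqP 2 N; last first.
  exists c => // j /andP[j2]; rewrite ltnS => jN.
  by have := leq_trans j2 jN; rewrite leqNgt N2.
have [aN bN] : 0 < a N /\ 0 < b N by apply: h; rewrite N2 ltnS leqnn.
exists (Num.min c (a N / b N)); first by rewrite lt_min c0 divr_gt0.
move=> j /andP[j2]; rewrite ltnS leq_eqVlt => /orP[/eqP ->|jN].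
  by rewrite -ler_pdivlMr// ge_min lexx orbT.
have [_ bj] : 0 < a j /\ 0 < b j by apply: h; rewrite j2 ltnS ltnW.
apply: le_trans (hc j _); last by rewrite j2.
by rewrite ler_pM2r// ge_min lexx.
Qed.

Lemma resonant_weight : exists (B : R -> R) (om c0 : R),
  [/\ tame B, 2 < om, 0 < c0,
      freq (fun s => base_weight beta s + 1 * B s) om = 0 &
      forall k : nat, (2 <= k)%N -> c0 * (k%:R * om) `^ (beta - 1) <=
        normc (freq (fun s => base_weight beta s + 1 * B s) (k%:R * om))].
Proof.
have [om1 om1E] : exists om1 : R, om1 = pi / ln 2 by eexists.
have t2 := pi_div_ln2_gt2; rewrite -om1E in t2; have bl := beta_lo; have bh := beta_hi.
have [B tB hB] := tame_freq (- freq (base_weight beta) om1) om1E.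
have [CB CB0 hCB] := freq_tame_le tB.
have [c [C [c0 C0 hc]]] := freq_base_lower beta_lo beta_hi.
pose W s : R := base_weight beta s + 1 * B s.
have WE t : freq W t = freq (base_weight beta) t + freq B t.
  rewrite /W freqD ?mul1r//; first exact: base_weight_admissible.
  exact: tame_admissible.
have low t : 2 <= t -> c * t `^ (beta - 1) - (C + CB) <= normc (freq W t).
  move=> t2'; apply: le_trans (Re_le_normc _); apply: le_trans (ler_norm _).
  rewrite WE ReD; have := hc t t2'; have := le_trans (Re_le_normc _) (hCB t).
  rewrite ler_norml => /andP[h1 _]; lra.
have b0 : 0 < beta - 1 by lra.
(* From [T] on, the constant C + CB is at most half of the growing term. *)
pose q := 2 * (C + CB) / c; have q0 : 0 < q by rewrite /q divr_gt0// mulr_gt0// addr_gt0.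
pose T := q `^ (beta - 1)^-1.
have far t : 2 <= t -> T <= t -> c / 2 * t `^ (beta - 1) <= normc (freq W t).
  move=> t2' Tt; apply: le_trans (low t t2').
  have : q <= t `^ (beta - 1).
    have <- : T `^ (beta - 1) = q by rewrite -powRrM mulVf ?gt_eqF// powRr1// ltW.
    by apply: ge0_ler_powR; rewrite ?nnegrE ?powR_ge0//; lra.
  by rewrite /q ler_pdivrMr//; lra.
pose N := Num.bound (T / om1).
have hN : T < N%:R * om1.
  rewrite -ltr_pdivrMr; last by lra.
  by apply: archi_boundP; rewrite divr_ge0 ?powR_ge0//; lra.
pose Z k := (0 < k)%N && (freq W (k%:R * om1) == 0).
have Z1 : exists k, Z k by exists 1%N; rewrite /Z mul1r WE hB addrN eqxx.
have ZN k : Z k -> (k <= N)%N.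
  move=> /andP[k0 /eqP kz]; rewrite leqNgt; apply/negP => Nk.
  have kN : N%:R <= k%:R :> R by rewrite ler_nat ltnW.
  have k1 : 1 <= k%:R :> R by rewrite ler1n.
  have k2 : 2 <= k%:R * om1 by have := ler_wpM2r (_ : 0 <= om1) k1; lra.
  have kT : T <= k%:R * om1.
    have : N%:R * om1 <= k%:R * om1 by rewrite ler_wpM2r//; lra.
    lra.
  have := far _ k2 kT; rewrite kz normc0 leNgt mulr_gt0 ?powR_gt0//; lra.
(* [m] is the largest zero, so no proper multiple of it is one. The finitely many k below [N] then
   have a positive least ratio, and growth takes over from [N] on. *)
case: (ex_maxnP Z1 ZN) => m /andP[m0 /eqP mz] mmax.
have m1 : 1 <= m%:R :> R by rewrite ler1n.
have om2 : om1 <= m%:R * om1 by rewrite ler_peMl//; lra.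
set om := m%:R * om1 in om2 mz.
have omlarge : 2 < om by lra.
have jom (j : nat) : (2 <= j)%N -> 2 <= j%:R * om.
  move=> j2; have : 1 <= j%:R :> R by rewrite ler1n ltnW.
  by move=> j1; have := ler_wpM2r (_ : 0 <= om) j1; lra.
have pos (j : nat) : (2 <= j < N)%N ->
    0 < normc (freq W (j%:R * om)) /\ 0 < (j%:R * om) `^ (beta - 1).
  move=> /andP[j2 _]; have h := jom j j2; split; last by rewrite powR_gt0//; lra.
  rewrite lt_def normc_ge0 andbT; apply/eqP => /eq0_normc hz.
  have : (j * m <= m)%N.
    apply: mmax; rewrite /Z muln_gt0 m0 (ltn_trans _ j2)//=.
    by rewrite natrM -mulrA -/om hz.
  by rewrite leqNgt -[X in (X < _)%N]mul1n ltn_pmul2r// j2.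
have [c1 c10 hc1] := finite_min pos.
exists B, om, (Num.min c1 (c / 2)); split => //.
  by rewrite lt_min c10 divr_gt0.
move=> k k2; have kom := jom k k2.
have p : 0 < (k%:R * om) `^ (beta - 1) by rewrite powR_gt0//; lra.
have [kN|kN] := ltnP k N.
  by apply: le_trans (hc1 k _); rewrite ?k2// ler_pM2r// ge_min lexx.
apply: le_trans (far _ kom _); first by rewrite ler_pM2r// ge_min lexx orbT.
have kN' : N%:R <= k%:R :> R by rewrite ler_nat.
have h1 : N%:R * om1 <= k%:R * om1 by rewrite ler_wpM2r//; lra.
have h2 : k%:R * om1 <= k%:R * om by rewrite ler_wpM2l.
lra.
Qed.

End ResonantWeight.

(** * Monotonicity of the flux *)

Section Monotonicity.
Context {R : realType}.
Local Notation mu := (@lebesgue_measure R).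

(* No measurability is needed, the integral of a nonnegative function being a supremum. *)
Lemma ge0_le_integral_any d (T : measurableType d) (nu : {measure set T -> \bar R})
    (A : set T) (f1 f2 : T -> \bar R) :
  (forall x, A x -> (0 <= f1 x)%E) -> (forall x, A x -> (f1 x <= f2 x)%E) ->
  (\int[nu]_(x in A) f1 x <= \int[nu]_(x in A) f2 x)%E.
Proof.
move=> f10 f12; have f20 x : A x -> (0 <= f2 x)%E by move=> Ax; rewrite (le_trans (f10 x Ax)) ?f12.
rewrite !ge0_integralE//; apply: ereal_sup_le => _ [h /= hf <-]; exists h => // x.
apply: le_trans (hf x) _; rewrite !patchE; case: ifPn => // /set_mem Ax.
exact: f12.
Qed.

Lemma flux_le gamma (W G1 G2 : R -> R) x : (forall s, 0 < s < 1 -> 0 <= W s) ->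
  (forall t, 0 <= G1 t <= G2 t) ->
  (flux (hom_kernel gamma W) (modulated gamma G1) x <=
   flux (hom_kernel gamma W) (modulated gamma G2) x)%E.
Proof.
move=> W0 G12.
have K0 y z : 0 < y -> 0 < z -> 0 <= hom_kernel gamma W y z.
  move=> y0 z0; rewrite mulr_ge0 ?powR_ge0// mulr_ge0 ?powR_ge0//.
  by apply: W0; rewrite divr_gt0 ?addr_gt0//= ltr_pdivrMr ?addr_gt0// mul1r ltrDl.
have f0 y : 0 <= modulated gamma G1 y.
  by have /andP[h _] := G12 (ln y); rewrite divr_ge0 ?powR_ge0.
have f12 y : modulated gamma G1 y <= modulated gamma G2 y.
  have /andP[_ h] := G12 (ln y); rewrite /modulated ler_wpM2r// invr_ge0 powR_ge0.
  by [].
have yz y z : y \in `]0, x[ -> z \in `](x - y), +oo[ -> 0 < y /\ 0 < z.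
  rewrite !in_itv/= andbT => /andP[y0 yx] zy; split => //; lra.
apply: ge0_le_integral_any => y /= yx.
  apply: integral_ge0 => z /= zy; have [y0 z0] := yz y z yx zy.
  by rewrite lee_fin; apply: mulr_ge0 => //; apply: mulr_ge0 => //; apply: mulr_ge0 (ltW y0); exact: K0.
apply: ge0_le_integral_any => z /= zy; have [y0 z0] := yz y z yx zy.
  by rewrite lee_fin; apply: mulr_ge0 => //; apply: mulr_ge0 => //; apply: mulr_ge0 (ltW y0); exact: K0.
have k1 : 0 <= hom_kernel gamma W y z * y by apply: mulr_ge0 (ltW y0); exact: K0.
rewrite lee_fin; apply: ler_pM => //; first exact: mulr_ge0.
by rewrite ler_wpM2l.
Qed.

End Monotonicity.

(** * Sequences with geometric increments *)

Section GeometricLimits.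
Context {R : realType}.

Lemma geometric_small (A e : R) : 0 < e -> exists N, forall n, (N <= n)%N -> A * 2^-1 ^+ n <= e.
Proof.
move=> e0; pose N := Num.bound `|A / e|; exists N => n Nn.
have hN : `|A / e| < N%:R by exact/archi_boundP/normr_ge0.
have n2 : N%:R <= 2 ^+ n :> R.
  by rewrite -natrX ler_nat (leq_trans Nn)// ltnW// ltn_expl.
rewrite exprVn ler_pdivrMr ?exprn_gt0// -ler_pdivrMl// mulrC.
apply: le_trans (ler_norm _) _; exact: le_trans (ltW hN) n2.
Qed.

Lemma le_geometric0 (x A : R) : (forall n, x <= A * 2^-1 ^+ n) -> x <= 0.
Proof.
move=> h; rewrite leNgt; apply/negP => x0.
have [N hN] := geometric_small A (divr_gt0 x0 (ltr0Sn R 1)).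
by have := le_trans (h N) (hN N (leqnn N)); lra.
Qed.

(** The radius 2 A 2^(- n) is the sum of all the later increments, so the intervals with this radius
    around [u n] are nested; the limit is the supremum of their left ends. *)
Lemma geometric_cauchy (u : nat -> R) (A : R) : (forall n, `|u n.+1 - u n| <= A * 2^-1 ^+ n) ->
  exists l, forall n, `|l - u n| <= 2 * A * 2^-1 ^+ n.
Proof.
move=> hu.
pose q n : R := 2 * A * 2^-1 ^+ n.
have qS n : q n.+1 = q n / 2 by rewrite /q exprSr mulrA.
have q0 n : 0 <= q n.
  by have := le_trans (normr_ge0 _) (hu n); rewrite /q -mulrA; lra.
have hu' n : `|u n.+1 - u n| <= q n / 2.
  by apply: le_trans (hu n) _; rewrite /q; lra.
have mlo n k : u n - q n <= u (n + k)%N - q (n + k)%N.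
  elim: k => [|k IH]; first by rewrite addn0.
  apply: le_trans IH _; rewrite addnS qS.
  by have := hu' (n + k)%N; rewrite ler_norml => /andP[h1 h2]; lra.
have mhi n k : u (n + k)%N + q (n + k)%N <= u n + q n.
  elim: k => [|k IH]; first by rewrite addn0.
  apply: le_trans _ IH; rewrite addnS qS.
  by have := hu' (n + k)%N; rewrite ler_norml => /andP[h1 h2]; lra.
have lohi n m : u n - q n <= u m + q m.
  have h1 := mlo n m; have h2 := mhi m n; rewrite addnC in h2.
  by have := q0 (n + m)%N; lra.
pose E := [set u n - q n | n in [set: nat]].
have E0 : E !=set0 by exists (u 0%N - q 0%N), 0%N.
have Eb m : ubound E (u m + q m) by move=> _ [n _ <-].
have hs : has_sup E by split => //; exists (u 0%N + q 0%N).
exists (sup E) => n.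
have h1 : u n - q n <= sup E by apply: (sup_upper_bound hs); exists n.
have h2 : sup E <= u n + q n by apply: ge_sup.
by rewrite ler_norml -/(q n); apply/andP; split; lra.
Qed.

End GeometricLimits.

(** * Linearity in the symbol, scaling, constant shifts and periodicity *)

Section QuadraticForms.
Context {R : realType}.
Local Notation modes := (seq (int * R[i])).
Implicit Types (M : int -> int -> R[i]).

Lemma ev_prodm_linear X M M0 M1 (t : R) (G H : modes) :
  (forall j l, M j l = M0 j l + t%:C%C * M1 j l) ->
  ev X (prodm M G H) = ev X (prodm M0 G H) + t * ev X (prodm M1 G H).
Proof.
move=> hM; rewrite !ev_prodm mulr_sumr -big_split/=; apply: eq_bigr => e _.
rewrite mulr_sumr -big_split/=; apply: eq_bigr => h _.
rewrite mulrDr -!ReZ -!ReD !hM; congr complex.Re; ring.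
Qed.

Lemma norm_ev_prodm X M (P : R) (G H : modes) : (forall j l, normc (M j l) <= P) ->
  `|ev X (prodm M G H)| <= P * nrm (fun=> 1) G * nrm (fun=> 1) H.
Proof.
move=> hM; apply: le_trans (norm_ev _ _) _.
by apply: nrm_prodm => // j l; rewrite mulr1.
Qed.

Lemma ev_prodm_scale X M (k : R) (G : modes) :
  ev X (prodm M (scalem k G) (scalem k G)) = k ^+ 2 * ev X (prodm M G G).
Proof.
rewrite !ev_prodm /scalem !big_map mulr_sumr; apply: eq_bigr => e _.
rewrite big_map mulr_sumr; apply: eq_bigr => h _; rewrite /fst /snd.
rewrite conjcM conjc_real mulrDr -!ReZ rmorphXn/=; congr (complex.Re _ + complex.Re _); ring.
Qed.

Definition const_mode (y : R) : modes := [:: (0, y%:C%C)].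

Lemma ev_const X y : ev X (const_mode y) = y.
Proof.
by rewrite /ev big_seq1 [X in cis X](_ : _ = 0) ?cis0 ?mulr1//= mul0r.
Qed.

Lemma nrm_const y : nrm (fun=> 1) (const_mode y) = `|y|.
Proof. by rewrite /nrm big_seq1 divr1 normc_real. Qed.

(** One term quadratic in [eta] and two cross terms with a [G] of norm at most 2: 1 + 2 + 2 = 5. *)
Lemma prodm_shift X M (P eta : R) (G : modes) : (forall j l, normc (M j l) <= P) ->
  `|eta| <= 1 -> nrm (fun=> 1) G <= 2 ->
  `|ev X (prodm M (const_mode eta ++ G) (const_mode eta ++ G)) - ev X (prodm M G G)|
    <= 5 * P * `|eta|.
Proof.
move=> hM e1 G2; have P0 : 0 <= P := le_trans (normc_ge0 _) (hM 0 0).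
rewrite ev_prodm_catl !ev_prodm_catr.
have h1 := norm_ev_prodm X (const_mode eta) (const_mode eta) hM.
have h2 := norm_ev_prodm X (const_mode eta) G hM.
have h3 := norm_ev_prodm X G (const_mode eta) hM.
rewrite nrm_const in h1 h2 h3.
have n0 : 0 <= `|eta| by [].
have Pe : 0 <= P * `|eta| by rewrite mulr_ge0.
have g1 : P * `|eta| * `|eta| <= P * `|eta| by rewrite ler_piMr.
have g2 : P * `|eta| * nrm (fun=> 1) G <= P * `|eta| * 2 by rewrite ler_wpM2l.
have g3 : P * nrm (fun=> 1) G * `|eta| <= P * 2 * `|eta|.
  by rewrite ler_wpM2r// ler_wpM2l.
move: (ev X (prodm M (const_mode eta) (const_mode eta))) h1 => a h1.
move: (ev X (prodm M (const_mode eta) G)) h2 => b h2.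
move: (ev X (prodm M G (const_mode eta))) h3 => c h3.
move: (ev X (prodm M G G)) => d.
have -> : a + b + (c + d) - d = a + b + c by ring.
apply: le_trans (ler_normD _ _) _; apply: le_trans (lerD (ler_normD _ _) (lexx _)) _.
have := le_trans h1 g1; have := le_trans h2 g2; have := le_trans h3 g3; lra.
Qed.

Lemma cisn2pi (k : int) : cis (k%:~R * (2 * pi)) = 1 :> R[i].
Proof.
have nat_case (n : nat) : cis (n%:R * (2 * pi)) = 1 :> R[i].
  elim: n => [|n IH]; first by rewrite mul0r cis0.
  rewrite -natr1 mulrDl mul1r cisD IH mul1r /cis mulr_natl cos2pi sin2pi.
  by apply/eqP; rewrite eq_complex/= !eqxx.
case: k => n; first exact: nat_case.
rewrite NegzE mulrNz mulNr -conjc_cis -pmulrn nat_case.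
by apply/eqP; rewrite eq_complex/= oppr0 !eqxx.
Qed.

Lemma ev_periodic X (G : modes) : ev (X + 2 * pi) G = ev X G.
Proof.
by apply: eq_bigr => e _; rewrite mulrDr cisD cisn2pi mulr1.
Qed.

End QuadraticForms.

(** * Coefficients of sums of weights, and the mean flux *)

Section Coefficients.
Context {R : realType}.
Local Notation mu := (@lebesgue_measure R).
Local Notation Re := complex.Re.
Local Notation D := (`]0%R, 1%R[%classic : set R).

Lemma pair_coefD om (W B : R -> R) (t : R) j l : 0 < om -> admissible W -> admissible B ->
  pair_coef om (fun s => W s + t * B s) j l = pair_coef om W j l + t%:C%C * pair_coef om B j l.
Proof. by move=> om0 aW aB; apply: cintD; exact: cintegrable_pair_mode. Qed.

Lemma pair_coef00 om (W : R -> R) : pair_coef om W 0 0 =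
  (\int[mu]_(s in D) ((1 - s) * W s * loglen s))%:C%C.
Proof.
rewrite /pair_coef (_ : (fun s => pair_mode om s 0 0) = fun s => (loglen s)%:C%C); last first.
  apply/funext => s; rewrite /pair_mode /phase [X in cis X](_ : _ = 0) ?cis0 ?mul1r//.
  by rewrite !mul0r addr0.
rewrite /cint; congr Complex; rewrite /Rintegral.
by under eq_integral do rewrite /= mulr0; rewrite integral0.
Qed.

(** A multiple of a bump of known mass fits under the integrand, because loglen s >= s and the
    weight is at least 1 / 2. *)
Lemma mean_coef_gt0 (W : R -> R) : admissible W -> (forall s, 0 < s < 1 -> 1 / 2 <= W s) ->
  0 < \int[mu]_(s in D) ((1 - s) * W s * loglen s).
Proof.
move=> [mW W0 iW] W12.
have m0 : 0 < (1 / 4 : R) by lra.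
have b := @bump_mass R (1 / 2) (1 / 4) m0 ltac:(lra) ltac:(lra).
have := le_has_int (has_intZ (1 / 2) b) (integrable_has_int iW).
have p : 0 < 1 / 2 * (4 / 3 * (1 / 4) ^+ 3) :> R by rewrite !mulr_gt0// exprn_gt0.
move=> h; apply: lt_le_trans p (h _) => s s01; have /andP[s0 s1] := s01.
have ls := le_loglen s01; have w := W12 s s01.
have a1 : bump (1 / 2) (1 / 4) s <= s * (1 - s).
  rewrite /bump ge_max; apply/andP; split; first by rewrite mulr_ge0//; lra.
  have -> : (1 / 4) ^+ 2 - (s - 1 / 2) ^+ 2 = s * (1 - s) - 3 / 16 by field.
  lra.
apply: le_trans (ler_wpM2l _ a1) _; first lra.
have -> : 1 / 2 * (s * (1 - s)) = (1 - s) * (1 / 2) * s by ring.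
by apply: ler_pM => //; [rewrite mulr_ge0//; lra|exact: ltW|rewrite ler_wpM2l//; lra].
Qed.

Lemma flux_const gamma (W : R -> R) (y x : R) : 0 < x -> 0 <= y -> admissible W ->
  (forall s, W (1 - s) = W s) ->
  flux (hom_kernel gamma W) (modulated gamma (fun=> y)) x =
  (y ^+ 2 * \int[mu]_(s in D) ((1 - s) * W s * loglen s))%:E.
Proof.
move=> x0 y0 aW Wsym.
have := @flux_trig R 1 ltr01 gamma x W (const_mode y) x0 aW Wsym.
rewrite (_ : (fun t => ev (1 * t) (const_mode y)) = fun=> y); last first.
  by apply/funext => t; rewrite ev_const.
move=> ->; last by move=> t; rewrite ev_const.
congr EFin; rewrite ev_prodm /const_mode !big_seq1 /fst /snd oppr0 addr0 !pair_coef00 conjc_real.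
rewrite [cis _](_ : _ = 1); last by rewrite mul0r cis0.
rewrite !mulr1 -ReD; move: (\int[mu]_(s in D) _) => I.
have -> : y%:C%C * y%:C%C * I%:C%C / 2 + y%:C%C * y%:C%C * I%:C%C / 2 =
  (y ^+ 2 * I)%:C%C :> R[i].
  by rewrite !rmorphM/= ?rmorphXn/=; field.
by [].
Qed.

End Coefficients.

(** * Passage to the limit in the iteration *)

Section LimitSolution.
Context {R : realType}.
Local Notation mu := (@lebesgue_measure R).
Local Notation modes := (seq (int * R[i])).
Variables (om A P : R) (W B1 B2 : R -> R) (L : nat -> modes) (t1 t2 c : nat -> R).
Hypothesis om0 : 0 < om.
Hypothesis A0 : 0 <= A.
Hypothesis A4 : 4 * A <= 1.
Hypotheses (aW : admissible W) (aB1 : admissible B1) (aB2 : admissible B2).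
Hypotheses (sW : forall s, W (1 - s) = W s) (sB1 : forall s, B1 (1 - s) = B1 s)
  (sB2 : forall s, B2 (1 - s) = B2 s).
Hypothesis PW : forall j l, normc (pair_coef om W j l) <= P.
Hypothesis PB1 : forall j l, normc (pair_coef om B1 j l) <= P.
Hypothesis PB2 : forall j l, normc (pair_coef om B2 j l) <= P.
Hypothesis L_step : forall n, exists2 E, L n.+1 = L n ++ E & nrm (fun=> 1) E <= A * 2^-1 ^+ n.
Hypothesis L_nrm : forall n, nrm (fun=> 1) (L n) <= 2.
Hypothesis L_pos : forall n X, 1 / 2 <= ev X (L n).
Hypothesis t1_step : forall n, `|t1 n.+1 - t1 n| <= A * 2^-1 ^+ n.
Hypothesis t2_step : forall n, `|t2 n.+1 - t2 n| <= A * 2^-1 ^+ n.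
Hypothesis quad_close : forall n X,
  `|quad (pair_coef om W) (pair_coef om B1) (pair_coef om B2) (t1 n) (t2 n) X (L n) - c n|
    <= A * 2^-1 ^+ n.

Let half_le1 n : 2^-1 ^+ n <= 1 :> R.
Proof. by rewrite exprn_ile1// invf_le1// ler1n. Qed.

Let half_ge0 n : 0 <= 2^-1 ^+ n :> R.
Proof. by rewrite exprn_ge0. Qed.

Let P0 : 0 <= P. Proof. exact: le_trans (normc_ge0 _) (PW 0 0). Qed.

Let profile_limit : {g : R -> R | forall X n, `|g X - ev X (L n)| <= 2 * A * 2^-1 ^+ n}.
Proof.
apply: cid.
suff /choice[g hg] : forall X, exists l, forall n, `|l - ev X (L n)| <= 2 * A * 2^-1 ^+ n.
  by exists g.
move=> X; apply: geometric_cauchy => n; have [E -> hE] := L_step n.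
rewrite ev_cat addrC addKr; exact: le_trans (norm_ev _ _) hE.
Qed.

Let weight (T1 T2 : R) (s : R) := (W s + T1 * B1 s) + T2 * B2 s.

(* The limit [g] is squeezed between the trigonometric sums [ev _ (L n)] shifted by constants, whose
   fluxes are explicit, so monotonicity of the flux replaces any convergence theorem. *)
Lemma limit_solution : exists (g : R -> R) (T1 T2 : R),
  [/\ forall X n, `|g X - ev X (L n)| <= 2 * A * 2^-1 ^+ n,
      forall n, `|T1 - t1 n| <= 2 * A * 2^-1 ^+ n /\ `|T2 - t2 n| <= 2 * A * 2^-1 ^+ n,
      measurable_fun [set: R] g /\ (forall X, 0 <= g X),
      (forall X, g (X + 2 * pi) = g X) &
      (forall s, 0 < s < 1 -> 0 <= (W s + T1 * B1 s) + T2 * B2 s) ->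
      forall gamma, exists a : R, forall k x, 0 < k -> 0 < x ->
        flux (hom_kernel gamma (fun s => (W s + T1 * B1 s) + T2 * B2 s))
          (modulated gamma (fun t => k * g (om * t))) x = (k ^+ 2 * a)%:E].
Proof.
have [g hg] := profile_limit.
have [T1 hT1] := geometric_cauchy t1_step; have [T2 hT2] := geometric_cauchy t2_step.
have hA4 := A4; have hA0 := A0.
(* [4 * A <= 1] keeps the shift below 1 / 2, the lower bound of the sums, so that the lower
   comparison function is nonnegative as [flux_le] demands. *)
have eta_le n : 2 * A * 2^-1 ^+ n <= 1 / 2.
  by apply: le_trans (ler_wpM2l _ (half_le1 n)) _; lra.
have eta_ge0 n : 0 <= 2 * A * 2^-1 ^+ n by rewrite mulr_ge0 ?half_ge0// mulr_ge0.
have mg : measurable_fun [set: R] g.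
  apply: (@measurable_fun_cvg _ _ _ _ (fun n X => ev X (L n))) => [n|X _].
    exact: measurable_ev.
  apply/cvgrPdist_le => e e0; have [N hN] := geometric_small (2 * A) e0.
  by exists N => // n /= Nn; apply: le_trans (hg X n) (hN n Nn).
exists g, T1, T2; split => //.
- split => // X; have := hg X 0%N; have := L_pos 0%N X; have := eta_le 0%N.
  by rewrite ler_norml => h1 h2 /andP[h3 _]; lra.
- move=> X; apply/eqP; rewrite -subr_eq0 -normr_le0.
  apply: (@le_geometric0 _ _ (4 * A)) => n.
  have := hg X n; have := hg (X + 2 * pi) n; rewrite ev_periodic !ler_norml.
  by move=> /andP[? ?] /andP[? ?]; apply/andP; split; lra.
move=> Wpos gamma; pose Wt s := weight T1 T2 s.
rewrite -/Wt; have [mW W0 iW] := aW; have [mB1 _ iB1] := aB1; have [mB2 _ iB2] := aB2.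
have aWt : admissible Wt.
  split => //.
    by apply: measurable_funD; [apply: measurable_funD => //|]; apply: measurable_funM.
  by apply: weight_integrableD => //; exact: weight_integrableD.
have sWt s : Wt (1 - s) = Wt s by rewrite /Wt /weight sW sB1 sB2.
pose M := pair_coef om Wt.
have ME X (G H : modes) : ev X (prodm M G H) = ev X (prodm (pair_coef om W) G H)
    + T1 * ev X (prodm (pair_coef om B1) G H) + T2 * ev X (prodm (pair_coef om B2) G H).
  pose M' j l := pair_coef om W j l + T1%:C%C * pair_coef om B1 j l.
  rewrite -(@ev_prodm_linear _ X M' _ _ _ _ _ (fun j l => erefl)).
  apply: ev_prodm_linear => j l; rewrite /M /M' /Wt /weight.
  have [i1 i2] := cintegrable_pair_mode om0 j l aW.
  have [k1 k2] := cintegrable_pair_mode om0 j l aB1.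
  rewrite -(@pair_coefD _ om W B1 T1 j l om0 aW aB1) /pair_coef.
  apply: cintD; last exact: cintegrable_pair_mode.
  by split; exact: weight_integrableD.
pose Q := P + (`|T1| + `|T2|) * P.
have MQ j l : normc (M j l) <= Q.
  have -> : M j l = pair_coef om W j l + T1%:C%C * pair_coef om B1 j l
      + T2%:C%C * pair_coef om B2 j l.
    have [i1 i2] := cintegrable_pair_mode om0 j l aW.
    have [k1 k2] := cintegrable_pair_mode om0 j l aB1.
    rewrite -(@pair_coefD _ om W B1 T1 j l om0 aW aB1) /pair_coef.
    apply: cintD; last exact: cintegrable_pair_mode.
    by split; exact: weight_integrableD.
  apply: le_trans (normcD _ _) _; apply: le_trans (lerD (normcD _ _) (lexx _)) _.
  rewrite !normcM !normc_real.
  have u1 : `|T1| * normc (pair_coef om B1 j l) <= `|T1| * P by rewrite ler_wpM2l.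
  have u2 : `|T2| * normc (pair_coef om B2 j l) <= `|T2| * P by rewrite ler_wpM2l.
  by have := PW j l; rewrite /Q; lra.
have Q0 : 0 <= Q := le_trans (normc_ge0 _) (MQ 0 0).
(* 10 Q A is the cost of a shift by 2 A 2^(- n), 16 P A that of replacing [t1 n], [t2 n] by their
   limits, and A comes from [quad_close]. *)
pose E := 10 * Q * A + 16 * P * A + A.
have quadM n X : `|ev X (prodm M (L n) (L n)) - c n| <= (16 * P * A + A) * 2^-1 ^+ n.
  have := quad_close n X; rewrite /quad ME.
  have b1 := norm_ev_prodm X (L n) (L n) PB1; have b2 := norm_ev_prodm X (L n) (L n) PB2.
  have n0 : 0 <= nrm (fun=> 1) (L n) by apply: nrm_ge0.
  have n4 : P * nrm (fun=> 1) (L n) * nrm (fun=> 1) (L n) <= 4 * P.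
    rewrite -mulrA (mulrC 4) ler_wpM2l//.
    have : nrm (fun=> 1) (L n) * nrm (fun=> 1) (L n) <= 2 * 2 by apply: ler_pM.
    lra.
  move: (ev X (prodm (pair_coef om B1) _ _)) b1 => y1 b1.
  move: (ev X (prodm (pair_coef om B2) _ _)) b2 => y2 b2.
  move: (ev X (prodm (pair_coef om W) _ _)) => y0 hq.
  have d1 : `|(T1 - t1 n) * y1| <= 2 * A * 2^-1 ^+ n * (4 * P).
    by rewrite normrM; apply: ler_pM => //; exact: le_trans b1 n4.
  have d2 : `|(T2 - t2 n) * y2| <= 2 * A * 2^-1 ^+ n * (4 * P).
    by rewrite normrM; apply: ler_pM => //; exact: le_trans b2 n4.
  have -> : y0 + T1 * y1 + T2 * y2 - c n =
     (y0 + t1 n * y1 + t2 n * y2 - c n) + (T1 - t1 n) * y1 + (T2 - t2 n) * y2 by ring.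
  apply: le_trans (ler_normD _ _) _; apply: le_trans (lerD (ler_normD _ _) (lexx _)) _.
  lra.
have shifted n eta k x : 0 < k -> 0 < x -> `|eta| <= 2 * A * 2^-1 ^+ n ->
    exists2 y : R, `|y - c n| <= E * 2^-1 ^+ n &
    flux (hom_kernel gamma Wt) (modulated gamma (fun t => k * (eta + ev (om * t) (L n)))) x = (k ^+ 2 * y)%:E.
  move=> k0 x0 he; have := he; rewrite ler_norml => /andP[he1 he2].
  have en := eta_le n.
  exists (ev (om * ln x) (prodm M (const_mode eta ++ L n) (const_mode eta ++ L n))).
    have e1 : `|eta| <= 1 by apply: le_trans he _; lra.
    have h1 := prodm_shift (om * ln x) MQ e1 (L_nrm n).
    have h2 := quadM n (om * ln x).
    have h3 : 5 * Q * `|eta| <= 5 * Q * (2 * A * 2^-1 ^+ n) by rewrite ler_wpM2l// mulr_ge0.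
    move: h1 h2; set z := ev _ _; set z' := ev _ _ => h1 h2.
    have -> : z - c n = (z - z') + (z' - c n) by ring.
    apply: le_trans (ler_normD _ _) _; rewrite /E; lra.
  have evE t : ev t (const_mode eta ++ L n) = eta + ev t (L n) by rewrite ev_cat ev_const.
  rewrite (_ : (fun t => k * (eta + ev (om * t) (L n))) =
      fun t => ev (om * t) (scalem k (const_mode eta ++ L n))).
    rewrite flux_trig ?ev_prodm_scale// => t; rewrite ev_scale evE mulr_ge0 ?(ltW k0)//.
    by have := L_pos n t; lra.
  by apply/funext => t; rewrite ev_scale evE.
have between n k x : 0 < k -> 0 < x -> exists2 y : R, `|y - c n| <= E * 2^-1 ^+ n &
    flux (hom_kernel gamma Wt) (modulated gamma (fun t => k * g (om * t))) x = (k ^+ 2 * y)%:E.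
  move=> k0 x0; have en := eta_le n; have k20 : 0 < k ^+ 2 by rewrite exprn_gt0.
  have [|ylo hlo flo] := shifted n (- (2 * A * 2^-1 ^+ n)) k x k0 x0.
    by rewrite normrN ger0_norm.
  have [|yhi hhi fhi] := shifted n (2 * A * 2^-1 ^+ n) k x k0 x0.
    by rewrite ger0_norm.
  have k1 : (flux (hom_kernel gamma Wt)
        (modulated gamma (fun t => k * (- (2 * A * 2^-1 ^+ n) + ev (om * t) (L n)))%R) x
     <= flux (hom_kernel gamma Wt) (modulated gamma (fun t => k * g (om * t))%R) x)%E.
    apply: flux_le => // t; have := hg (om * t) n; have := L_pos n (om * t).
    rewrite ler_norml => h1 /andP[h2 h3]; rewrite ler_pM2l// pmulr_rge0//.
    by apply/andP; split; lra.
  have k2 : (flux (hom_kernel gamma Wt) (modulated gamma (fun t => k * g (om * t))%R) x <=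
     flux (hom_kernel gamma Wt)
       (modulated gamma (fun t => k * (2 * A * 2^-1 ^+ n + ev (om * t) (L n)))%R) x)%E.
    apply: flux_le => // t; have := hg (om * t) n; have := L_pos n (om * t).
    rewrite ler_norml => h1 /andP[h2 h3]; rewrite ler_pM2l// pmulr_rge0//.
    by apply/andP; split; lra.
  move: k1 k2; rewrite flo fhi; case: (flux _ _ _) => // y.
  have yE : y = k ^+ 2 * (y / k ^+ 2) by rewrite mulrCA divff ?mulr1// gt_eqF.
  rewrite yE; set y' := y / _; rewrite !lee_fin !ler_pM2l// => k1 k2; exists y' => //.
  by move: hlo hhi; rewrite !ler_norml => /andP[? ?] /andP[? ?]; apply/andP; split; lra.
(* For every n both constants are within E 2^(- n) of the same [c n]. Hence the flux does not depend
   on x and, divided by k^2, not on k either. *)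
have [a _ fa] := between 0%N 1 1 ltr01 ltr01.
exists a => k x k0 x0; have [b _ fb] := between 0%N k x k0 x0.
have inj (z y y' : R) : 0 < z -> (z ^+ 2 * y)%:E = (z ^+ 2 * y')%:E -> y = y'.
  by move=> z0 [] /mulfI; apply; rewrite expf_neq0// gt_eqF.
rewrite fb; congr ((_ * _)%:E); apply/eqP; rewrite -subr_eq0 -normr_le0.
apply: (@le_geometric0 _ _ (2 * E)) => n.
have [a' ha' fa'] := between n 1 1 ltr01 ltr01; have [b' hb' fb'] := between n k x k0 x0.
rewrite fa in fa'; rewrite fb in fb'.
rewrite -(inj _ _ _ ltr01 fa') in ha'; rewrite -(inj _ _ _ k0 fb') in hb'.
by move: ha' hb'; rewrite !ler_norml => /andP[? ?] /andP[? ?]; apply/andP; split; lra.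
Qed.

End LimitSolution.

(** * Existence of a log-periodic solution for some weight *)

Section Existence.
Context {R : realType}.
Local Notation mu := (@lebesgue_measure R).
Local Notation Re := complex.Re.
Variable (beta : R).
Hypothesis beta_lo : 3 / 2 <= beta.
Hypothesis beta_hi : beta < 2.
Local Notation W0 := (base_weight beta).

Lemma dominated_mono (K K' : R) (W : R -> R) : K <= K' -> dominated beta K W -> dominated beta K' W.
Proof.
move=> KK' [mW hW]; split => // s s01; have /andP[-> h] := hW s s01 => /=.
apply: le_trans h _; rewrite ler_wpM2r//.
exact: le_trans ler01 (base_weight_ge1 beta_lo s01).
Qed.

Lemma dominatedD (K1 K2 c : R) (W1 W2 : R -> R) : 0 <= c -> dominated beta K1 W1 ->
  dominated beta K2 W2 -> dominated beta (K1 + c * K2) (fun s => W1 s + c * W2 s).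
Proof.
move=> c0 [m1 h1] [m2 h2]; split; first by apply: measurable_funD => //; exact: measurable_funM.
move=> s s01; have /andP[a1 b1] := h1 s s01; have /andP[a2 b2] := h2 s s01.
rewrite addr_ge0 ?mulr_ge0//= mulrDl -mulrA; apply: lerD => //.
by rewrite ler_wpM2l.
Qed.

Lemma normc_symbolN (M : int -> int -> R[i]) (k : int) : hermitian M ->
  normc (symbol M (- k)) = normc (symbol M k).
Proof.
move=> hM; rewrite /symbol.
have -> : M 0 (- k) = conjc (M 0 k) by rewrite -hM oppr0.
have -> : M (- k) 0 = conjc (M k 0) by rewrite -hM oppr0.
by rewrite -(rmorphD (@conjc R)); exact: normcJ'.
Qed.

(** The directions at phases 0 and pi / 2 have determinant 2 om^2, and pulses come close enough to
    them. *)
Let transversal_bumps (om : R) : 0 < om -> exists (B1 B2 : R -> R),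
  [/\ tame B1, tame B2 & 0 < cross (freq B1 om) (freq B2 om)].
Proof.
move=> om0.
have : 0 < cross (direction om 0) (direction om (pi / 2)).
  rewrite /cross /direction/= sin0 cos0 cos_pihalf sin_pihalf.
  have -> : - om * 0 * (om + om * 0 - 2 * 1) - (om + om * 1 - 2 * 0) * (- om * 1) =
    2 * om ^+ 2 by rewrite expr2; ring.
  by rewrite mulr_gt0// exprn_gt0.
move=> /cross_open[e e0 H].
have [B1 tB1 h1] := pulse_direction beta_lo beta_hi 0 om0 e0.
have [B2 tB2 h2] := pulse_direction beta_lo beta_hi (pi / 2) om0 e0.
by exists B1, B2; split => //; exact: H.
Qed.

Lemma ev_total (eps X : R) (L : seq (int * R[i])) :
  ev X (total eps L) = 1 + 2 * eps * cos X + ev X L.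
Proof.
rewrite /total !ev_cat addrA; congr (_ + _ + _).
  exact: (@ev_const R X 1).
rewrite /ev big_seq1.
have -> : cis (1%:~R * X) = cis X by rewrite mul1r.
by rewrite /= mul0r subr0.
Qed.

Lemma nrm_total (eps : R) (L : seq (int * R[i])) : 0 <= eps ->
  nrm (fun=> 1) (total eps L) = 1 + 2 * eps + nrm (fun=> 1) L.
Proof.
move=> e0; rewrite /total !nrm_cat addrA; congr (_ + _ + _).
  by rewrite (@nrm_const R 1) normr1.
by rewrite /nrm big_seq1 divr1 normc_real ger0_norm// mulr_ge0.
Qed.

Let small_factor (N x y : R) : 0 < N -> 0 < x -> 0 < y ->
  exists2 e, 0 < e & N * x * e * y = 1.
Proof.
move=> N0 x0 y0; exists (N * x * y)^-1; first by rewrite invr_gt0 !mulr_gt0.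
by field; rewrite !gt_eqF.
Qed.

Lemma iteration_data : exists (B B1 B2 : R -> R) (om C P : R),
  let W s : R := W0 s + 1 * B s in
  let M V := pair_coef om V in
  [/\ [/\ tame B, tame B1 & tame B2], 0 < om /\ 1 <= C,
      [/\ admissible W, admissible B1 & admissible B2],
      [/\ forall j l, normc (M W j l) <= P, forall j l, normc (M B1 j l) <= P &
          forall j l, normc (M B2 j l) <= P] &
      forall eps, 0 < eps -> 1000 * C ^+ 3 * eps <= 1 ->
      exists (Ls : nat -> seq (int * R[i])) (t1 t2 c : nat -> R),
      [/\ forall n, nrm (fun=> 1) (Ls n) <= 8 * C * eps ^+ 2,
        forall n, exists2 D, Ls n.+1 = Ls n ++ D &
          nrm (fun=> 1) D <= 4 * C * eps ^+ 2 * 2^-1 ^+ n,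
        forall n, `|t1 n| <= 4 * C ^+ 2 * eps /\ `|t2 n| <= 4 * C ^+ 2 * eps,
        forall n, `|t1 n.+1 - t1 n| <= 2 * C ^+ 2 * eps * 2^-1 ^+ n /\
          `|t2 n.+1 - t2 n| <= 2 * C ^+ 2 * eps * 2^-1 ^+ n &
        forall n X, `|quad (M W) (M B1) (M B2) (t1 n) (t2 n) X (total eps (Ls n)) - c n| <=
          8 * C ^+ 2 * eps ^+ 2 * 2^-1 ^+ n]].
Proof.
have [B [om [c0 [tB om2 c00 fB hB]]]] := resonant_weight beta_lo beta_hi.
have om0 : 0 < om by lra.
have [B1 [B2 [tB1 tB2 cr]]] := transversal_bumps om0.
have [Ct Ct0 hCt] := cross_solve cr.
set W := fun s => _ in fB hB.
have [KB KB0 dB] := tame_dominated beta_lo tB.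
have [K1 K10 dB1] := tame_dominated beta_lo tB1.
have [K2 K20 dB2] := tame_dominated beta_lo tB2.
have dbase : dominated beta 1 W0.
  split; first exact: measurable_base_weight.
  by move=> s s01; rewrite mul1r lexx andbT (le_trans ler01)// base_weight_ge1.
have dW : dominated beta (1 + 1 * KB) W := dominatedD ler01 dbase dB.
pose K := 1 + KB + K1 + K2.
have K0 : 0 <= K by rewrite /K; lra.
have {}dW : dominated beta K W by apply: dominated_mono dW; rewrite /K; lra.
have {}dB1 : dominated beta K B1 by apply: dominated_mono dB1; rewrite /K; lra.
have {}dB2 : dominated beta K B2 by apply: dominated_mono dB2; rewrite /K; lra.
have aW := dominated_admissible beta_lo beta_hi dW.
have aB1 := dominated_admissible beta_lo beta_hi dB1.
have aB2 := dominated_admissible beta_lo beta_hi dB2.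
have [Cd Cd0 hCd] := dominated_pair_coef beta_lo beta_hi.
pose P := K * Cd; have P0 : 0 <= P by rewrite mulr_ge0// ltW.
pose M0 := pair_coef om W; pose M1 := pair_coef om B1; pose M2 := pair_coef om B2.
have hM0 := pair_coef_hermitian om0 aW.
have hM1 := pair_coef_hermitian om0 aB1.
have hM2 := pair_coef_hermitian om0 aB2.
(* Dividing the lower bound on F by |k om| turns the exponent beta - 1 into beta - 2. *)
have wlow (k : int) : (1 < `|k|)%N ->
    c0 * `|k%:~R * om| `^ (beta - 2) <= normc (symbol M0 k) /\ 1 <= `|k%:~R * om|.
  have natc (n : nat) : (1 < n)%N ->
      c0 * `|n%:~R * om| `^ (beta - 2) <= normc (symbol M0 n) /\ 1 <= `|n%:~R * om|.
    move=> n1; have n0 : n%:Z != 0 by case: n n1.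
    have nR : 2 <= n%:R :> R by rewrite ler_nat.
    have no : 1 <= n%:R * om.
      by have := ler_wpM2r (ltW om0) nR; lra.
    have no0 : 0 < n%:R * om by lra.
    rewrite (normc_symbol om0 aW n0) -pmulrn (gtr0_norm no0); split => //.
    rewrite ler_pdivlMr//; apply: le_trans (hB n n1).
    rewrite -mulrA ler_wpM2l ?(ltW c00)//.
    rewrite -{2}[n%:R * om](powRr1 (ltW no0)) -powRD ?(gt_eqF no0) ?implybT//.
    by have -> : beta - 2 + 1 = beta - 1 by ring.
  case: k => n; first exact: natc.
  rewrite NegzE abszN => n1; rewrite normc_symbolN//.
  by rewrite mulrNz mulNr normrN; exact: natc.
pose w (k : int) : R := if (`|k| <= 1)%N then 1 else normc (symbol M0 k).
have w0 k : 0 < w k.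
  rewrite /w; case: ifPn => // ; rewrite -ltnNge => /wlow[h1 h2].
  apply: lt_le_trans h1; rewrite mulr_gt0// powR_gt0//; lra.
(* [P] serves where the weight is 1, [P / c0] bounds the ratio of coefficient to symbol elsewhere,
   and [Ct * om] accounts for the symbol at 1 being F / (i om). *)
pose C := 1 + P + P / c0 + Ct * om.
have Pc : 0 <= P / c0 by rewrite divr_ge0// ltW.
have Co : 0 <= Ct * om by rewrite mulr_ge0// ltW.
have C1 : 1 <= C by rewrite /C; lra.
have MC (V : R -> R) : dominated beta K V -> forall j l, normc (pair_coef om V j l) <= C * w (j + l).
  move=> dV j l; have [h1 h2] := hCd om K V j l om0 K0 dV; rewrite -/P in h1 h2.
  rewrite /w; case: ifPn => [_|]; first by rewrite mulr1 /C; lra.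
  rewrite -ltnNge => kk; have [g1 g2] := wlow _ kk.
  have k0 : j + l != 0 by move: kk; case: eqP => // ->.
  apply: le_trans (h2 k0 g2) _.
  apply: (@le_trans _ _ (P / c0 * normc (symbol M0 (j + l)))).
    by rewrite -mulrA ler_wpM2l// ler_pdivlMl.
  by rewrite ler_wpM2r ?normc_ge0// /C; lra.
have PP (V : R -> R) : dominated beta K V -> forall j l, normc (pair_coef om V j l) <= P.
  by move=> dV j l; have [] := hCd om K V j l om0 K0 dV.
have sym1 (V : R -> R) : admissible V ->
    symbol (pair_coef om V) 1 = Complex 0 (- om^-1) * freq V om.
  by move=> aV; rewrite symbol_pair_coef// mul1r.
have M0_res : symbol M0 1 = 0 by rewrite /M0 sym1// fB mulr0.
have transv (z : R[i]) : exists t1 t2 : R,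
    [/\ t1%:C%C * symbol M1 1 + t2%:C%C * symbol M2 1 = z,
      `|t1| <= C * normc z & `|t2| <= C * normc z].
  have [a [b [hab ha hb]]] := hCt (Complex 0 om * z).
  have nz : normc (Complex 0 om * z) = om * normc z.
    by rewrite normcM; congr (_ * _); rewrite /= expr0n/= add0r sqrtr_sqr gtr0_norm.
  have bd : Ct * normc (Complex 0 om * z) <= C * normc z.
    by rewrite nz mulrA ler_wpM2r ?normc_ge0// /C; lra.
  exists a, b; split; [|exact: le_trans ha bd|exact: le_trans hb bd].
  rewrite /M1 /M2 !sym1//.
  have -> : a%:C%C * (Complex 0 (- om^-1) * freq B1 om) + b%:C%C * (Complex 0 (- om^-1) * freq B2 om)
    = Complex 0 (- om^-1) * (a%:C%C * freq B1 om + b%:C%C * freq B2 om) by ring.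
  rewrite hab mulrA.
  have -> : Complex 0 (- om^-1) * Complex 0 om = 1 :> R[i].
    apply/eqP; rewrite eq_complex/=; apply/andP; split; apply/eqP; last by ring.
    by field; rewrite gt_eqF.
  by rewrite mul1r.
have PC : P <= C by rewrite /C; lra.
exists B, B1, B2, om, C, P; split => //; first by split; exact: PP.
move=> eps e0 He.
exact: (quad_iter C1 hM0 hM1 hM2 w0 (MC W dW)
  (MC B1 dB1) (MC B2 dB2) M0_res transv (fun j l => le_trans (PP W dW j l) PC) e0 He).
Qed.

(** A single eps = 1 / (1000 C^3 (1 + k)) meets all demands: contraction, sums close to the seed and
    above 1 / 2, and, with [k] a bound on the bumps, a weight above 1 / 2. *)
Let small_amplitude (C k : R) : 1 <= C -> 0 <= k -> exists eps,
  [/\ 0 < eps /\ 1000 * C ^+ 3 * eps <= 1, eps <= 1 / 40, C * eps ^+ 2 <= eps / 40,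
      C * eps ^+ 2 <= C ^+ 2 * eps /\ C ^+ 2 * eps ^+ 2 <= C ^+ 2 * eps &
      40 * (C ^+ 2 * eps * (1 + k)) <= 1].
Proof.
move=> C1 k0.
have C0 : 0 < C ^+ 3 by rewrite exprn_gt0//; lra.
have k1 : 0 < 1 + k by lra.
have N0 : 0 < 1000 :> R by rewrite ltr0n.
have [eps e0 eE] := small_factor N0 C0 k1.
have ek : 0 <= C ^+ 3 * eps * k by apply: mulr_ge0 => //; apply: mulr_ge0; exact: ltW.
have e1 : 1000 * C ^+ 3 * eps <= 1 by lra.
have CK : C ^+ 2 * (eps * (1 + k)) <= C ^+ 3 * (eps * (1 + k)).
  apply: ler_wpM2r; first by apply: mulr_ge0; exact: ltW.
  by rewrite [leRHS]exprS ler_peMl// sqr_ge0.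
have {}CK : 40 * (C ^+ 2 * eps * (1 + k)) <= 1 by lra.
have C2k : 0 <= C ^+ 2 * eps * k by apply: mulr_ge0 => //; apply: mulr_ge0; rewrite ?sqr_ge0// ltW.
exists eps; clear eE; split; [by split| | | |exact: CK]; clear e1 N0.
- have h1 : eps <= C ^+ 2 * eps by rewrite ler_peMl ?(ltW e0)// expr_ge1//; lra.
  lra.
- have h2 : C * eps <= C ^+ 2 * eps.
    by rewrite ler_wpM2r ?(ltW e0)// expr2 ler_peMl//; lra.
  rewrite expr2 mulrA [leRHS]mulrC ler_wpM2r ?(ltW e0)//; lra.
- have h1 : eps <= C ^+ 2 * eps by rewrite ler_peMl ?(ltW e0)// expr_ge1//; lra.
  have h2 : C <= C ^+ 2 by rewrite expr2 ler_peMl//; lra.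
  have h3 : eps ^+ 2 <= eps by rewrite expr2 ler_piMl ?(ltW e0)//; lra.
  split; last by rewrite ler_wpM2l ?sqr_ge0.
  by apply: ler_pM; rewrite ?sqr_ge0//; lra.
Qed.

Let eps_cos (e x : R) : 0 <= e -> - e <= e * cos x <= e.
Proof.
move=> e0; have := ler_wpM2l e0 (cos_geN1 x); have := ler_wpM2l e0 (cos_le1 x).
by move=> h1 h2; apply/andP; split; lra.
Qed.

Let seed_ge (e x y b : R) : 0 <= e -> e <= 1 / 40 -> b <= e / 40 -> `|y| <= 8 * b ->
  1 / 2 <= 1 + 2 * e * cos x + y.
Proof.
move=> e0 e1 be; have /andP[x1 x2] := eps_cos x e0.
by rewrite ler_norml => /andP[y1 y2]; lra.
Qed.

Let seed_nrm_le (e b y : R) : 0 <= e -> e <= 1 / 40 -> b <= e / 40 -> y <= 8 * b ->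
  1 + 2 * e + y <= 2.
Proof. by move=> ? ? ? ?; lra. Qed.

Let eighth_le (e b : R) : 0 <= e -> b <= e / 40 -> 8 * b <= e / 2.
Proof. by move=> ? ?; lra. Qed.

Let profile_ge (e x y : R) : 0 <= e -> e <= 1 / 40 ->
  `|y - (1 + 2 * e * cos x)| <= e / 2 -> 1 / 2 <= y.
Proof.
move=> e0 e1; have /andP[x1 x2] := eps_cos x e0.
by rewrite ler_norml => /andP[y1 y2]; lra.
Qed.

Let amplitude_le (z u v : R) : `|u - v| <= 2 * (8 * z) * 2^-1 ^+ 0 -> `|v| <= 4 * z ->
  `|u| <= 20 * z.
Proof. by rewrite expr0 => h1 h2; have := ler_normD (u - v) v; rewrite subrK; lra. Qed.

Let perturbed_ge (z k1 k2 u1 u2 w b : R) : 40 * (z * (1 + (k1 + k2))) <= 1 -> 0 <= z ->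
  1 <= w -> 0 <= b -> `|u1| <= 20 * z * k1 -> `|u2| <= 20 * z * k2 ->
  1 / 2 <= w + (1 * b + u1 + u2).
Proof. by move=> h z0 w1 b0; rewrite !ler_norml => /andP[? _] /andP[? _]; lra. Qed.

Let close_limit (u v y b A : R) : `|y| <= 8 * b -> `|u - (v + y)| <= A ->
  `|u - v| - 8 * b <= A.
Proof.
move=> h1 h2; rewrite lerBlDl; have -> : u - v = (u - (v + y)) + y by ring.
by apply: le_trans (ler_normD _ _) _; lra.
Qed.

Lemma modulated_solution : exists (T g : R -> R) (om eps : R),
  [/\ [/\ continuous T, forall s, T (1 - s) = T s &
          exists2 a, 0 < a & forall s, s < a -> T s = 0],
      admissible (fun s => W0 s + T s) /\
      (forall s, 0 < s < 1 -> 1 / 2 <= W0 s + T s),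
      [/\ 0 < om, 0 < eps & forall X, `|g X - (1 + 2 * eps * cos X)| <= eps / 2],
      [/\ measurable_fun [set: R] g, forall X, 0 <= g X & forall X, g (X + 2 * pi) = g X] &
      forall gamma, exists2 c : R, 0 < c & forall k x, 0 < k -> 0 < x ->
        flux (hom_kernel gamma (fun s => W0 s + T s))
          (modulated gamma (fun t => k * g (om * t))) x = (k ^+ 2 * c)%:E].
Proof.
have [B [B1 [B2 [om [C [P /=]]]]]] := iteration_data.
set W := fun s => W0 s + _ => -[[tB tB1 tB2] [om0 C1] [aW aB1 aB2] [PW PB1 PB2] iter].
have [_ sB _ [aB aB0 zB]] := tB.
have [cB1 sB1 [Kb1 hb1] [a1 a10 zB1]] := tB1.
have [cB2 sB2 [Kb2 hb2] [a2 a20 zB2]] := tB2.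
have kb1 : 0 <= Kb1 by have /andP[/le_trans h /h] := hb1 0.
have kb2 : 0 <= Kb2 by have /andP[/le_trans h /h] := hb2 0.
have [eps [[e0 He] e40 Ceps [CC C2eps] CK]] := small_amplitude C1 (addr_ge0 kb1 kb2).
have half_ge0 : 0 <= 1 / 2 :> R by rewrite divr_ge0.
have C2e : 0 <= C ^+ 2 * eps by rewrite mulr_ge0 ?sqr_ge0// ltW.
have C2k1 : 0 <= C ^+ 2 * eps * Kb1 by rewrite mulr_ge0.
have C2k2 : 0 <= C ^+ 2 * eps * Kb2 by rewrite mulr_ge0.
have [Ls [t1 [t2 [c [hL hD ht hdt hq]]]]] := iter eps e0 He.
clear He.
(* One constant dominating the geometric bounds on corrections, amplitudes and residual. *)
pose A := 8 * (C ^+ 2 * eps).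
have A0 : 0 <= A by rewrite /A; lra.
have A4 : 4 * A <= 1 by rewrite /A; lra.
have evL n X : `|ev X (Ls n)| <= 8 * (C * eps ^+ 2).
  by apply: le_trans (norm_ev _ _) _; rewrite mulrA.
have h2n n : 0 <= 2^-1 ^+ n :> R by rewrite exprn_ge0.
have s1 n : exists2 E, total eps (Ls n.+1) = total eps (Ls n) ++ E &
    nrm (fun=> 1) E <= A * 2^-1 ^+ n.
  have [E -> hE] := hD n; exists E; first by rewrite /total !catA.
  by apply: le_trans hE _; rewrite ler_wpM2r// /A; lra.
have s2 n : nrm (fun=> 1) (total eps (Ls n)) <= 2.
  rewrite nrm_total ?(ltW e0)//; have := hL n; rewrite -mulrA.
  exact: seed_nrm_le (ltW e0) e40 Ceps.
have s3 n (X : R) : 1 / 2 <= ev X (total eps (Ls n)).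
  by rewrite ev_total; exact: seed_ge (ltW e0) e40 Ceps (evL n X).
have s4 n : `|t1 n.+1 - t1 n| <= A * 2^-1 ^+ n.
  by have [h _] := hdt n; apply: le_trans h _; rewrite ler_wpM2r// /A -mulrA ler_wpM2r ?ler_nat.
have s5 n : `|t2 n.+1 - t2 n| <= A * 2^-1 ^+ n.
  by have [_ h] := hdt n; apply: le_trans h _; rewrite ler_wpM2r// /A -mulrA ler_wpM2r ?ler_nat.
have s6 n X : `|quad (pair_coef om W) (pair_coef om B1) (pair_coef om B2) (t1 n) (t2 n) X (total eps (Ls n)) - c n| <= A * 2^-1 ^+ n.
  by apply: le_trans (hq n X) _; rewrite ler_wpM2r// /A -mulrA ler_wpM2l.
have sW s : W (1 - s) = W s by rewrite /W base_weight_sym sB.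
have [g [T1 [T2 [hg hT [mg g0] gper flx]]]] := limit_solution om0 A0 A4 aW aB1 aB2 sW sB1 sB2
  PW PB1 PB2 s1 s2 s3 s4 s5 s6.
pose T s := 1 * B s + T1 * B1 s + T2 * B2 s.
have TE : (fun s => (W s + T1 * B1 s) + T2 * B2 s) = fun s => W0 s + T s.
  by apply/funext => s; rewrite /W /T; ring.
have T1b : `|T1| <= 20 * (C ^+ 2 * eps).
  have [h _] := hT 0%N; have [h' _] := ht 0%N; rewrite -mulrA in h'.
  exact: amplitude_le h h'.
have T2b : `|T2| <= 20 * (C ^+ 2 * eps).
  have [_ h] := hT 0%N; have [_ h'] := ht 0%N; rewrite -mulrA in h'.
  exact: amplitude_le h h'.
(* The amplitudes [T1], [T2] have no definite sign; the base weight, which is at least 1, pays for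
   them. *)
have half s : 0 < s < 1 -> 1 / 2 <= W0 s + T s.
  move=> s01; have /andP[b1 b1'] := hb1 s; have /andP[b2 b2'] := hb2 s.
  have w1 := base_weight_ge1 beta_lo s01; 
  have B0' : 0 <= B s by have [_ _ [Kb /(_ s)/andP[]]] := tB.
  have n1 : `|T1 * B1 s| <= 20 * (C ^+ 2 * eps) * Kb1.
    by rewrite normrM; apply: ler_pM => //; rewrite ger0_norm.
  have n2 : `|T2 * B2 s| <= 20 * (C ^+ 2 * eps) * Kb2.
    by rewrite normrM; apply: ler_pM => //; rewrite ger0_norm.
  exact: perturbed_ge CK C2e w1 B0' n1 n2.
have aT : admissible (fun s => W0 s + T s).
  rewrite -TE; have [mW w00 iW] := aW; have [mB1 _ iB1] := aB1; have [mB2 _ iB2] := aB2.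
  split.
  - by apply: measurable_funD; [apply: measurable_funD => //|]; apply: measurable_funM.
  - move=> s s01; rewrite (_ : W s + _ + _ = W0 s + T s); last by rewrite /W /T; ring.
    exact: le_trans half_ge0 (half s s01).
  - by apply: weight_integrableD => //; exact: weight_integrableD.
(* The corrections add up to O(eps^2), so the seed 2 eps cos X dominates and [g] cannot be
   constant. *)
have gb X : `|g X - (1 + 2 * eps * cos X)| <= eps / 2.
  apply: le_trans (_ : _ <= 8 * (C * eps ^+ 2)) (eighth_le (ltW e0) Ceps).
  rewrite -subr_le0; apply: (@le_geometric0 _ _ (2 * A)) => n.
  by have := hg X n; rewrite ev_total => /(close_limit (evL n X)).
exists T, g, om, eps; split => //.
- split.
  + move=> s; apply: cvgD; [apply: cvgD|]; apply: cvgM; try exact: cvg_cst;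
      [have [cB _ _ _] := tB; exact: cB|exact: cB1|exact: cB2].
  + by move=> s; rewrite /T sB sB1 sB2.
  + exists (Num.min aB (Num.min a1 a2)); first by rewrite !lt_min aB0 a10.
    move=> s; rewrite !lt_min => /and3P[q0 q1 q2].
    by rewrite /T zB// zB1// zB2// !mulr0 !addr0.
move=> gamma; have [|a ha] := flx _ gamma.
  move=> s s01; rewrite (_ : W s + _ + _ = W0 s + T s); last by rewrite /W /T; ring.
  exact: le_trans half_ge0 (half s s01).
rewrite TE in ha; exists a => //.
have sT s : W0 (1 - s) + T (1 - s) = W0 s + T s.
  by rewrite base_weight_sym /T sB sB1 sB2.
(* The constant flux of [g] is positive: by monotonicity it is at least that of the constant 1 / 2,
   which lies below [g]. *)
have fc := @flux_const R gamma _ (1 / 2) 1 ltr01 half_ge0 aT sT.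
have : (flux (hom_kernel gamma (fun s => W0 s + T s)%R) (modulated gamma (fun=> 1 / 2)%R) 1 <=
   flux (hom_kernel gamma (fun s => W0 s + T s)%R) (modulated gamma (fun t => 1 * g (om * t))%R) 1)%E.
  apply: flux_le => [s s01|t]; first exact: le_trans half_ge0 (half s s01).
  by rewrite half_ge0 [1 * g _]mul1r; exact: profile_ge (ltW e0) e40 (gb (om * t)).
rewrite fc (ha 1 1 ltr01 ltr01) expr1n [1 * a]mul1r lee_fin; apply: lt_le_trans.
by rewrite mulr_gt0 ?exprn_gt0 ?mean_coef_gt0//; lra.
Qed.

End Existence.

(** * Membership in the kernel class *)

Section KernelClass.
Context {R : realType}.

Lemma profile_hom gamma (W : R -> R) s :
  profile (hom_kernel gamma W) s = W s * (s * (1 - s)) `^ ((3 + gamma) / 2).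
Proof. by rewrite /profile /hom_kernel subrKC powR1 mul1r !divr1. Qed.

Let cvg_powR (I : Type) (F : set_system I) (h : I -> R) (a e : R) : Filter F ->
  0 < a -> h @ F --> a -> h x `^ e @[x --> F] --> a `^ e.
Proof. move=> FF a0 ha.
exact: (@continuous_cvg I R R F FF h (fun y => y `^ e) a (continuous_powR a0) ha). Qed.

Lemma continuous_base_weight (beta s : R) : 0 < s < 1 ->
  {for s, continuous (base_weight beta)}.
Proof.
move=> /andP[s0 s1].
have c1 : 1 - x @[x --> s] --> 1 - s by apply: cvgB; [exact: cvg_cst|exact: cvg_id].
have cM : Num.max x (1 - x) @[x --> s] --> Num.max s (1 - s).
  exact: (@continuous_max R R id (fun x => 1 - x) s cvg_id c1).
have cm : Num.min x (1 - x) @[x --> s] --> Num.min s (1 - s).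
  exact: (@continuous_min R R id (fun x => 1 - x) s cvg_id c1).
have m0 : 0 < Num.min s (1 - s) by rewrite lt_min s0 subr_gt0.
apply: cvgM; first by apply: cvgV => //; rewrite gt_eqF// lt_max s0.
exact: cvg_powR m0 cm.
Qed.

Variables (gamma p beta : R) (T : R -> R).
Hypothesis betaE : beta = (3 + gamma) / 2 + p.
Hypothesis cT : continuous T.
Hypothesis symT : forall s, T (1 - s) = T s.
Hypothesis nearT : exists2 a : R, 0 < a & forall s, s < a -> T s = 0.
Let W s := base_weight beta s + T s.
Hypothesis W_gt0 : forall s, 0 < s < 1 -> 0 < W s.

Let continuous_W (s : R) : 0 < s < 1 -> {for s, continuous W}.
Proof. by move=> s01; apply: cvgD; [exact: continuous_base_weight|exact: cT]. Qed.

Let W_sym s : W (1 - s) = W s.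
Proof. by rewrite /W base_weight_sym symT. Qed.

Lemma hom_kernel_class : in_kernel_class gamma p (hom_kernel gamma W).
Proof.
split.
- split.
    apply: continuous_in_subspaceT => z /set_mem[z1 z2].
    have cD : x.1 + x.2 @[x --> z] --> z.1 + z.2.
      by apply: cvgD; [exact: cvg_fst|exact: cvg_snd].
    have zD : 0 < z.1 + z.2 by rewrite addr_gt0.
    have cs : x.1 / (x.1 + x.2) @[x --> z] --> z.1 / (z.1 + z.2).
      by apply: cvgM; [exact: cvg_fst|apply: cvgV => //; rewrite gt_eqF].
    have s01 : 0 < z.1 / (z.1 + z.2) < 1.
      by rewrite divr_gt0//= ltr_pdivrMr// mul1r ltrDl.
    have /andP[s0 s1] := s01.
    apply: cvgM.
      exact: cvg_powR zD cD.
    apply: cvgM; first exact: (@continuous_cvg _ R R _ _ _ W _ (continuous_W s01) cs).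
    apply: cvg_powR; first by rewrite mulr_gt0// subr_gt0.
    by apply: cvgM => //; apply: cvgB => //; exact: cvg_cst.
  rewrite (_ : profile _ = fun s => W s * (s * (1 - s)) `^ ((3 + gamma) / 2)); last first.
    by apply/funext => s; exact: profile_hom.
  apply: continuous_in_subspaceT => s; rewrite inE/= in_itv/= => s01.
  have /andP[s0 s1] := s01.
  apply: cvgM; first exact: continuous_W.
  apply: cvg_powR; first by rewrite mulr_gt0// subr_gt0.
  by apply: cvgM; [exact: cvg_id|apply: cvgB; [exact: cvg_cst|exact: cvg_id]].
- by move=> x y x0 y0; rewrite profile_hom.
- by move=> s _; rewrite !profile_hom W_sym subKr (mulrC s).
- move=> s s01; have /andP[s0 s1] := s01.
  by rewrite profile_hom mulr_gt0 ?W_gt0// powR_gt0// mulr_gt0// subr_gt0.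
(* Near 0 the bumps vanish and the powers of s cancel by [betaE]; what is left of s^p Phi(s) is (1 -
   s)^((3 + gamma) / 2 - 1), with limit 1. *)
- exists 1 => //; have [a a0 Ta] := nearT.
  apply: (@cvg_trans _ ((1 - s) `^ ((3 + gamma) / 2 - 1) @[s --> 0^'+])).
    apply: near_eq_cvg; near=> s.
    have s0 : 0 < s by near: s; exact: nbhs_right_gt.
    have sa : s < a by near: s; exact: nbhs_right_lt.
    have sh : s < 1 / 2 by near: s; apply: nbhs_right_lt; lra.
    have s10 : 0 < 1 - s by lra.
    rewrite profile_hom /W Ta// addr0.
    have -> : base_weight beta s = s `^ (- beta) / (1 - s).
      have h : (1 - s) * base_weight beta s = s `^ (- beta).
        by apply: base_weight_left; rewrite s0 ltW.
      by rewrite -h; field; rewrite gt_eqF.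
    rewrite powRM ?ltW// powRB ?(gt_eqF s10) ?implybT// powRr1 ?(ltW s10)//.
    have e : s `^ p * s `^ (- beta) * s `^ ((3 + gamma) / 2) = 1.
      rewrite -!powRD ?(gt_eqF s0) ?implybT//.
      have -> : p - beta + (3 + gamma) / 2 = 0 by rewrite betaE; ring.
      by rewrite powRr0.
    rewrite -[LHS]mul1r -[X in X * _ = _]e; ring.
  apply: cvg_at_right_filter.
  have c1 : 1 - x @[x --> (0 : R)] --> (1 : R).
    by rewrite -[X in _ --> X](subr0 (1 : R)); apply: cvgB; [exact: cvg_cst|exact: cvg_id].
  by have := cvg_powR (e := (3 + gamma) / 2 - 1) _ ltr01 c1; rewrite powR1; apply.
Unshelve. all: by end_near.
Qed.

End KernelClass.

(** * The power law coefficient, and profiles that are not power laws *)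

Section PowerLaw.
Context {R : realType}.
Local Notation mu := (@lebesgue_measure R).

(** The factor y of the flux lowers the exponent of y from (3 + gamma) / 2 to (gamma + 1) / 2. So
    the normalising integral is the flux at 1 of the bare power law, and the flux formula evaluates
    it. *)
Lemma b_integral_flux (gamma : R) (K : R -> R -> R) :
  (forall x y, 0 < x -> 0 < y -> K x y = (x + y) `^ gamma * profile K (x / (x + y))) ->
  b_integral (profile K) gamma = flux K (power_law 1 gamma) 1.
Proof.
move=> hK; apply: eq_integral => y /set_mem/=; rewrite in_itv/= => /andP[y0 y1].
apply: eq_integral => z /set_mem/=; rewrite in_itv/= andbT => zy.
have z0 : 0 < z by lra.
congr EFin; rewrite hK// /power_law.
have -> : y `^ ((3 + gamma) / 2) = y `^ ((gamma + 1) / 2) * y.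
  rewrite -{3}[y](powRr1 (ltW y0)) -powRD ?(gt_eqF y0) ?implybT//.
  by congr powR; field.
rewrite (addrC 3).
have py : y `^ ((gamma + 1) / 2) != 0 by rewrite gt_eqF// powR_gt0.
have pz : z `^ ((gamma + 3) / 2) != 0 by rewrite gt_eqF// powR_gt0.
by field; rewrite py pz gt_eqF.
Qed.

Lemma measurable_modulated gamma (G : R -> R) : measurable_fun [set: R] G ->
  measurable_fun [set: R] (modulated gamma G).
Proof.
move=> mG; apply: measurable_funM.
  by apply: (measurableT_comp mG); exact: measurable_ln.
by apply: (measurableT_comp (@measurable_inv R)); exact: measurable_powR.
Qed.

Lemma ae_itv (P : R -> Prop) (a b : R) : a < b -> {ae mu, forall x, P x} ->
  exists2 x, a < x < b & P x.
Proof.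
move=> ab aeP; apply: contrapT => h.
have : mu.-negligible `]a, b[.
  apply: negligibleS aeP => x /=; rewrite in_itv/= => xab Px.
  by apply: h; exists x.
have mab : measurable (`]a, b[%classic : set (measurableTypeR R)) by exact: measurable_itv.
have hl : (mu `]a, b[%classic = (b - a)%:E)%E.
  by rewrite lebesgue_measure_itv/= lte_fin ab EFinB.
rewrite (negligibleP mu mab) => h0; have := etrans (esym hl) h0 => -[] /eqP.
by rewrite subr_eq0 gt_eqF.
Qed.

(** A power law would make [g] constant almost everywhere over a period. But [g] is at least 1 + eps
    / 2 on an interval of phases after 0 and at most 1 - eps / 2 on one before pi, and neither
    interval is a null set. *)
Lemma modulated_not_power_law (g : R -> R) (om eps k gamma C : R) :
  0 < om -> 0 < eps -> 0 < k ->
  (forall X, `|g X - (1 + 2 * eps * cos X)| <= eps / 2) ->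
  ~ {ae mu, forall x, 1 < x < expR (2 * pi / om) ->
      modulated gamma (fun t => k * g (om * t)) x = power_law C gamma x}.
Proof.
move=> om0 e0 k0 hg aeC.
have p2 := @pi_ge2 R.
have pick (u v : R) : 0 <= u -> u < v -> v < 2 * pi ->
    exists2 X, u < X < v & k * g X = C.
  move=> u0 uv v2.
  have uv' : expR (u / om) < expR (v / om) by rewrite ltr_expR ltr_pM2r ?invr_gt0.
  have [x /andP[ux xv] hx] := ae_itv uv' aeC.
  have x0 : 0 < x := lt_trans (expR_gt0 _) ux.
  have l1 : u < om * ln x.
    by rewrite mulrC -ltr_pdivrMr// -ltr_expR lnK// posrE.
  have l2 : om * ln x < v.
    by rewrite mulrC -ltr_pdivlMr// -ltr_expR lnK// posrE.
  exists (om * ln x); first by rewrite l1 l2.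
  have := hx _; rewrite /modulated /power_law => h.
  apply: (@mulIf _ (x `^ ((3 + gamma) / 2))^-1); first by rewrite invr_neq0// gt_eqF// powR_gt0.
  apply: h; apply/andP; split.
    by apply: le_lt_trans ux; rewrite -expR0 ler_expR divr_ge0// ltW.
  by apply: lt_trans xv _; rewrite ltr_expR ltr_pM2r ?invr_gt0.
have half : (0 : R) < 1 / 2 by lra.
have [|X1 /andP[a1 b1] h1] := pick 0 (1 / 2) (lexx 0) half; first lra.
have [||| X2 /andP[a2 b2] h2] := pick (pi - 1 / 2) pi; try lra.
have c1 : 1 / 2 <= cos X1.
  have := cos_lipschitz 0 X1; rewrite cos0 sub0r normrN (gtr0_norm a1) ler_norml => /andP[_ ?]; lra.
have c2 : cos X2 <= - (1 / 2).
  have := cos_lipschitz X2 pi; rewrite cospi.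
  have -> : `|X2 - pi| = pi - X2 by rewrite distrC ger0_norm//; lra.
  by rewrite ler_norml => /andP[_ ?]; lra.
have e1 : eps * (1 / 2) <= eps * cos X1 by rewrite ler_pM2l.
have e2 : eps * cos X2 <= eps * - (1 / 2) by rewrite ler_pM2l.
have g12 : g X2 < g X1.
  have := hg X1; have := hg X2; rewrite !ler_norml => /andP[_ u] /andP[v _]; lra.
have := h1; rewrite -h2 => /(mulfI (lt0r_neq0 k0)) E; rewrite E ltxx in g12.
by [].
Qed.

End PowerLaw.

(** * From the resonant weight to the theorem *)

Section Conclusion.
Context {R : realType}.

Lemma resonant_kernel (gamma p : R) : 0 <= gamma + 2 * p < 1 ->
  exists (K : coag_kernel gamma p) (g : R -> R) (om eps I c : R),
  [/\ [/\ 0 < om, 0 < eps & forall X, `|g X - (1 + 2 * eps * cos X)| <= eps / 2],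
      [/\ measurable_fun [set: R] g, forall X, 0 <= g X & forall X, g (X + 2 * pi) = g X],
      0 < I /\ 0 < c,
      forall y x, 0 < x -> 0 <= y -> flux K (power_law y gamma) x = (y ^+ 2 * I)%:E &
      forall k x, 0 < k -> 0 < x ->
        flux K (modulated gamma (fun t => k * g (om * t))) x = (k ^+ 2 * c)%:E].
Proof.
move=> /andP[hg0 hg1].
(* As beta = 3 / 2 + (gamma + 2 p) / 2, the hypothesis is exactly 3 / 2 <= beta < 2. *)
pose beta := (3 + gamma) / 2 + p.
have beta_lo : 3 / 2 <= beta by rewrite /beta; lra.
have beta_hi : beta < 2 by rewrite /beta; lra.
have [T [g [om [eps [[cT sT nT] [aW half] hom hg flx]]]]] :=
  modulated_solution beta_lo beta_hi.
pose W s := base_weight beta s + T s.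
have W0 s : 0 < s < 1 -> 0 < W s by move=> /half; rewrite -/(W s); lra.
have sW s : W (1 - s) = W s by rewrite /W base_weight_sym sT.
have [c c0 fluxg] := flx gamma.
exists (CoagKernel (hom_kernel_class (erefl beta) cT sT nT W0)), g, om, eps.
exists (\int[lebesgue_measure]_(s in `]0%R, 1%R[) ((1 - s) * W s * loglen s)), c.
split; [exact: hom|exact: hg|split; [exact: mean_coef_gt0|exact: c0]| |exact: fluxg].
by move=> y x x0 y0; exact: (flux_const gamma x0 y0 aW sW).
Qed.

End Conclusion.

Unset Implicit Arguments.

Theorem theorem1p1 (R : realType) (J0 gamma p : R)
    (hJ0 : 0 < J0) (hgp : 0 <= gamma + 2 * p < 1) :
  exists (delta : R) (K : R -> coag_kernel gamma p) (Q : R),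
    [/\ 0 < delta,
        {within `]- delta, delta[, continuous K},
        1 < Q &
        forall d : R, - delta < d < delta -> d != 0 ->
          let C0 := b_coef (profile (K d)) gamma * Num.sqrt J0 in
          solution (K d) J0 (power_law C0 gamma) /\
          exists f : R -> R,
            [/\ solution (K d) J0 f,
                ~ {ae lebesgue_measure, forall x : R,
                     0 < x -> f x = power_law C0 gamma x},
                forall x, 0 < x ->
                  f (Q * x) = Q `^ (- ((gamma + 3) / 2)) * f x &
                ~ exists2 C : R, 0 < C &
                  {ae lebesgue_measure, forall x : R,
                     1 < x < Q -> f x = power_law C gamma x}]].
Proof.
have [K [g [om [eps [I [c [[om0 e0 hg] [mg g0 gper] [I0 c0] fluxC fluxg]]]]]]] :=
  resonant_kernel hgp.
have bE : b_coef (profile K) gamma = I `^ (- 2^-1).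
  have [_ hK _ _ _] := kernelP K.
  by rewrite /b_coef b_integral_flux// fluxC// expr1n mul1r.
(* Multiplying x by e^(2 pi / om) advances om ln x by one period of [g]. *)
exists 1, (fun=> K), (expR (2 * pi / om)); split => //.
- by apply: continuous_subspaceT => x; exact: cvg_cst.
- by rewrite -expR0 ltr_expR divr_gt0// mulr_gt0// pi_gt0.
move=> d _ _ C0.
have C00 : 0 < C0 by rewrite /C0 bE mulr_gt0 ?powR_gt0// sqrtr_gt0.
have C0E : C0 ^+ 2 * I = J0.
  rewrite /C0 bE exprMn sqr_sqrtr ?(ltW hJ0)// -powR_mulrn ?powR_ge0// -powRrM.
  have -> : - 2^-1 * 2 = -1 :> R by field.
  by rewrite powR_inv1 ?(ltW I0)// mulrAC mulVf ?mul1r// gt_eqF.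
split.
  split.
  - apply: measurable_funTS; apply: (measurable_modulated gamma (G := fun=> C0)).
    exact: measurable_cst.
  - by move=> x x0; rewrite /power_law divr_ge0 ?powR_ge0// ltW.
  - by move=> x x0; rewrite fluxC ?(ltW C00)// C0E.
(* The flux is quadratic in the solution, so this scaling moves its constant value from [c] to
   [J0]. *)
pose k := Num.sqrt (J0 / c).
have k0 : 0 < k by rewrite sqrtr_gt0 divr_gt0.
have notpl C : ~ {ae lebesgue_measure, forall x : R, 1 < x < expR (2 * pi / om) ->
    modulated gamma (fun t => k * g (om * t)) x = power_law C gamma x}.
  exact: (modulated_not_power_law om0 e0 k0 hg).
exists (modulated gamma (fun t => k * g (om * t))); split.
- split.
  + apply: measurable_funTS; apply: measurable_modulated; apply: measurable_funM => //.
    by apply: (measurableT_comp mg); exact: measurable_funM.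
  + by move=> x _; rewrite /modulated divr_ge0 ?powR_ge0// mulr_ge0// ltW.
  + move=> x x0; rewrite fluxg// sqr_sqrtr ?divr_ge0 ?(ltW c0) ?(ltW hJ0)//.
    by rewrite divfK// gt_eqF.
- move=> h; apply: (notpl C0); apply: negligibleS h => x /= hx hP; apply: hx => /andP[x1 _].
  by apply: hP; exact: lt_trans x1.
- move=> x x0; rewrite /modulated lnM ?posrE ?expR_gt0// expRK powRM ?(ltW x0) ?expR_ge0//.
  have -> : om * (2 * pi / om + ln x) = om * ln x + 2 * pi by field; rewrite gt_eqF.
  by rewrite gper powRN (addrC 3) invfM; ring.
- by move=> [C _ /notpl].
Qed.
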